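(* Consider an SRBM in $E=\mathbb R_+^d$ with drift $\mu\in\mathbb R^d$, symmetric positive definite covariance matrix $\Sigma$, nonsingular completely-$\mathcal S$ reflection matrix $R$, and stationary probability $\pi_0$. Assume that the process is strong Markov, that its transition semigroup $(P_t)$ is Feller on $C_0(E)$, that there are a locally bounded function $V:E\to[1,\infty)$ and constants $M,\kappa>0$ with $$\|P_t(x,\cdot)-\pi_0\|_{\mathrm{TV}}\le M V(x)e^{-\kappa t},\qquad x\in E,\ t\ge 0,$$ and that $\sup_{x\in E}\mathbb E_xY_i(1)<\infty$ for $i=1,\dots,d$, where $Y$ is the regulator. If the principal submatrix $R_{AA}$ is singular for some nonempty proper set $A\subsetneq\{1,\dots,d\}$, then signed BAR uniqueness fails. More precisely, there exists a finite signed BAR tuple $(\overline\pi,\overline\nu_1,\dots,\overline\nu_d)$ such that $$\overline\pi(E)=0,\qquad \overline\pi\ne 0.$$ Consequently $\overline\pi$ is not a scalar multiple of $\pi_0$.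
   Context: $E=[0,\infty)^d$, $E^\circ=(0,\infty)^d$, $F_i=\{x\in E:x_i=0\}$. A square matrix $A$ is an $\mathcal S$ matrix if there is a vector $u>0$ (componentwise) with $Au>0$; it is completely-$\mathcal S$ if every principal submatrix is an $\mathcal S$ matrix. An SRBM with data $(\mu,\Sigma,R)$ is a continuous $E$-valued process with laws $\mathbb P_x$ ($x\in E$, $Z(0)=x$ under $\mathbb P_x$) of the form $Z(t)=Z(0)+\mu t+\Sigma^{1/2}W(t)+RY(t)$, where $W$ is a standard Brownian motion and the regulator $Y=(Y_1,\dots,Y_d)$ is adapted, with each $Y_i$ continuous, nondecreasing, $Y_i(0)=0$, increasing only when $Z\in F_i$. $P_t(x,\cdot)$ is the law of $Z(t)$ under $\mathbb P_x$ and $P_th(x)=\mathbb E_x[h(Z(t))]$. $C_0(E)$ is the space of continuous functions vanishing at infinity; $(P_t)$ is Feller on $C_0(E)$ if $P_tC_0(E)\subset C_0(E)$ and $\|P_th-h\|_\infty\to0$ as $t\downarrow0$ for all $h\in C_0(E)$. $\|\eta\|_{\mathrm{TV}}=|\eta|(E)$. $C_b^2(E)$ is the set of bounded $f:E\to\mathbb R$ that are $C^2$ on $E^\circ$ with all partial derivatives of order $\le2$ bounded and extending continuously to $E$. $Lf=\mu\cdot\nabla f+\tfrac12\sum_{j,k}\Sigma_{jk}\partial_{jk}f$ and $D_if=R_i\cdot\nabla f$, with $R_i$ the $i$th column of $R$. A finite signed BAR tuple is a tuple $(\overline\pi,\overline\nu_1,\dots,\overline\nu_d)$ of finite signed Radon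 measures on $E,F_1,\dots,F_d$ such that $\int_E Lf\,d\overline\pi+\sum_{i}\int_{F_i}D_if\,d\overline\nu_i=0$ for all $f\in C_b^2(E)$. $R_{AA}$ is the submatrix with rows and columns in $A$. *)

(* Defs.v *)
From HB Require Import structures.
From mathcomp Require Import all_boot all_order all_algebra.
From mathcomp Require Import all_classical all_reals all_analysis measurable_realfun.
Import Order.TTheory GRing.Theory Num.Theory.
Import numFieldNormedType.Exports.

Set Implicit Arguments.
Unset Strict Implicit.
Unset Printing Implicit Defensive.

Local Open Scope classical_set_scope.
Local Open Scope ring_scope.

Section matrices.
Context {R : realType}.

Definition symmx n (A : 'M[R]_n) := A^T = A.

Definition posdefmx n (A : 'M[R]_n) :=
  symmx A /\ forall v : 'cV[R]_n, v != 0 -> 0 < (v^T *m A *m v) 0 0.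

Definition possemidefmx n (A : 'M[R]_n) :=
  symmx A /\ forall v : 'cV[R]_n, 0 <= (v^T *m A *m v) 0 0.

(* [S] is "the" square root A^{1/2}; it is unique when it exists. *)
Definition is_sqrtmx n (S A : 'M[R]_n) := possemidefmx S /\ S *m S = A.

Definition principal_submx n (A : 'M[R]_n) (J : {set 'I_n}) : 'M[R]_#|J| :=
  mxsub enum_val enum_val A.

Definition Smatrix n (A : 'M[R]_n) :=
  exists u : 'cV[R]_n, (forall i, 0 < u i 0) /\ (forall i, 0 < (A *m u) i 0).

(* For J empty the condition is vacuously true. *)
Definition completely_S n (A : 'M[R]_n) :=
  forall J : {set 'I_n}, Smatrix (principal_submx A J).

End matrices.

Section charges.
Context {d} {T : measurableType d} {R : realType}.
Implicit Types (nu : {charge set T -> \bar R}) (D : set T).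

Definition hahn_pos nu : set T := sval (cid (Hahn_decomposition nu)).
Definition hahn_neg nu : set T := sval (cid (svalP (cid (Hahn_decomposition nu)))).

Lemma hahnP nu : hahn_decomposition nu (hahn_pos nu) (hahn_neg nu).
Proof. exact: svalP (cid (svalP (cid (Hahn_decomposition nu)))). Qed.

Definition tv_norm nu : \bar R := charge_variation (hahnP nu) setT.

(* Integral against the Jordan decomposition of nu; like [tv_norm], it does
   not depend on the Hahn decomposition that was chosen. *)
Definition charge_integral nu D (f : T -> R) : R :=
  \int[jordan_pos (hahnP nu)]_(x in D) f x -
  \int[jordan_neg (hahnP nu)]_(x in D) f x.

Definition supported_on nu D :=
  forall B, measurable B -> B `&` D = set0 -> nu B = 0%E.

End charges.

(* R^d with its Borel sigma-algebra. Measures on E or on F_i are represented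
   by measures on R^d that vanish off that closed set; finite Borel (signed)
   measures on these spaces are automatically Radon. *)
Notation borel R d := (g_sigma_algebraType (@open 'cV[R]_d)).

Section orthant.
Context {R : realType} {d : nat}.

Definition orthant : set 'cV[R]_d := [set x | forall i, 0 <= x i 0].
Definition oorthant : set 'cV[R]_d := [set x | forall i, 0 < x i 0].
Definition face (i : 'I_d) : set 'cV[R]_d := [set x | orthant x /\ x i 0 = 0].

End orthant.

Section test_functions.
Context {R : realType} {d : nat}.
Implicit Types (f h : 'cV[R]_d -> R) (j k : 'I_d).

Definition partial j f : 'cV[R]_d -> R := 'D_(delta_mx j 0) f.

Definition extends_to_orthant h := exists g : 'cV[R]_d -> R,
  {within orthant, continuous g} /\ (forall x, oorthant x -> g x = h x).

(* On the closed orthant, the continuous extension of the restriction of [h]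
   to the open orthant. *)
Definition extension h : 'cV[R]_d -> R :=
  fun x => lim (h y @[y --> within oorthant (nbhs x)]).

Definition bounded_and_extends h :=
  [bounded h x | x in oorthant] /\ extends_to_orthant h.

(* The partial derivatives exist on the open orthant, and their continuity
   there is part of [extends_to_orthant]. *)
Definition Cb2 f := [/\
  {within orthant, continuous f} /\ [bounded f x | x in orthant],
  forall j x, oorthant x -> derivable f x (delta_mx j 0),
  forall j k x, oorthant x -> derivable (partial k f) x (delta_mx j 0),
  forall j, bounded_and_extends (partial j f) &
  forall j k, bounded_and_extends (partial j (partial k f))].

Definition generator (mu : 'cV[R]_d) (Sigma : 'M[R]_d) f : 'cV[R]_d -> R :=
  fun x => \sum_j mu j 0 * extension (partial j f) x +
    2^-1 * \sum_j \sum_k Sigma j k * extension (partial j (partial k f)) x.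

Definition reflection_op (Rmat : 'M[R]_d) (i : 'I_d) f : 'cV[R]_d -> R :=
  fun x => \sum_j Rmat j i * extension (partial j f) x.

Definition signed_BAR_tuple (mu : 'cV[R]_d) (Sigma Rmat : 'M[R]_d)
    (pi : {charge set (borel R d) -> \bar R})
    (nu : 'I_d -> {charge set (borel R d) -> \bar R}) := [/\
  supported_on pi orthant,
  forall i, supported_on (nu i) (face i) &
  forall f, Cb2 f ->
    charge_integral pi orthant (generator mu Sigma f) +
    \sum_i charge_integral (nu i) (face i) (reflection_op Rmat i f) = 0].

End test_functions.

(* Times range over [0, oo): values at negative times are irrelevant. *)

Section filtrations.
Context {R : realType} {dO} {Omega : measurableType dO}.
Implicit Types (F : R -> set (set Omega)) (tau : Omega -> \bar R).

Definition filtration F := [/\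
  forall t, 0 <= t -> sigma_algebra setT (F t),
  forall t, 0 <= t -> F t `<=` measurable &
  forall s t, 0 <= s -> s <= t -> F s `<=` F t].

Definition adapted F {d'} {T : measurableType d'} (X : R -> Omega -> T) :=
  forall t, 0 <= t -> preimage_set_system setT (X t) measurable `<=` F t.

Definition stopping_time F tau :=
  (forall w, 0 <= tau w)%E /\
  (forall t, 0 <= t -> F t [set w | tau w <= t%:E]%E).

Definition stopped_events F tau : set (set Omega) :=
  [set A | measurable A /\
    forall t, 0 <= t -> F t (A `&` [set w | tau w <= t%:E]%E)].

(* Standard d-dimensional F-Brownian motion. For s < t, the increment on
   [s, t] is independent of F s, with independent N(0, t - s) coordinates. *)
Definition brownian_motion F {d : nat} (Pr : probability Omega R)
    (W : R -> Omega -> borel R d) := [/\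
  adapted F W,
  {ae Pr, forall w, W 0 w = 0 :> 'cV[R]_d},
  {ae Pr, forall w, {within `[0, +oo[, continuous (fun t => W t w : 'cV[R]_d)}} &
  forall s t, 0 <= s -> s < t -> forall A, F s A ->
    forall B : 'I_d -> set R, (forall i, measurable (B i)) ->
    Pr (A `&` [set w | forall i, B i ((W t w - W s w : 'cV[R]_d) i 0)]) =
    (Pr A * \big[*%E/1%E]_i normal_prob 0 (Num.sqrt (t - s)) (B i))%E].

End filtrations.

Section SRBM.
Context {R : realType} {d : nat} {dO} {Omega : measurableType dO}.
Variables (F : R -> set (set Omega)) (P : borel R d -> probability Omega R).
Variables (Z : R -> {mfun Omega >-> borel R d}).

(* A path [y] of Y_i along a path [z] of Z: it is constant on every time
   interval during which z stays away from F_i. *)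
Definition regulator_path (i : 'I_d) (z : R -> 'cV[R]_d) (y : R -> R) := [/\
  {within `[0, +oo[, continuous y},
  y 0 = 0,
  forall s t, 0 <= s -> s <= t -> y s <= y t &
  forall s t, 0 <= s -> s <= t ->
    (forall u, s <= u <= t -> ~ face i (z u)) -> y s = y t].

(* The laws P x are only relevant for x in the orthant. *)
Record is_SRBM (mu : 'cV[R]_d) (Sigma Rmat : 'M[R]_d)
    (W Y : R -> Omega -> borel R d) : Prop := {
  srbm_filtration : filtration F;
  srbm_adapted : adapted F Z;
  srbm_orthant : forall t w, 0 <= t -> orthant (Z t w);
  srbm_continuous :
    forall w, {within `[0, +oo[, continuous (fun t => Z t w : 'cV[R]_d)};
  srbm_start : forall x, orthant x -> {ae P x, forall w, Z 0 w = x};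
  srbm_brownian : forall x, orthant x -> brownian_motion F (P x) W;
  srbm_regulator_adapted : adapted F Y;
  srbm_regulator : forall x, orthant x -> {ae P x, forall w, forall i,
    regulator_path i (fun t => Z t w) (fun t => (Y t w : 'cV[R]_d) i 0)};
  srbm_decomposition : exists2 S : 'M[R]_d, is_sqrtmx S Sigma &
    forall x, orthant x -> {ae P x, forall w, forall t, 0 <= t ->
      Z t w = (Z 0 w : 'cV[R]_d) + t *: mu
              + S *m (W t w : 'cV[R]_d) + Rmat *m (Y t w : 'cV[R]_d)
      :> 'cV[R]_d}
}.

Definition transition (t : R) (x : borel R d) : probability (borel R d) R :=
  distribution (P x) (Z t).

Definition semigroup (t : R) (h : 'cV[R]_d -> R) : 'cV[R]_d -> R :=
  fun x => fine 'E_(P x)[fun w => h (Z t w)].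

Definition C0_orthant (h : 'cV[R]_d -> R) :=
  {within orthant, continuous h} /\
  forall e, 0 < e -> exists2 K : set 'cV[R]_d, compact K &
    forall x, orthant x -> ~ K x -> `|h x| < e.

Definition feller :=
  (forall t h, 0 <= t -> C0_orthant h -> C0_orthant (semigroup t h)) /\
  (forall h, C0_orthant h ->
    ereal_sup [set (`|semigroup t h x - h x|)%:E | x in orthant]
      @[t --> 0^'+] --> 0%E).

(* On {tau < oo}, the conditional law of Z(tau + t) given F_tau is
   P_t(Z(tau), .). *)
Definition strong_markov :=
  (forall (t : R) B, 0 <= t -> measurable B ->
    measurable_fun (orthant : set (borel R d)) (fun x => transition t x B)) /\
  (forall x tau A (t : R) B, orthant x -> stopping_time F tau ->
    stopped_events F tau A -> 0 <= t -> measurable B ->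
    P x (A `&` [set w | (tau w < +oo)%E /\ B (Z (fine (tau w) + t) w)]) =
    (\int[P x]_(w in A `&` [set w | tau w < +oo])
      transition t (Z (fine (tau w)) w) B)%E).

Definition stationary_probability (pi0 : probability (borel R d) R) :=
  pi0 (orthant : set (borel R d)) = 1%E /\
  forall (t : R) B, 0 <= t -> measurable B ->
    (\int[pi0]_(x in (orthant : set (borel R d))) transition t x B = pi0 B)%E.

Definition transition_deviation (pi0 : probability (borel R d) R) t x :
    {charge set (borel R d) -> \bar R} :=
  cadd (charge_of_finite_measure (transition t x))
       (copp (charge_of_finite_measure pi0)).

Definition exponentially_ergodic (pi0 : probability (borel R d) R)
    (V : 'cV[R]_d -> R) (M kappa : R) :=
  forall x t, orthant x -> 0 <= t ->
    (tv_norm (transition_deviation pi0 t x) <=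
     (M * V x * expR (- kappa * t))%:E)%E.

End SRBM.

(* Main.v *)
(** Choose v <> 0 vanishing off A with w = R v vanishing on A, and x0 on the faces F_i, i in A, such
    that x1 = x0 + w also lies in the orthant. By exponential ergodicity the signed measure
    rho = sum_k (P_k(x1, .) - P_k(x0, .)) is finite, and rho (P_1 - 1) = delta_x0 - delta_x1.
    For a starting point z let G_0(z, .) and G_i(z, .) be the expected occupation measures of Z on
    [0, 1] with respect to time and to Y_i. Dynkin's formula reads
    G_0(z, L f) + sum_i G_i(z, D_i f) = P_1 f(z) - f(z), so that pi = rho G_0 and rho G_i satisfy the
    basic adjoint relation up to the error f(x0) - f(x1). This error is cancelled by adding to rho G_i
    the uniform law on the segment [x0, x1] with weight v_i: the segment lies in F_i when v_i <> 0,
    and sum_i v_i D_i f is the derivative of f along w.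
    If pi were 0, then rho would annihilate int_0^1 P_s (P_h phi - phi) ds for all phi in C_0 and h > 0;
    dividing by h and letting h tend to 0, rho (P_1 phi - phi) = phi(x0) - phi(x1) would vanish for
    every phi in C_0. *)
Require Import Defs.
From HB Require Import structures.
From mathcomp Require Import all_boot all_order all_algebra.
From mathcomp Require Import all_classical all_reals all_analysis measurable_realfun.
From mathcomp Require Import ring lra.
Import Order.TTheory GRing.Theory Num.Theory.
Import numFieldNormedType.Exports.

Set Implicit Arguments.
Unset Strict Implicit.
Unset Printing Implicit Defensive.

Local Open Scope classical_set_scope.
Local Open Scope ring_scope.

(** * The orthant *)

(** The laws [P x] are only linked through the transition probabilities of [Z], whereas the G_i are
    expectations of the regulator on the sample space; to be mixed over rho they must depend
    measurably on the starting point. Hence they are characterised by limits of Riemann sums: as R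
    is invertible, the expectation of [q(Z_s) (Y_t - Y_s)] is recovered from two-time laws of [Z],
    which the Markov property makes measurable. The uniform bound on the expected regulators bounds
    the mass of every G_i(z, .), so that a finite rho gives finite rho G_i. Dynkin's formula is
    proved without stochastic integrals, by a Taylor expansion along a grid and moments of Brownian
    increments up to order four. The regulators are only known to have a first moment, so the
    remainder must be bounded linearly in their increments. The vector v extends by zero a kernel
    vector of the singular submatrix, and w is not 0 because R is invertible. G_0(z, .) is a
    probability, so pi has the mass of rho, whose terms are differences of probabilities. *)

Lemma continuous_sum (R : realType) (T : topologicalType) (I : Type) (s : seq I)
    (F : I -> T -> R) :
  (forall i, continuous (F i)) -> continuous (fun x => \sum_(i <- s) F i x).
Proof.
move=> Fc; elim: s => [|i s ih] x.
  by rewrite (_ : (fun _ => _) = cst 0); [exact: cvg_cst|apply/funext => y; rewrite big_nil].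
rewrite (_ : (fun _ => _) = (fun y => F i y + \sum_(j <- s) F j y)); last first.
  by apply/funext => y; rewrite big_cons.
by apply: (@cvgD _ _ _ (nbhs x)); [exact: Fc|exact: ih].
Qed.

Section column_vectors.
Context {R : realType} {d : nat}.
Implicit Types x y z p : 'cV[R]_d.

Lemma cV_normP x e : 0 <= e -> (`|x| <= e) <-> (forall i, `|x i 0| <= e).
Proof.
move=> e0; rewrite [`|x|]/Num.Def.normr /= mx_normrE; split=> [/bigmax_leP[_ h] i|h].
  exact: (h (i, 0)).
by apply/bigmax_leP; split => // -[i j] _ /=; rewrite ord1.
Qed.

Lemma cV_coord_le x i : `|x i 0| <= `|x|.
Proof. by have [+ _] := @cV_normP x `|x| (normr_ge0 _); apply. Qed.

Lemma coord_cvg i : continuous (fun x => x i 0).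
Proof. exact: coord_continuous. Qed.

Definition ones : 'cV[R]_d := const_mx 1.

(** Retraction onto the orthant. Composing with it turns continuity relative to the orthant into
    continuity on the whole space, hence into Borel measurability of a globally defined function. *)
Definition pos_part x : 'cV[R]_d := \col_i Num.max (x i 0) 0.

Lemma pos_part_orthant x : orthant (pos_part x).
Proof. by move=> i; rewrite mxE le_max lexx orbT. Qed.

Lemma pos_part_id x : orthant x -> pos_part x = x.
Proof. by move=> x0; apply/colP => i; rewrite mxE; apply/max_idPl. Qed.

Lemma pos_part_continuous : continuous pos_part.
Proof.
move=> x; apply/(@cvgrPdist_le _ _ _ (nbhs x)) => e e0; near=> y.
have xy : `|x - y| <= e by near: y; apply: cvgr_dist_le.
apply/cV_normP; first exact: ltW.
move=> i; apply: le_trans xy; apply: le_trans (cV_coord_le _ i).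
rewrite !mxE; have [a|a] := leP (x i 0) 0; have [b|b] := leP (y i 0) 0.
- by rewrite subrr normr0.
- by rewrite sub0r normrN gtr0_norm// ler0_norm; lra.
- by rewrite subr0 gtr0_norm// gtr0_norm; lra.
- by [].
Unshelve. all: by end_near. Qed.

Lemma continuous_pos_part (f : 'cV[R]_d -> R) :
  {within orthant, continuous f} -> continuous (f \o pos_part).
Proof.
move=> fc x; move/subspace_continuousP : fc => /(_ _ (pos_part_orthant x)) fc.
move=> B /fc nB; have := @pos_part_continuous x _ nB.
rewrite /= !nbhs_simpl /=; apply: filterS => y; apply; exact: pos_part_orthant.
Qed.

Lemma closed_orthant : closed (@orthant R d).
Proof.
rewrite (_ : orthant = \bigcap_(i in [set: 'I_d]) [set x | 0 <= x i 0]); last first.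
  by apply/seteqP; split=> [x h i _|x h i]; [exact: h|exact: (h i)].
apply: closed_bigI => i _.
by apply: (@preimage_closed _ _ (fun x : 'cV[R]_d => x i 0) [set t : R | 0 <= t]);
  [move=> x _; exact: coord_cvg|exact: closed_ge].
Qed.

Lemma shift_oorthant x e : orthant x -> 0 < e -> oorthant (x + e *: ones).
Proof. by move=> x0 e0 i; rewrite !mxE mulr1 ltr_wpDl. Qed.

Lemma norm_ones e : 0 <= e -> `|e *: ones| <= e.
Proof.
by move=> e0; apply/cV_normP => // i; rewrite !mxE mulr1 ger0_norm.
Qed.

Lemma shift_cvg x : x + e *: ones @[e --> 0^'+] --> x.
Proof.
apply: cvg_at_right_filter; rewrite -[X in _ --> X]addr0 -[in X in _ --> X](scale0r ones).
by apply: cvgD; [exact: cvg_cst|apply: cvgZl; exact: cvg_id].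
Qed.

Lemma oorthantW x : oorthant x -> orthant x.
Proof. by move=> h i; exact: ltW. Qed.

Lemma oorthant_ball x : oorthant x ->
  exists2 e, 0 < e & forall y, `|y - x| < e -> oorthant y.
Proof.
move=> x0; pose e := \big[Num.min/1]_i x i 0.
exists e; first by apply/bigmin_gtP; split.
move=> y yx i; have := cV_coord_le (y - x) i; rewrite !mxE.
have : e <= x i 0 by exact: bigmin_le.
move: yx; move: (y i 0) (x i 0) => a b; rewrite ler_norml => h1 h2 /andP[h3 _]; lra.
Qed.

(** Derivatives exist in the open orthant only. An estimate proved there reaches a boundary point
    along the direction [ones], which points inwards at every face. *)
Lemma le_orthant_lim (q : 'cV[R]_d -> R) x c : continuous q -> orthant x ->
  (\forall e \near 0^'+, q (x + e *: ones) <= c) -> q x <= c.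
Proof.
move=> qc x0 h; have : q (x + e *: ones) @[e --> 0^'+] --> q x.
  by apply: (cvg_comp _ _ (@shift_cvg x)); exact: qc.
move=> hc; apply: (@closed_cvg _ _ _ _ (fun e => q (x + e *: ones)) (fun t : R => t <= c) _ h (q x) hc).
exact: closed_le.
Qed.

(** The limit is unique only along a proper filter; properness holds because [x + e *: ones] is
    interior for every [e > 0]. *)
Lemma extension_eq (h g : 'cV[R]_d -> R) x :
  {within orthant, continuous g} -> (forall y, oorthant y -> g y = h y) ->
  orthant x -> extension h x = g x.
Proof.
move=> gc gh x0; rewrite /extension.
have PF : ProperFilter (within (@oorthant R d) (nbhs x)).
  apply: within_nbhs_proper => B /= nB.
  have := @shift_cvg x B nB => nB'.
  have [e [e0 Be]] : exists e, 0 < e /\ B (x + e *: ones).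
    near (0 : R)^'+ => e; exists e; split => //; near: e; exact: nB'.
  by exists (x + e *: ones); split=> //; exact: shift_oorthant.
apply: cvg_lim => //.
apply: (@cvg_trans _ (g y @[y --> within orthant (nbhs x)])); last first.
  by move/subspace_continuousP : gc => /(_ x x0).
move=> B; rewrite /fmap /= !nbhs_simpl /= /within /=.
apply: filter_app; near=> y => hy yo.
by rewrite -gh//; apply: hy; exact: oorthantW.
Unshelve. all: by end_near. Qed.

(** Later estimates use this global continuous representative instead of the limit [extension h]. *)
Lemma bounded_extension (h : 'cV[R]_d -> R) : bounded_and_extends h ->
  exists g : 'cV[R]_d -> R, [/\ continuous g,
    forall x, orthant x -> g x = extension h x,
    forall x, oorthant x -> g x = h x &
    exists2 C, 0 < C & forall x, `|g x| <= C].
Proof.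
move=> [[M [_ hM]] [g0 [g0c g0h]]]; exists (g0 \o pos_part).
have gc := continuous_pos_part g0c.
have go x : oorthant x -> (g0 \o pos_part) x = h x.
  by move=> xo /=; rewrite pos_part_id ?g0h//; exact: oorthantW.
split => //.
  by move=> x x0; rewrite /= pos_part_id// (@extension_eq h g0).
(* A [bounded] statement gives the bound only for constants above [M]; adding 1 provides one and
   makes it positive. *)
exists (`|M| + 1); first by rewrite ltr_pwDr.
move=> x; suff H y : orthant y -> `|(g0 \o pos_part) y| <= `|M| + 1.
  by have := H _ (pos_part_orthant x); rewrite /= pos_part_id//; exact: pos_part_orthant.
move=> y0; apply: (@le_orthant_lim (fun y => `|(g0 \o pos_part) y|)) => //.
  by move=> z; apply: (@cvg_norm _ _ _ (nbhs z)); exact: gc.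
near=> e; rewrite go; last exact: shift_oorthant.
apply: hM; last exact: shift_oorthant.
by rewrite ltr_pwDr// ler_norm.
Unshelve. all: by end_near. Qed.

End column_vectors.

(** * Second-order Taylor expansion up to the boundary *)

Section taylor.
Context {R : realType} {d : nat}.
Implicit Types x y z p : 'cV[R]_d.

Lemma derive_along (f : 'cV[R]_d -> R) x v s : derivable f (x + s *: v) v ->
  is_derive s 1 (fun s => f (x + s *: v)) ('D_v f (x + s *: v)).
Proof.
move=> df.
have E : (fun h : R => h^-1 *: (((fun s => f (x + s *: v)) \o shift s) (h *: 1) - f (x + s *: v)))
   = (fun h => h^-1 *: ((f \o shift (x + s *: v)) (h *: v) - f (x + s *: v))).
  apply/funext => h /=; congr (_ *: (f _ - _)).
  by rewrite [h *: 1]mulr1 scalerDl addrCA.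
by split; rewrite /derivable /derive /= E.
Qed.

Variables (f : 'cV[R]_d -> R) (g : 'I_d -> 'cV[R]_d -> R).
Hypothesis df : forall j x, oorthant x -> derivable f x (delta_mx j 0).
Hypothesis gc : forall j, continuous (g j).
Hypothesis gE : forall j x, oorthant x -> g j x = partial j f x.

Let step p z (m : nat) : 'cV[R]_d := \col_i (p i 0 + (if (i < m)%N then z i 0 else 0)).

Let coord_increment p j t : 
  (forall s, `|s| <= `|t| -> oorthant (p + s *: delta_mx j 0)) ->
  exists2 s, `|s| <= `|t| &
    f (p + t *: delta_mx j 0) - f p = g j (p + s *: delta_mx j 0) * t.
Proof.
move=> ho; pose D s := partial j f (p + s *: delta_mx j 0).
have dd (s : R) : `|s| <= `|t| -> is_derive s 1 (fun s => f (p + s *: delta_mx j 0)) (D s).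
  by move=> st; apply: derive_along; apply: df; exact: ho.
have cc (s : R) : `|s| <= `|t| -> {for s, continuous (fun s : R => f (p + s *: delta_mx j 0))}.
  by move=> /dd ds; apply/differentiable_continuous/derivable1_diffP; exact: ex_derive.
have main (a b : R) : a <= b -> (forall s, a <= s <= b -> `|s| <= `|t|) ->
    exists2 s, `|s| <= `|t| & f (p + b *: delta_mx j 0) - f (p + a *: delta_mx j 0) =
      g j (p + s *: delta_mx j 0) * (b - a).
  move=> ab hs; have [|||c cab ->] := @MVT_segment R (fun s => f (p + s *: delta_mx j 0)) D a b.
  - by [].
  - by move=> s sab; apply: dd; apply: hs; rewrite !ltW ?(itvP sab).
  - apply: continuous_in_subspaceT => s; rewrite inE /= in_itv /= => sab.
    by apply: cc; apply: hs.
  - by exists c; [apply: hs; rewrite !(itvP cab)|rewrite gE//; apply: ho; apply: hs; rewrite !(itvP cab)].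
have [t0|t0] := leP 0 t.
  have [s|s st] := main 0 t t0; first by move=> /andP[s0 st]; rewrite !ger0_norm.
  by rewrite scale0r addr0 subr0 => ->; exists s.
have [s|s st] := main t 0 (ltW t0); first by move=> /andP[s0 st]; rewrite !ler0_norm ?lerN2 // ltW.
by rewrite scale0r addr0 sub0r mulrN => /eqP; rewrite -eqr_oppLR opprB => /eqP ->; exists s.
Qed.

(** Only partial derivatives are available, so the increment is telescoped along the staircase
    [step] from [p] to [p + z], and the one-variable mean value theorem is applied to each edge,
    which is parallel to an axis. *)
Lemma increment_mean_value p z e : `|z| < e ->
  (forall y, `|y - p| < e -> oorthant y) ->
  exists q : 'I_d -> 'cV[R]_d, (forall j, `|q j - p| <= `|z|) /\
    f (p + z) - f p = \sum_j g j (q j) * z j 0.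
Proof.
move=> ze ho.
have stepS (j : 'I_d) : step p z j.+1 = step p z j + z j 0 *: delta_mx j 0.
  apply/colP => i; rewrite !mxE andbT ltnS leq_eqVlt.
  rewrite -val_eqE /=; have [/val_inj ->|_] /= := eqVneq (i : nat) j.
    by rewrite ltnn mulr1 addr0.
  by rewrite mulr0 addr0.
have steple (j : 'I_d) s : `|s| <= `|z j 0| -> `|step p z j + s *: delta_mx j 0 - p| <= `|z|.
  move=> sz; apply/cV_normP => // i; rewrite !mxE andbT.
  have [->|ij] := eqVneq i j.
    by rewrite ltnn mulr1 addr0 addrAC subrr add0r (le_trans sz)// cV_coord_le.
  rewrite mulr0 addr0 addrAC subrr add0r; case: ifP => _; first exact: cV_coord_le.
  by rewrite normr0.
have H (j : 'I_d) : exists q, `|q - p| <= `|z| /\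
    f (step p z j.+1) - f (step p z j) = g j q * z j 0.
  have [s hs|s sz E] := @coord_increment (step p z j) j (z j 0).
    by apply: ho; apply: le_lt_trans ze; exact: steple.
  by exists (step p z j + s *: delta_mx j 0); rewrite stepS; split => //; exact: steple.
have [q hq] := choice H; exists q; split; first by move=> j; have [] := hq j.
rewrite (eq_bigr (fun j : 'I_d => f (step p z j.+1) - f (step p z j))); last first.
  by move=> j _; have [_ ->] := hq j.
rewrite -(big_mkord xpredT (fun j => f (step p z j.+1) - f (step p z j))).
rewrite telescope_sumr//; congr (f _ - f _); apply/colP => i; rewrite !mxE.
  by rewrite ltn_ord.
by rewrite addr0.
Qed.

Lemma chain_rule x z s : oorthant (x + s *: z) ->
  is_derive s 1 (fun s => f (x + s *: z)) (\sum_j g j (x + s *: z) * z j 0).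
Proof.
set p := x + s *: z => po.
have [e e0 he] := oorthant_ball po.
have L : h^-1 *: (((fun s => f (x + s *: z)) \o shift s) (h *: 1) - f p) @[h --> 0^']
   --> \sum_j g j p * z j 0.
  apply/cvgrPdist_le => eps eps0.
  (* The summand 1 keeps [S] positive when [z = 0]. *)
  pose S := 1 + \sum_j `|z j 0|.
  have S0 : 0 < S by rewrite ltr_pwDl// sumr_ge0.
  have : \forall y \near p, forall j, `|g j p - g j y| <= eps / S.
    apply: (@filter_forall _ _ (fun j y => `|g j p - g j y| <= eps / S) (nbhs p) _) => j.
    by move/cvgrPdist_le : (@gc j p); apply; rewrite divr_gt0.
  move=> /nbhs_ballP[r /= r0 hr].
  near=> h.
  have h0 : h != 0 by near: h; exact: nbhs_dnbhs_neq.
  have hz : `|h *: z| < Num.min e r.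
    have z1 : 0 < `|z| + 1 by rewrite ltr_pwDr.
    rewrite normrZ (@le_lt_trans _ _ (`|h| * (`|z| + 1)))//.
      by rewrite ler_pM// lerDl.
    rewrite -ltr_pdivlMr//.
    near: h; apply: dnbhs0_lt; rewrite divr_gt0// lt_min e0; exact: r0.
  move: hz; rewrite lt_min => /andP[hze hzr].
  have [q [hq]] := @increment_mean_value p (h *: z) e hze he.
  rewrite /= [h *: 1]mulr1 scalerDl addrCA -/p addrC => ->.
  rewrite scaler_sumr -sumrB (@le_trans _ _ (\sum_j eps / S * `|z j 0|))//.
    apply: le_trans (ler_norm_sum _ _ _) _; apply: ler_sum => j _.
    rewrite !mxE (_ : _ *: _ = g j (q j) * z j 0); last first.
      by rewrite [LHS]mulrCA mulKf.
    rewrite -mulrBl normrM ler_wpM2r//.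
    apply: hr; rewrite -ball_normE /= distrC; apply: le_lt_trans hzr; exact: hq.
  rewrite -mulr_sumr mulrAC ler_pdivrMr// ler_pM2l//; rewrite /S lerDr//.
split.
  by apply/cvg_ex; eexists; exact: L.
exact: cvg_lim L.
Unshelve. all: by end_near. Qed.

End taylor.

Section second_order.
Context {R : realType} {d : nat}.
Implicit Types x y z p : 'cV[R]_d.
Variables (f : 'cV[R]_d -> R) (G : 'I_d -> 'cV[R]_d -> R) (H : 'I_d -> 'I_d -> 'cV[R]_d -> R).
Hypothesis df : forall j x, oorthant x -> derivable f x (delta_mx j 0).
Hypothesis ddf : forall j k x, oorthant x -> derivable (partial k f) x (delta_mx j 0).
Hypothesis Gc : forall j, continuous (G j).
Hypothesis Hc : forall j k, continuous (H j k).
Hypothesis GE : forall j x, oorthant x -> G j x = partial j f x.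
Hypothesis HE : forall j k x, oorthant x -> H j k x = partial j (partial k f) x.

Definition taylor2 x z := \sum_j G j x * z j 0 + 2^-1 * \sum_j \sum_k H j k x * (z j 0 * z k 0).

(** On the segment, [K] is the first derivative minus the linear function that the Hessian at [x]
    predicts, and [F' = K - K 0], while [F 1 - F 0] is the Taylor remainder. The mean value theorem
    for [F] and then for [K] bounds it by the oscillation of the Hessian. *)
Lemma taylor_interior x y e : oorthant x -> oorthant y ->
  (forall s : R, 0 <= s <= 1 -> forall j k, `|H j k (x + s *: (y - x)) - H j k x| <= e) ->
  `|f y - f x - taylor2 x (y - x)| <= e * (\sum_j `|(y - x) j 0|) ^+ 2.
Proof.
move=> x0 y0 he; set z := y - x.
have seg (s : R) : 0 <= s <= 1 -> oorthant (x + s *: z).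
  move=> /andP[s0 s1] i; rewrite !mxE; have := x0 i; have := y0 i.
  move: (x i 0) (y i 0) => a b; rewrite le_eqVlt in s0; case/predU1P : s0 => [<-|s0]; first by lra.
  nra.
pose c := \sum_j \sum_k H j k x * (z j 0 * z k 0).
pose phi1 (s : R) := \sum_k partial k f (x + s *: z) * z k 0.
pose dphi1 (s : R) := \sum_k (\sum_j H j k (x + s *: z) * z j 0) * z k 0.
have D1 (s : R) : 0 <= s <= 1 -> is_derive s 1 (fun s : R => f (x + s *: z)) (phi1 s).
  move=> s01; have -> : phi1 s = \sum_k G k (x + s *: z) * z k 0.
    by apply: eq_bigr => k _; rewrite GE//; exact: seg.
  by apply: (chain_rule df Gc GE); exact: seg.
have D2 (s : R) : 0 <= s <= 1 -> is_derive s 1 phi1 (dphi1 s).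
  move=> s01; rewrite /phi1 /dphi1.
  have h k : is_derive s 1 (fun s : R => partial k f (x + s *: z) * z k 0)
      ((\sum_j H j k (x + s *: z) * z j 0) * z k 0).
    have hk := @chain_rule _ _ _ _ (ddf ^~ k) (Hc ^~ k) (HE ^~ k) x z s (seg _ s01).
    have := @is_deriveZ _ _ _ (fun s : R => partial k f (x + s *: z)) (z k 0) s 1 _ hk.
    rewrite [_ *: \sum_j _]mulrC => h; apply: (@eq_ind _ _ (fun g => is_derive s 1 g _) h).
    by apply/funext => r /=; rewrite [LHS]mulrC.
  have := @is_derive_sum _ _ _ d (fun k (s : R) => partial k f (x + s *: z) * z k 0) s 1 _ h.
  move=> h'; apply: (@eq_ind _ _ (fun g => is_derive s 1 g _) h').
  by apply/funext => r; rewrite fct_sumE.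
pose K (s : R) := phi1 s - s * c.
have DK (s : R) : 0 <= s <= 1 -> is_derive s 1 K (dphi1 s - c).
  move=> s01; apply: (@is_deriveB _ _ _ phi1 (fun s => s * c)); first exact: D2.
  have := @is_deriveZ _ _ _ (@id R) c s 1 1 (is_derive_id _ _).
  rewrite [_ *: 1]mulr1 => h; apply: (@eq_ind _ _ (fun g => is_derive s 1 g _) h).
  by apply/funext => r /=; rewrite [LHS]mulrC.
pose F (s : R) := f (x + s *: z) - s * phi1 0 - 2^-1 * s ^+ 2 * c.
have DF (s : R) : 0 <= s <= 1 -> is_derive s 1 F (K s - K 0).
  move=> s01; have h1 := D1 s s01.
  have h2 : is_derive s 1 (fun s : R => s * phi1 0) (phi1 0).
    have := @is_deriveZ _ _ _ (@id R) (phi1 0) s 1 1 (is_derive_id _ _).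
    rewrite [_ *: 1]mulr1 => h; apply: (@eq_ind _ _ (fun g => is_derive s 1 g _) h).
    by apply/funext => r /=; rewrite [LHS]mulrC.
  have h3 : is_derive s 1 (fun s : R => 2^-1 * s ^+ 2 * c) (s * c).
    have := @is_deriveZ _ _ _ _ (2^-1 * c) s 1 _ (@is_deriveX _ _ (@id R) 2 s 1 _ (is_derive_id _ _)).
    rewrite (_ : _ *: _ = s * c); last first.
      by rewrite [_%:A]mulr1 expr1 [LHS]mulrC -mulr_natl; field.
    move=> h; apply: (@eq_ind _ _ (fun g => is_derive s 1 g _) h).
    by apply/funext => r /=; rewrite [LHS]mulrAC.
  rewrite /K mul0r subr0 addrAC.
  have h4 := @is_deriveB _ _ _ _ _ s 1 _ _ (@is_deriveB _ _ _ _ _ s 1 _ _ h1 h2) h3.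
  exact: (@eq_ind _ _ (fun g => is_derive s 1 g _) h4 F erefl).
have cont (g dg : R -> R) a b : 0 <= a -> b <= 1 ->
   (forall s : R, 0 <= s <= 1 -> is_derive s 1 g (dg s)) -> {within `[a, b], continuous g}.
  move=> a0 b1 dg'; apply: continuous_in_subspaceT => s; rewrite inE /= in_itv /= => /andP[sa sb].
  apply/differentiable_continuous/derivable1_diffP.
  by have := dg' s; rewrite (le_trans a0 sa) (le_trans sb b1) => /(_ isT) [].
set S := \sum_j _.
have dK (s : R) : 0 <= s <= 1 -> `|dphi1 s - c| <= e * S ^+ 2.
  move=> s01; rewrite /dphi1 /c exchange_big /=.
  rewrite -sumrB; apply: le_trans (ler_norm_sum _ _ _) _.
  rewrite expr2 mulrA mulrC /S mulr_suml; apply: ler_sum => k _.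
  rewrite mulr_suml -sumrB; apply: le_trans (ler_norm_sum _ _ _) _.
  rewrite mulr_sumr mulr_sumr; apply: ler_sum => j _.
  rewrite -mulrA -mulrBl normrM normrM mulrCA [in leRHS]mulrCA mulrC [in leRHS]mulrC.
  by rewrite -mulrA [leRHS]mulrC (mulrC `|z k 0|) ler_wpM2r ?mulr_ge0//; exact: he.
have bK (s : R) : 0 <= s <= 1 -> `|K s - K 0| <= e * S ^+ 2.
  move=> /[dup] s01 /andP[s0 s1].
  have [r rs|r rs ->] := @MVT_segment R K (fun s => dphi1 s - c) 0 s s0 _ (cont _ _ _ _ (lexx 0) s1 DK).
    by apply: DK; move: rs; rewrite in_itv /= => /andP[r0 r1]; rewrite (ltW r0) (le_trans (ltW r1)).
  move: rs; rewrite in_itv /= => /andP[r0 r1].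
  rewrite subr0 normrM (ger0_norm s0); apply: (@le_trans _ _ (e * S ^+ 2 * 1)); last by rewrite mulr1.
  by apply: ler_pM => //; apply: dK; rewrite r0 (le_trans r1).
have [r rs|r rs] := @MVT_segment R F (fun s => K s - K 0) 0 1 ler01 _ (cont _ _ _ _ (lexx 0) (lexx 1) DF).
  by apply: DF; move: rs; rewrite in_itv /= => /andP[r0 r1]; rewrite !ltW.
rewrite subr0 mulr1 => E.
have -> : f y - f x - taylor2 x z = F 1 - F 0.
  rewrite /F /taylor2 scale1r scale0r addr0 /z addrCA subrr addr0 expr1n expr0n /= -/z !mul1r mul0r !mulr0 !mulr1 mul0r !subr0.
  rewrite /phi1 scale0r addr0 (eq_bigr (fun k => partial k f x * z k 0)); first by rewrite /c; lra.
  by move=> k _; rewrite GE.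
by rewrite E; apply: bK; move: rs; rewrite in_itv.
Qed.

(** Both end points are shifted into the interior by [eps *: ones] and [eps] tends to 0. The factor
    2 arises because the Hessian at two shifted points is compared through its value at the
    unshifted [x]. *)
Lemma taylor_orthant (fc : {within orthant, continuous f}) x y e r : orthant x -> orthant y ->
  `|y - x| < r ->
  (forall p, `|p - x| <= r -> forall j k, `|H j k p - H j k x| <= e) ->
  `|f y - f x - taylor2 x (y - x)| <= 2 * e * (\sum_j `|(y - x) j 0|) ^+ 2.
Proof.
move=> x0 y0 yxr he.
pose ft := f \o pos_part.
have ftc : continuous ft := continuous_pos_part fc.
have -> : f y = ft y by rewrite /ft /= pos_part_id.
have -> : f x = ft x by rewrite /ft /= pos_part_id.
have T2c z : continuous (fun x => taylor2 x z).
  move=> p; apply: (@cvgD _ _ _ (nbhs p)).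
    apply: continuous_sum => j {}p; apply: (@cvgM _ _ (nbhs p)); [exact: Gc|exact: cvg_cst].
  apply: (@cvgM _ _ (nbhs p)); first exact: cvg_cst.
  apply: continuous_sum => j; apply: continuous_sum => k {}p.
  by apply: (@cvgM _ _ (nbhs p)); [exact: Hc|exact: cvg_cst].
pose q p := `|ft (p + (y - x)) - ft p - taylor2 p (y - x)|.
have qc : continuous q.
  move=> p; apply: (@cvg_norm _ _ _ (nbhs p)); apply: (@cvgB _ _ _ (nbhs p)); last exact: T2c.
  apply: (@cvgB _ _ _ (nbhs p)); last exact: ftc.
  apply: (@cvg_comp _ _ _ (fun p => p + (y - x)) ft (nbhs p) (nbhs (p + (y - x)))); last exact: ftc.
  by apply: (@cvgD _ _ _ (nbhs p)); [exact: cvg_id|exact: cvg_cst].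
suff : q x <= 2 * e * (\sum_j `|(y - x) j 0|) ^+ 2 by rewrite /q (addrC x) subrK.
apply: le_orthant_lim => //; near=> eps.
have e0 : 0 < eps by [].
(* Keeps the shifted segment within distance [r] of [x]. *)
have er : eps <= r - `|y - x| by near: eps; apply: nbhs_right_le; rewrite subr_gt0.
have xo := shift_oorthant x0 e0; have yo := shift_oorthant y0 e0.
rewrite /q.
have -> : x + eps *: ones + (y - x) = y + eps *: ones :> 'cV[R]_d by rewrite addrAC (addrC x) subrK.
rewrite /ft /= !pos_part_id; [|exact: oorthantW..].
have -> : y - x = (y + eps *: ones) - (x + eps *: ones) by rewrite opprD addrACA subrr addr0.
apply: taylor_interior => // s /andP[s0 s1] j k.
rewrite opprD addrACA subrr addr0.
apply: (@le_trans _ _ (`|H j k (x + eps *: ones + s *: (y - x)) - H j k x| + `|H j k x - H j k (x + eps *: ones)|)).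
  by rewrite (le_trans _ (ler_normD _ _))// addrA subrK.
rewrite mulr_natl mulr2n lerD//; last rewrite distrC; apply: he.
- rewrite -[x + _ + _]addrA [x + _]addrC addrK (le_trans (ler_normD _ _))//.
  have := norm_ones (d := d) (ltW e0).
  have -> : `|s *: (y - x)| = s * `|y - x| by rewrite normrZ ger0_norm.
  have : s * `|y - x| <= `|y - x| by rewrite ler_piMl.
  lra.
- by rewrite [x + _]addrC addrK (le_trans (norm_ones (ltW e0)))// (le_trans er)// gerBl.
Unshelve. all: by end_near. Qed.

End second_order.

(** * Measures and integrals *)

Section borel_tools.
Context {R : realType} {d : nat}.

Lemma borel_continuous (q : 'cV[R]_d -> R) : continuous q ->
  measurable_fun [set: borel R d] (q : borel R d -> R).
Proof.
move=> qc; apply: (measurability _ (@RGenOpens.measurableE R)) => //.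
move=> _ [_ [a [b ->]] <-]; rewrite setTI.
by apply: sub_sigma_algebra; move/continuousP : qc; apply; exact: interval_open.
Qed.

Lemma borel_open (U : set 'cV[R]_d) : open U -> measurable (U : set (borel R d)).
Proof. by move=> oU; exact: sub_sigma_algebra. Qed.

Lemma borel_closed (U : set 'cV[R]_d) : closed U -> measurable (U : set (borel R d)).
Proof. by move=> cU; rewrite -[U]setCK; apply: measurableC; apply: borel_open; exact: closed_openC. Qed.

Lemma measurable_orthant : measurable (orthant : set (borel R d)).
Proof. apply: borel_closed; exact: closed_orthant. Qed.

Lemma measurable_coord i : measurable_fun [set: borel R d] (fun x : borel R d => (x : 'cV[R]_d) i 0).
Proof. by apply: borel_continuous => x; exact: coord_cvg. Qed.

Lemma measurable_to_borel d1 (T : measurableType d1) (f : T -> borel R d) :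
  (forall U : set 'cV[R]_d, open U -> measurable (f @^-1` U)) -> measurable_fun setT f.
Proof.
move=> h; apply: (@measurability _ _ _ _ setT f (@open 'cV[R]_d) erefl) => //.
by move=> _ [U oU <-]; rewrite setTI; exact: h.
Qed.

(** [q] is the distance to the complement of [U], truncated at 1; the element 1 keeps the set [S x]
    nonempty when [U] is the whole space. Such functions carry statements about continuous
    integrands over to open sets. *)
Lemma open_cutoff (U : set 'cV[R]_d) : open U ->
  exists q : 'cV[R]_d -> R, [/\ continuous q, forall x, 0 <= q x <= 1 &
    forall x, U x <-> 0 < q x].
Proof.
move=> oU; pose S x := [set t : R | t = 1 \/ exists a, ~ U a /\ t = `|x - a|].
have S0 x : S x !=set0 by exists 1; left.
have lbS x : lbound (S x) 0 by move=> t [->|[a [_ ->]]].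
have infS x t : S x t -> inf (S x) <= t by apply: ge_inf; exists 0; exact: lbS.
have q0 x : 0 <= inf (S x) by apply: lb_le_inf.
have lip x y : inf (S x) <= `|x - y| + inf (S y).
  rewrite -lerBlDl; apply: lb_le_inf => // t [->|[a [Ua ->]]]; rewrite lerBlDl.
    by rewrite (le_trans (infS x 1 _)); [|left|rewrite lerDr].
  rewrite (le_trans (infS x `|x - a| _))//; first by right; exists a.
  exact: ler_distD.
exists (fun x => inf (S x)); split.
- move=> x; apply/(@cvgrPdist_le _ _ _ (nbhs x)) => e e0; near=> y.
  have xy : `|x - y| <= e by near: y; apply: cvgr_dist_le.
  have := lip x y; have := lip y x; rewrite distrC.
  by rewrite ler_norml => h1 h2; apply/andP; split; lra.
- by move=> x; rewrite q0 infS//; left.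
- move=> x; split=> [Ux|qx].
    move: oU; rewrite openE => /(_ x Ux) /nbhs_ballP[e /= e0 he].
    apply: (@lt_le_trans _ _ (Num.min 1 e)); first by rewrite lt_min ltr01.
    apply: lb_le_inf => // t [->|[a [Ua ->]]]; first by rewrite ge_min lexx.
    rewrite ge_min; apply/orP; right; rewrite leNgt; apply/negP => xa.
    by apply: Ua; apply: he; rewrite -ball_normE.
  apply: contrapT => Ux; suff : inf (S x) <= 0 by rewrite leNgt qx.
  by apply: infS; right; exists x; rewrite subrr normr0.
Unshelve. all: by end_near. Qed.

End borel_tools.

(** * Induction on nonnegative measurable functions *)

Section measurable_ge0_ind.
Import HBNNSimple.
Local Open Scope ereal_scope.

Lemma measurable_ge0_ind d (T : measurableType d) (R : realType) (Phi : (T -> \bar R) -> Prop) :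
  (forall A, measurable A -> Phi (fun x => (\1_A x)%:E)) ->
  (forall (k : R) (f : T -> \bar R), (0 <= k)%R -> measurable_fun setT f -> (forall x, 0 <= f x) -> Phi f ->
    Phi (fun x => k%:E * f x)) ->
  (forall f g : T -> \bar R, measurable_fun setT f -> (forall x, 0 <= f x) -> measurable_fun setT g ->
    (forall x, 0 <= g x) -> Phi f -> Phi g -> Phi (fun x => f x + g x)) ->
  (forall (f_ : (T -> \bar R)^nat) (f : T -> \bar R), (forall n, measurable_fun setT (f_ n)) ->
    (forall n x, 0 <= f_ n x) -> measurable_fun setT f ->
    (forall x, {homo (f_ ^~ x) : m n / (m <= n)%N >-> m <= n}) ->
    (forall x, f_ ^~ x @ \oo --> f x) -> (forall n, Phi (f_ n)) -> Phi f) ->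
  forall f, measurable_fun setT f -> (forall x, 0 <= f x) -> Phi f.
Proof.
move=> P1 PZ PD PL f mf f0; pose g := nnsfun_approx measurableT mf.
apply: (PL (fun n x => (g n x)%:E)) => //.
- by move=> n; exact/measurable_EFinP.
- by move=> n x; rewrite lee_fin.
- by move=> x a b ab; rewrite lee_fin; exact/lefP/nd_nnsfun_approx.
- by move=> x; apply: (@cvg_nnsfun_approx _ _ _ _ measurableT _ mf).
move=> n; move: (g n) => {mf f0 g PL f} h.
have -> : (fun x => (h x)%:E) = (fun x => \sum_(r <- finmap.enum_fset (fset_set (range h))) r%:E * (\1_(h @^-1` [set r]) x)%:E).
  by apply/funext => x; rewrite [in LHS]fimfunE -fsumEFin// fsbig_finite.
have mI r : measurable_fun setT (fun x => r%:E * (\1_(h @^-1` [set r]) x)%:E).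
  by apply/measurable_EFinP; apply: measurable_funM => //; exact: measurable_indic.
suff : Phi (fun x => \sum_(r <- finmap.enum_fset (fset_set (range h))) r%:E * (\1_(h @^-1` [set r]) x)%:E) /\
   measurable_fun setT (fun x => \sum_(r <- finmap.enum_fset (fset_set (range h))) r%:E * (\1_(h @^-1` [set r]) x)%:E) by case.
elim: (finmap.enum_fset (fset_set (range h))) => [|r s [ih mih]].
  have -> : (fun x : T => \sum_(r <- [::]) r%:E * (\1_(h @^-1` [set r]) x)%:E) = (fun x => (\1_set0 x)%:E).
    by apply/funext => x; rewrite big_nil indic0.
  by split; [exact: P1|apply/measurable_EFinP; exact: measurable_indic].
have -> : (fun x : T => \sum_(r <- r :: s) r%:E * (\1_(h @^-1` [set r]) x)%:E) = 
    (fun x => r%:E * (\1_(h @^-1` [set r]) x)%:E + \sum_(r <- s) r%:E * (\1_(h @^-1` [set r]) x)%:E).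
  by apply/funext => x; rewrite big_cons.
split; last exact: emeasurable_funD.
apply: PD => //.
- by move=> x; exact: nnfun_muleindic_ge0.
- by move=> x; apply: sume_ge0 => r' _; exact: nnfun_muleindic_ge0.
have mh : measurable_fun setT (fun x => (\1_(h @^-1` [set r]) x)%:E : \bar R).
  by apply/measurable_EFinP; exact: measurable_indic.
have [r0|r0] := leP 0%R r.
  by apply: PZ => //; exact: P1.
(* A negative [r] is not a value of [h]: its level set is empty, and the coefficient may be replaced
   by 0, which [PZ] allows. *)
rewrite (_ : (fun x => _) = (fun x => 0%:E * (\1_(h @^-1` [set r]) x)%:E)).
  by apply: PZ => //; exact: P1.
apply/funext => x; rewrite mul0e indicE; case: (boolP (x \in _)); rewrite ?mule0//.
by rewrite inE /= => hx; move: r0; rewrite -hx ltNge fun_ge0.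
Qed.

End measurable_ge0_ind.

Section integral_like.
Local Open Scope ereal_scope.

(* An identity or a measurability statement between functionals of this kind has only to be checked
   on indicators, and each of them is the integral against some measure. *)
Definition integral_like d (T : measurableType d) (R : realType) (I : (T -> \bar R) -> \bar R) := [/\
  forall f : T -> \bar R, measurable_fun setT f -> (forall x, 0 <= f x) -> 0 <= I f,
  forall (k : R) (f : T -> \bar R), (0 <= k)%R -> measurable_fun setT f -> (forall x, 0 <= f x) ->
    I (fun x => k%:E * f x) = k%:E * I f,
  forall f g : T -> \bar R, measurable_fun setT f -> (forall x, 0 <= f x) ->
    measurable_fun setT g -> (forall x, 0 <= g x) -> I (fun x => f x + g x) = I f + I g &
  forall (f_ : (T -> \bar R)^nat) (f : T -> \bar R), (forall n, measurable_fun setT (f_ n)) ->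
    (forall n x, 0 <= f_ n x) -> measurable_fun setT f ->
    (forall x, {homo (f_ ^~ x) : m n / (m <= n)%N >-> m <= n}) ->
    (forall x, f_ ^~ x @ \oo --> f x) ->
    {homo (fun n => I (f_ n)) : m n / (m <= n)%N >-> m <= n} /\ I (f_ n) @[n --> \oo] --> I f].

Context {d : measure_display} {T : measurableType d} {R : realType}.
Implicit Types I : (T -> \bar R) -> \bar R.

Lemma integral_like_eq I1 I2 : integral_like I1 -> integral_like I2 ->
  (forall A, measurable A -> I1 (fun x => (\1_A x)%:E) = I2 (fun x => (\1_A x)%:E)) ->
  forall f, measurable_fun setT f -> (forall x, 0 <= f x) -> I1 f = I2 f.
Proof.
move=> [_ Z1 D1 L1] [_ Z2 D2 L2] h; apply: measurable_ge0_ind => //.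
- by move=> k f k0 mf f0 ih; rewrite Z1// ih -Z2.
- by move=> f g mf f0 mg g0 ihf ihg; rewrite D1// ihf ihg -D2.
- move=> f_ f mf_ f_0 mf nd cf ih.
  have [_] := L1 _ _ mf_ f_0 mf nd cf; rewrite (funext ih) => h1.
  by apply: (cvg_unique _ h1) => //; have [] := L2 _ _ mf_ f_0 mf nd cf.
Qed.

Lemma integral_like_measurable d0 (T0 : measurableType d0) (D : set T0) (J : T0 -> (T -> \bar R) -> \bar R) :
  (forall z, D z -> integral_like (J z)) ->
  (forall A, measurable A -> measurable_fun D (fun z => J z (fun x => (\1_A x)%:E))) ->
  forall f, measurable_fun setT f -> (forall x, 0 <= f x) -> measurable_fun D (J^~ f).
Proof.
move=> hJ mJ; apply: measurable_ge0_ind => //.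
- move=> k f k0 mf f0 ih; apply: (@eq_measurable_fun _ _ _ _ _ (fun z => k%:E * J z f)).
    by move=> z /set_mem Dz; have [_ -> //] := hJ z Dz.
  by apply: emeasurable_funM => //; exact: measurable_cst.
- move=> f g mf f0 mg g0 ihf ihg; apply: (@eq_measurable_fun _ _ _ _ _ (fun z => J z f + J z g)).
    by move=> z /set_mem Dz; have [_ _ -> //] := hJ z Dz.
  exact: emeasurable_funD.
- move=> f_ f mf_ f_0 mf nd cf ih; apply: (emeasurable_fun_cvg (fun n z => J z (f_ n))) => // z Dz.
  by have [_ _ _ L] := hJ z Dz; have [] := L _ _ mf_ f_0 mf nd cf.
Qed.

Lemma integral_like_eval x : integral_like (fun f : T -> \bar R => f x).
Proof. by split => // f_ f mf_ f_0 mf nd cf; split => // a b; exact: nd. Qed.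

Lemma integral_like0 : integral_like (fun f : T -> \bar R => 0).
Proof.
split => //; [by move=> k f *; rewrite mule0|by move=> *; rewrite adde0|].
by move=> *; split => //; exact: cvg_cst.
Qed.

(** The weight [a] covers measures with a density; with [a = 1] this is the mixture of a kernel. *)
Lemma integral_like_mix d0 (T0 : measurableType d0) (m : {measure set T0 -> \bar R}) (a : T0 -> R)
    (J : T0 -> (T -> \bar R) -> \bar R) :
  measurable_fun setT a -> (forall z, (0 <= a z)%R) -> (forall z, integral_like (J z)) ->
  (forall A, measurable A -> measurable_fun setT (fun z => J z (fun x => (\1_A x)%:E))) ->
  integral_like (fun f => \int[m]_z ((a z)%:E * J z f)).
Proof.
move=> ma a0 hJ mJA.
have mJ f : measurable_fun setT f -> (forall x, 0 <= f x) -> measurable_fun setT (J^~ f).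
  by move=> mf f0; apply: integral_like_measurable => // z _; exact: hJ.
have maJ f : measurable_fun setT f -> (forall x, 0 <= f x) -> measurable_fun setT (fun z => (a z)%:E * J z f).
  by move=> mf f0; apply: emeasurable_funM; [exact/measurable_EFinP|exact: mJ].
have J0 f z : measurable_fun setT f -> (forall x, 0 <= f x) -> 0 <= J z f.
  by move=> mf f0; have [+ _ _ _] := hJ z; apply.
have aJ0 f z : measurable_fun setT f -> (forall x, 0 <= f x) -> 0 <= (a z)%:E * J z f.
  by move=> mf f0; rewrite mule_ge0 ?lee_fin// J0.
split.
- by move=> f mf f0; apply: integral_ge0 => z _; exact: aJ0.
- move=> k f k0 mf f0; rewrite -ge0_integralZl_EFin//.
  + by apply: eq_integral => z _; have [_ -> // _ _] := hJ z; rewrite muleCA.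
  + by move=> z _; exact: aJ0.
  + exact: maJ.
- move=> f g mf f0 mg g0; rewrite -ge0_integralD//.
  + by apply: eq_integral => z _; have [_ _ -> // _] := hJ z; rewrite ge0_muleDr// J0.
  + by move=> z _; exact: aJ0.
  + exact: maJ.
  + by move=> z _; exact: aJ0.
  + exact: maJ.
- move=> f_ f mf_ f_0 mf nd cf.
  have nJ z : {homo (fun n => J z (f_ n)) : m n / (m <= n)%N >-> m <= n}.
    by have [_ _ _ L] := hJ z; have [] := L _ _ mf_ f_0 mf nd cf.
  have naJ z b c : (b <= c)%N -> (a z)%:E * J z (f_ b) <= (a z)%:E * J z (f_ c).
    by move=> bc; rewrite lee_wpmul2l ?lee_fin// nJ.
  split.
    by move=> b c bc; apply: ge0_le_integral => //; first [exact: maJ|by move=> z _; first [exact: aJ0|exact: naJ]].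
  have := @cvg_monotone_convergence _ _ _ m setT measurableT (fun n z => (a z)%:E * J z (f_ n)) _ _ _.
  rewrite (_ : (fun x => limn _) = (fun z => (a z)%:E * J z f)); last first.
    apply/funext => z; apply: cvg_lim => //.
    have [_ _ _ L] := hJ z; have [_ cJ] := L _ _ mf_ f_0 mf nd cf.
    exact: cvgeZl.
  apply=> [n|n x _|x _ b c bc]; [exact: maJ|exact: aJ0|exact: naJ].
Qed.

Lemma integral_like_integral (m : {measure set T -> \bar R}) : integral_like (fun f => \int[m]_z f z).
Proof.
have := @integral_like_mix _ T m (cst 1%R) (fun z f => f z) _ _ (fun z => integral_like_eval z).
rewrite (_ : (fun f => _) = (fun f : T -> \bar R => \int[m]_z f z)); last first.
  by apply/funext => f; apply: eq_integral => z _; rewrite mul1e.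
by apply => // A mA; apply/measurable_EFinP; exact: measurable_indic.
Qed.

Section measure.
Variables (I : (T -> \bar R) -> \bar R) (hI : integral_like I).

(** A measure has to be nonnegative on every set, but [I] is only known to be so on measurable
    functions; hence the value 0 elsewhere. *)
Definition integral_like_set (A : set T) : \bar R :=
  if `[< measurable A >] then I (fun x => (\1_A x)%:E) else 0.

Let mi (A : set T) : measurable A -> measurable_fun setT (fun x => (\1_A x)%:E : \bar R).
Proof. by move=> mA; apply/measurable_EFinP; exact: measurable_indic. Qed.

Let integral_like_setE A : measurable A -> integral_like_set A = I (fun x => (\1_A x)%:E).
Proof. by move=> mA; rewrite /integral_like_set; case: asboolP. Qed.

Let integral_like_zero : I (fun=> 0) = 0.
Proof.
have [_ Z _ _] := hI; have := Z 0%R (fun=> 0) (lexx _) (measurable_cst _) (fun=> lexx _).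
have -> : (fun _ : T => 0%:E * 0 : \bar R) = (fun=> 0) by apply/funext => x; rewrite mul0e.
by move=> ->; rewrite mul0e.
Qed.

Let integral_like_set0 : integral_like_set set0 = 0.
Proof.
rewrite integral_like_setE//; rewrite -[RHS]integral_like_zero; congr I.
by apply/funext => x; rewrite indicE in_set0.
Qed.

Let integral_like_set_ge0 A : 0 <= integral_like_set A.
Proof.
rewrite /integral_like_set; case: asboolP => // mA; have [+ _ _ _] := hI; apply; first exact: mi.
by move=> x; rewrite lee_fin.
Qed.

Let integral_like_sum (F : (set T)^nat) n : (forall i, measurable (F i)) ->
  \sum_(0 <= i < n) integral_like_set (F i) = I (fun x => \sum_(0 <= i < n) (\1_(F i) x)%:E).
Proof.
move=> mF; elim: n => [|n ih].
  by rewrite big_nil -[LHS]integral_like_zero; congr I; apply/funext => x; rewrite big_nil.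
rewrite big_nat_recr//= ih integral_like_setE//.
have [_ _ D _] := hI; rewrite -D//.
- by congr I; apply/funext => x; rewrite big_nat_recr.
- by apply: emeasurable_sum => i; exact: mi.
- by move=> x; apply: sume_ge0 => i _; rewrite lee_fin.
- exact: mi.
Qed.

Let integral_like_sigma : semi_sigma_additive integral_like_set.
Proof.
move=> F mF tF mU; rewrite integral_like_setE// (funext (fun n => integral_like_sum n mF)).
have [_ _ _ L] := hI; apply: (L _ _ _ _ _ _ _).2.
- by move=> n; apply: emeasurable_sum => i; exact: mi.
- by move=> n x; apply: sume_ge0 => i _; rewrite lee_fin.
- exact: mi.
- by move=> x a b ab; apply: lee_sum_nneg_natr => // i _ _; rewrite lee_fin.
- by move=> x; rewrite (indic_bigcup x tF); apply: is_cvg_nneseries => i _; rewrite lee_fin.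
Qed.

HB.instance Definition _ := isMeasure.Build _ _ _ integral_like_set
  integral_like_set0 integral_like_set_ge0 integral_like_sigma.

Lemma integral_like_measure : exists m : {measure set T -> \bar R},
  forall f : T -> \bar R, measurable_fun setT f -> (forall x, 0 <= f x) -> \int[m]_x f x = I f.
Proof.
exists integral_like_set; apply: integral_like_eq => //; first exact: integral_like_integral.
by move=> A mA; rewrite integral_indic// setIT -integral_like_setE.
Qed.

End measure.

End integral_like.

(** * Transfer of integrals between measure spaces *)

Section transfer.
Local Open Scope ereal_scope.

(** A single change of variables for densities, images and restrictions: the hypothesis says that
    the weighted measures [a1 m1] and [a2 m2] have the same image in [T]. *)
Lemma ge0_integral_transfer d d1 d2 (T : measurableType d) (T1 : measurableType d1)
    (T2 : measurableType d2) (R : realType)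
    (m1 : {measure set T1 -> \bar R}) (m2 : {measure set T2 -> \bar R})
    (f1 : T1 -> T) (f2 : T2 -> T) (a1 : T1 -> R) (a2 : T2 -> R) :
  measurable_fun setT f1 -> measurable_fun setT f2 ->
  measurable_fun setT a1 -> measurable_fun setT a2 ->
  (forall x, 0 <= a1 x)%R -> (forall x, 0 <= a2 x)%R ->
  (forall B, measurable B ->
    \int[m1]_x ((\1_B (f1 x))%:E * (a1 x)%:E) = \int[m2]_x ((\1_B (f2 x))%:E * (a2 x)%:E)) ->
  forall f : T -> \bar R, measurable_fun setT f -> (forall x, 0 <= f x) ->
  \int[m1]_x (f (f1 x) * (a1 x)%:E) = \int[m2]_x (f (f2 x) * (a2 x)%:E).
Proof.
move=> mf1 mf2 ma1 ma2 a10 a20 h12.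
have IL d0 (T0 : measurableType d0) (m0 : {measure set T0 -> \bar R}) (f0 : T0 -> T) (a0 : T0 -> R) :
    measurable_fun setT f0 -> measurable_fun setT a0 -> (forall x, 0 <= a0 x)%R ->
    integral_like (fun f : T -> \bar R => \int[m0]_x (f (f0 x) * (a0 x)%:E)).
  move=> mf0 ma0 a00.
  have := @integral_like_mix _ T R _ T0 m0 a0 (fun x f => f (f0 x)) ma0 a00 (fun x => integral_like_eval (f0 x)).
  rewrite (_ : (fun f => _) = (fun f : T -> \bar R => \int[m0]_x (f (f0 x) * (a0 x)%:E))); last first.
    by apply/funext => f; apply: eq_integral => x _; rewrite muleC.
  apply => A mA; apply/measurable_EFinP; apply: measurableT_comp mf0; exact: measurable_indic.
apply: (@integral_like_eq _ T R (fun f => \int[m1]_x (f (f1 x) * (a1 x)%:E))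
  (fun f => \int[m2]_x (f (f2 x) * (a2 x)%:E))) h12; exact: IL.
Qed.

(** Nonnegative weights commute with positive and negative parts, so the identity extends to signed
    integrands; integrability is transferred along with it. *)
Lemma Rintegral_transfer d d1 d2 (T : measurableType d) (T1 : measurableType d1)
    (T2 : measurableType d2) (R : realType)
    (m1 : {measure set T1 -> \bar R}) (m2 : {measure set T2 -> \bar R})
    (f1 : T1 -> T) (f2 : T2 -> T) (a1 : T1 -> R) (a2 : T2 -> R) :
  measurable_fun setT f1 -> measurable_fun setT f2 ->
  measurable_fun setT a1 -> measurable_fun setT a2 ->
  (forall x, 0 <= a1 x)%R -> (forall x, 0 <= a2 x)%R ->
  (forall B, measurable B ->
    \int[m1]_x ((\1_B (f1 x))%:E * (a1 x)%:E) = \int[m2]_x ((\1_B (f2 x))%:E * (a2 x)%:E)) ->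
  forall f : T -> R, measurable_fun setT f ->
  m2.-integrable setT (EFin \o (fun x => (f (f2 x) * a2 x)%R)) ->
  m1.-integrable setT (EFin \o (fun x => (f (f1 x) * a1 x)%R)) /\
  (\int[m1]_x (f (f1 x) * a1 x) = \int[m2]_x (f (f2 x) * a2 x))%R.
Proof.
move=> mf1 mf2 ma1 ma2 a10 a20 h12 f mf /integrableP[_ fi].
have tr := ge0_integral_transfer mf1 mf2 ma1 ma2 a10 a20 h12.
have mfE : measurable_fun setT (EFin \o f) by exact/measurable_EFinP.
split.
  apply/integrableP; split.
    by apply/measurable_EFinP; apply: measurable_funM => //; exact: measurableT_comp.
  under eq_integral do rewrite /= normrM (ger0_norm (a10 _)) EFinM.
  rewrite (tr (fun x => `|f x|%:E)); last by [].
    apply: le_lt_trans fi; rewrite le_eqVlt; apply/orP; left; apply/eqP; apply: eq_integral => x _ /=.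
    by rewrite normrM (ger0_norm (a20 _)) EFinM.
  by apply/measurable_EFinP; exact: measurableT_comp.
rewrite /Rintegral integralE [in RHS]integralE; congr fine.
have E d0 (T0 : measurableType d0) (g : T0 -> T) (a : T0 -> R) : (forall x, 0 <= a x)%R ->
   ((fun x => (f (g x) * a x)%:E)^\+ = fun x => (EFin \o f)^\+ (g x) * (a x)%:E) /\
   ((fun x => (f (g x) * a x)%:E)^\- = fun x => (EFin \o f)^\- (g x) * (a x)%:E).
  move=> a0; split; apply/funext => x.
    by rewrite !funeposE EFinM maxe_pMl ?lee_fin// mul0e.
  by rewrite !funenegE EFinM -mulNe maxe_pMl ?lee_fin// mul0e.
have [-> ->] := E _ _ f1 _ a10; have [-> ->] := E _ _ f2 _ a20.
by rewrite !tr//; [exact: measurable_funeneg|exact: measurable_funepos].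
Qed.

End transfer.

Lemma probability_lty d (T : measurableType d) (R : realType) (P : probability T R) :
  (P setT < +oo)%E.
Proof. by rewrite probability_setT ltry. Qed.

Definition image_measure d1 d2 (T1 : measurableType d1) (T2 : measurableType d2) (R : realType)
    (m : {measure set T1 -> \bar R}) (f : T1 -> T2) (mf : measurable_fun setT f) :
    {measure set T2 -> \bar R} :=
  measure_function_pushforward__canonical__measure_function_Measure m mf.

Section Rintegral_tools.
Context d (T : measurableType d) (R : realType).

Lemma Rintegral_dominated_cvg (m : {measure set T -> \bar R}) (f_ : nat -> T -> R) (f g : T -> R) :
  (forall n, measurable_fun setT (f_ n)) -> measurable_fun setT f ->
  {ae m, forall x, f_ n x @[n --> \oo] --> f x} ->
  m.-integrable setT (EFin \o g) -> {ae m, forall x n, `|f_ n x| <= g x} ->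
  \int[m]_x f_ n x @[n --> \oo] --> \int[m]_x f x.
Proof.
move=> mf_ mf cf ig fg.
have [|||||fi _ L] := @dominated_convergence _ _ _ m setT measurableT (fun n x => (f_ n x)%:E) (EFin \o f) (EFin \o g).
- by move=> n; exact/measurable_EFinP.
- exact/measurable_EFinP.
- apply: filterS cf => x cx _; apply: cvg_EFin; last exact: cx.
  by apply: nearW => n.
- exact: ig.
- by apply: filterS fg => x gx n _; rewrite lee_fin; exact: gx.
apply: fine_cvg; rewrite fineK//; exact: integrable_fin_num fi.
Qed.

Lemma bounded_integrable (m : {measure set T -> \bar R}) (f : T -> R) (C : R) :
  (m setT < +oo)%E -> measurable_fun setT f -> (forall x, `|f x| <= C) -> m.-integrable setT (EFin \o f).
Proof.
move=> m1 mf fC; apply: measurable_bounded_integrable => //.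
by exists C; split; [exact: num_real|move=> M CM x _ /=; rewrite (le_trans (fC x))// ltW].
Qed.

Lemma integrable_le (m : {measure set T -> \bar R}) (f g : T -> R) :
  measurable_fun setT f -> (forall x, `|f x| <= g x) -> m.-integrable setT (EFin \o g) ->
  m.-integrable setT (EFin \o f).
Proof.
move=> mf fg; apply: le_integrable => //; first exact/measurable_EFinP.
by move=> x _ /=; rewrite lee_fin (le_trans (fg x))// ler_norm.
Qed.

Lemma eq_Rintegral_null (m : {measure set T -> \bar R}) (A : set T) (f g : T -> R) :
  measurable A -> m (~` A) = 0%E -> measurable_fun setT f -> measurable_fun setT g ->
  (forall x, A x -> f x = g x) -> \int[m]_x f x = \int[m]_x g x.
Proof.
move=> mA A0 mf mg fg; congr fine; apply: ae_eq_integral => //.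
- exact/measurable_EFinP.
- exact/measurable_EFinP.
- exists (~` A); split => //; first exact: measurableC.
  by move=> x /= h Ax; apply: h => _; rewrite fg.
Qed.

End Rintegral_tools.

(** * Brownian increments *)

Section normal_moments.
Context {R : realType}.
Local Notation mu := (@lebesgue_measure R).

(** Integrating over [[-n-1, n+1]] leaves boundary values of [F], which decay like [1/n]. *)
Lemma Rintegral_derivative_eq0 (F h : R -> R) (K : R) :
  continuous h -> mu.-integrable setT (EFin \o h) ->
  (forall x : R, is_derive x 1 F (h x)) -> (forall x : R, 1 <= `|x| -> `|F x| <= K / `|x|) ->
  \int[mu]_x h x = 0.
Proof.
move=> hc hi dF bF.
have FTC (n : nat) : \int[mu]_(x in `[- n.+1%:R, n.+1%:R]) h x = F n.+1%:R - F (- n.+1%:R).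
  rewrite /Rintegral (@continuous_FTC2 _ h F)//.
  - by rewrite gtrN.
  - exact: continuous_subspaceT.
  - have dcF : continuous F by move=> x; apply/differentiable_continuous/derivable1_diffP; exact: ex_derive.
    split; [by move=> x _; exact: ex_derive|by apply: cvg_at_right_filter; exact: dcF|
      by apply: cvg_at_left_filter; exact: dcF].
  - by move=> x _; rewrite derive1E derive_val.
have L : \int[mu]_(x in `[- n.+1%:R, n.+1%:R]) h x @[n --> \oo] --> \int[mu]_x h x.
  have mh : measurable_fun setT h by exact: continuous_measurable_fun.
  rewrite (_ : (fun n => _) = (fun n : nat => \int[mu]_x (h \_ `[- n.+1%:R, n.+1%:R]) x)); last first.
    by apply/funext => n; rewrite Rintegral_mkcond.
  apply: (@Rintegral_dominated_cvg _ _ _ mu _ _ (fun x => `|h x|)) => //.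
  - by move=> n; apply/(measurable_restrictT _ _).1 => //; exact: measurable_funTS.
  - apply: aeW => x; apply: cvg_near_cst; near=> n; rewrite patchE ifT// inE /= in_itv /=.
    rewrite -ler_norml (le_trans (_ : _ <= n%:R))//; last by rewrite ler_nat.
    by near: n; exact: nbhs_infty_ger.
  - by move: hi => /integrable_norm.
  - by apply: aeW => x n; rewrite patchE; case: ifP => // _; rewrite normr0.
have L0 : \int[mu]_(x in `[- n.+1%:R, n.+1%:R]) h x @[n --> \oo] --> 0.
  rewrite (_ : (fun n => _) = (fun n => F n.+1%:R - F (- n.+1%:R))); last exact/funext.
  apply: (@squeeze_cvgr _ _ _ _ (fun n => - (2 * K * harmonic n)) (fun n => 2 * K * harmonic n)).
    near=> n; rewrite -ler_norml (le_trans (ler_normB _ _))//.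
    have n1 : 1 <= `|n.+1%:R : R| by rewrite ger0_norm// ler1n.
    have := bF _ n1; have := bF (- n.+1%:R); rewrite normrN => /(_ n1).
    rewrite (ger0_norm (ler0n _ _)) => h1 h2; apply: (@le_trans _ _ (2 * K * n.+1%:R^-1)) => //.
    by rewrite -[leRHS]mulrA mulr_natl mulr2n lerD.
  - rewrite -oppr0; apply: cvgN; rewrite -(mulr0 (2 * K)); apply: cvgM; first exact: cvg_cst.
    exact: cvg_harmonic.
  - rewrite -(mulr0 (2 * K)); apply: cvgM; first exact: cvg_cst.
    exact: cvg_harmonic.
exact: (cvg_unique _ L L0).
Unshelve. all: by end_near. Qed.

Variable s : R.
Hypothesis s0 : 0 < s.
Local Notation p := (normal_pdf 0 s).

Lemma normal_pdf0E x : p x = normal_peak s * expR (- x ^+ 2 / (s ^+ 2 *+ 2)).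
Proof. by rewrite normal_pdfE ?gt_eqF// /normal_fun subr0. Qed.

(** Square the inequality [1 + y/2 <= expR (y/2)]. *)
Lemma expR_ge_sqr (y : R) : 0 <= y -> y ^+ 2 <= 4 * expR y.
Proof.
move=> y0; have -> : y = y / 2 + y / 2 by lra.
rewrite expRD; have := expR_ge1Dx (y / 2); set e := expR _; nra.
Qed.

Lemma normal_pdf_decay : exists2 K, 0 <= K & forall x, (1 + x ^+ 4) * p x <= K * normal_pdf 0 (2 * s) x.
Proof.
(* The number with [1/(2 s^2) - 1/(8 s^2) = 1/c]: the Gaussian rate that is left to absorb [x^4]
   once the density of deviation [2 s] has been factored out. *)
pose c := 8 * s ^+ 2 / 3.
have ss : 0 < s ^+ 2 by rewrite exprn_gt0.
have c0 : 0 < c by rewrite /c; lra.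
exists (normal_peak s / normal_peak (2 * s) * (1 + 4 * c ^+ 2)).
  by rewrite mulr_ge0 ?divr_ge0 ?normal_peak_ge0// addr_ge0// mulr_ge0// sqr_ge0.
move=> x; rewrite normal_pdf0E normal_pdfE ?gt_eqF ?mulr_gt0// /normal_fun subr0.
have -> : - x ^+ 2 / (s ^+ 2 *+ 2) = - x ^+ 2 / ((2 * s) ^+ 2 *+ 2) - x ^+ 2 / c.
  rewrite -[s ^+ 2 *+ 2]mulr_natl -[(2 * s) ^+ 2 *+ 2]mulr_natl /c exprMn.
  move: (s ^+ 2) ss => S ss; move: (x ^+ 2) => X.
  by field; rewrite gt_eqF.
rewrite expRD; set e1 := expR (_ / _); set y := x ^+ 2 / c.
have y0 : 0 <= y by rewrite /y divr_ge0 ?sqr_ge0// ltW.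
have xy : x ^+ 4 = c ^+ 2 * y ^+ 2 by rewrite -exprMn /y mulrCA divff ?mulr1 -?exprM// gt_eqF.
have ey : expR y * expR (- y) = 1 by rewrite -expRD subrr expR0.
have e0 : 0 < expR (- y) by exact: expR_gt0.
have h1 : y ^+ 2 * expR (- y) <= 4.
  by have := expR_ge_sqr y0; rewrite -(ler_pM2r e0) -[leRHS]mulrA ey mulr1.
have h2 : expR (- y) <= 1 by rewrite -[leRHS]expR0 ler_expR; lra.
have k1 : 0 < normal_peak s by rewrite normal_peak_gt0// gt_eqF.
have k2 : 0 < normal_peak (2 * s) by rewrite normal_peak_gt0// gt_eqF// mulr_gt0.
have e10 : 0 < e1 by exact: expR_gt0.
have -> : normal_peak s / normal_peak (2 * s) * (1 + 4 * c ^+ 2) * (normal_peak (2 * s) * e1) =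
   normal_peak s * e1 * (1 + 4 * c ^+ 2) by field; rewrite gt_eqF.
have -> : (1 + x ^+ 4) * (normal_peak s * (e1 * expR (- y))) =
   normal_peak s * e1 * (expR (- y) + c ^+ 2 * (y ^+ 2 * expR (- y))) by rewrite xy; ring.
by rewrite ler_pM2l ?mulr_gt0// lerD// mulrC ler_wpM2r// sqr_ge0.
Qed.

Lemma abs_exp_le (x : R) k : (k <= 4)%N -> `|x| ^+ k <= 1 + x ^+ 4.
Proof.
move=> k4; have -> : x ^+ 4 = `|x| ^+ 4 by rewrite -normrX ger0_norm// exprn_even_ge0.
have [x1|x1] := leP `|x| 1.
  by rewrite (@le_trans _ _ 1) ?exprn_ile1// lerDl exprn_ge0.
by rewrite (le_trans (ler_weXn2l _ k4))// ?lerDr// ltW.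
Qed.

Lemma integrable_moment k : (k <= 4)%N -> mu.-integrable setT (EFin \o (fun x => x ^+ k * p x)).
Proof.
move=> k4; have [K K0 hK] := normal_pdf_decay.
apply: (@integrable_le _ _ _ mu _ (fun x => K * normal_pdf 0 (2 * s) x)).
- by apply: measurable_funM; [exact: exprn_measurable|exact: measurable_normal_pdf].
- move=> x; rewrite normrM normrX (ger0_norm (normal_pdf_ge0 _ _ _)).
  by rewrite (le_trans _ (hK x))// ler_wpM2r ?normal_pdf_ge0// abs_exp_le.
- rewrite (_ : _ \o _ = (fun x => K%:E * (normal_pdf 0 (2 * s) x)%:E)%E)//.
  by apply: integrableZl => //; exact: integrable_normal_pdf.
Qed.

(** [h] is the derivative of [- s^2 x^k p(x)], so that its integral is 0. For [k = 0] the
    predecessor is 0 again, and the coefficient [k%:R] cancels the spurious term. *)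
Lemma moment_rec k : (k <= 3)%N ->
  \int[mu]_x (x ^+ k.+1 * p x) = s ^+ 2 * k%:R * \int[mu]_x (x ^+ k.-1 * p x).
Proof.
move=> k3; have [K K0 hK] := normal_pdf_decay.
have ss : s ^+ 2 != 0 by rewrite gt_eqF// exprn_gt0.
pose h x := x ^+ k.+1 * p x - s ^+ 2 * k%:R * (x ^+ k.-1 * p x).
have i1 : mu.-integrable setT (EFin \o (fun x => x ^+ k.+1 * p x)) by exact: integrable_moment.
have i2 : mu.-integrable setT (EFin \o (fun x => s ^+ 2 * k%:R * (x ^+ k.-1 * p x))).
  rewrite (_ : _ \o _ = (fun x => (s ^+ 2 * k%:R)%:E * (x ^+ k.-1 * p x)%:E)%E)//.
  by apply: integrableZl => //; apply: integrable_moment; rewrite (leq_trans (leq_pred _))// ltnW.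
have dp (x : R) : is_derive x 1 p (- x / s ^+ 2 * p x).
  have d1 : is_derive x 1 (fun x : R => - x ^+ 2 / (s ^+ 2 *+ 2)) (- x / s ^+ 2).
    have := @is_deriveZ _ _ _ _ (- (s ^+ 2 *+ 2)^-1) x 1 _ (@is_deriveX _ _ (@id R) 2 x 1 _ (is_derive_id _ _)).
    rewrite (_ : _ *: _ = - x / s ^+ 2); last first.
      rewrite [_%:A]mulr1 expr1 [LHS]mulrC -[s ^+ 2 *+ 2]mulr_natl.
      by move: (s ^+ 2) ss => S ss; field.
    move=> h0; apply: (@eq_ind _ _ (fun g => is_derive x 1 g _) h0).
    by apply/funext => r /=; rewrite [LHS]mulNr mulrC -mulNr.
  have d2 := @is_derive1_comp _ expR _ x _ _ (is_derive_expR _) d1.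
  have := @is_deriveZ _ _ _ _ (normal_peak s) x 1 _ d2.
  rewrite (_ : _ *: _ = - x / s ^+ 2 * p x); last first.
    by rewrite normal_pdf0E [LHS]mulrA mulrC.
  move=> h0; apply: (@eq_ind _ _ (fun g => is_derive x 1 g _) h0).
  by apply/funext => r /=; rewrite normal_pdf0E.
suff : \int[mu]_x h x = 0.
  rewrite /h RintegralB// RintegralZl//; last first.
    by apply: integrable_moment; rewrite (leq_trans (leq_pred _))// ltnW.
  by move=> /eqP; rewrite subr_eq0 => /eqP.
apply: (@Rintegral_derivative_eq0 (fun x => - s ^+ 2 * (x ^+ k * p x)) h
   (s ^+ 2 * (K * normal_peak (2 * s)))).
- move=> x; apply: (@cvgB _ _ _ (nbhs x)); apply: (@cvgM _ _ (nbhs x)).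
  + exact: exprn_continuous.
  + by apply: continuous_normal_pdf; rewrite gt_eqF.
  + exact: cvg_cst.
  + apply: (@cvgM _ _ (nbhs x)); first exact: exprn_continuous.
    by apply: continuous_normal_pdf; rewrite gt_eqF.
- exact: (integrableB measurableT i1 i2).
- move=> x.
  have := @is_deriveZ _ _ _ _ (- s ^+ 2) x 1 _ (@is_deriveM _ _ _ _ x 1 _ _ (@is_deriveX _ _ (@id R) k x 1 _ (is_derive_id _ _)) (dp x)).
  rewrite (_ : _ *: _ = h x); last first.
    rewrite [_%:A]mulr1 /h !fctE [x ^+ k.+1]exprS /GRing.scale /=.
    by move: (s ^+ 2) ss (x ^+ k) (x ^+ k.-1) (p x) => S ss A B C; field.
  move=> h0; apply: (@eq_ind _ _ (fun g => is_derive x 1 g _) h0).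
  by apply/funext => r /=; rewrite !fctE.
- move=> x x1; rewrite normrM normrN (ger0_norm (sqr_ge0 _)) -mulrA ler_wpM2l ?sqr_ge0//.
  rewrite ler_pdivlMr ?(lt_le_trans ltr01)//.
  rewrite normrM normrX (ger0_norm (normal_pdf_ge0 _ _ _)) mulrAC -exprSr.
  have k4 : (k.+1 <= 4)%N by [].
  apply: le_trans (le_trans (hK x) _).
    by rewrite ler_wpM2r ?normal_pdf_ge0// abs_exp_le.
  by rewrite ler_wpM2l// normal_pdf_ub// gt_eqF// mulr_gt0.
Qed.

Local Notation N := (normal_prob 0 s).

Lemma Rintegral_normal_prob (f : R -> R) : measurable_fun setT f ->
  mu.-integrable setT (EFin \o (fun x => f x * p x)) ->
  N.-integrable setT (EFin \o f) /\ \int[N]_x f x = \int[mu]_x (f x * p x).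
Proof.
move=> mf fi.
have [|||||||i1 E1] := @Rintegral_transfer _ _ _ _ _ _ R N mu id id (cst 1) p _ _ _ _ _ _ _ f mf fi => //.
- exact: measurable_normal_pdf.
- exact: normal_pdf_ge0.
- move=> B mB; under eq_integral do rewrite mule1.
  rewrite integral_indic// setIT; transitivity (\int[mu]_x (((EFin \o p) \_ B) x))%E.
    exact: integral_mkcond.
  apply: eq_integral => x _; rewrite patchE indicE.
  by case: (x \in B); rewrite ?mul1e ?mul0e.
have E : (fun x => f (id x) * cst 1 x) = f by apply/funext => x; rewrite mulr1.
by split; [rewrite -E|rewrite -E1 E].
Qed.

Lemma normal_moment_integrable k : (k <= 4)%N -> N.-integrable setT (EFin \o (fun x => x ^+ k)).
Proof. by move=> k4; have [] := Rintegral_normal_prob (exprn_measurable k) (integrable_moment k4). Qed.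

Lemma normal_moment_rec k : (k <= 3)%N ->
  \int[N]_x (x ^+ k.+1) = s ^+ 2 * k%:R * \int[N]_x (x ^+ k.-1).
Proof.
move=> k3; have k4 : (k.-1 <= 4)%N by rewrite (leq_trans (leq_pred _))// ltnW.
have [_ ->] := Rintegral_normal_prob (exprn_measurable k.+1) (integrable_moment (k3 : (k.+1 <= 4)%N)).
have [_ ->] := Rintegral_normal_prob (exprn_measurable k.-1) (integrable_moment k4).
exact: moment_rec.
Qed.

Lemma normal_moment1 : \int[N]_x x = 0.
Proof. by have := @normal_moment_rec 0 isT; rewrite mulr0 mul0r. Qed.

Lemma normal_moment2 : \int[N]_x (x ^+ 2) = s ^+ 2.
Proof.
rewrite (@normal_moment_rec 1 isT) mulr1 (_ : \int[N]_x _ = 1) ?mulr1//.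
transitivity (1 * fine (N setT)); first exact: Rintegral_cst.
by rewrite mul1r /normal_prob integral_normal_pdf.
Qed.

Lemma normal_moment4 : \int[N]_x (x ^+ 4) = 3 * s ^+ 4.
Proof. by rewrite (@normal_moment_rec 3 isT)/= normal_moment2; ring. Qed.

End normal_moments.

Lemma Rintegral1 (R : realType) d (T : measurableType d) (P : probability T R) :
  \int[P]_x (1 : R) = 1.
Proof. by transitivity (1 * fine (P setT)); [exact: Rintegral_cst|rewrite probability_setT mul1r]. Qed.

(** The hypothesis says that the positive and the negative part of [K], taken as densities, have the
    same image under [f]; [Rintegral_transfer] then extends the equality from indicators to [q]. *)
Lemma Rintegral_orthogonal d1 d2 (T : measurableType d1) (U : measurableType d2) (R : realType)
    (m : {measure set U -> \bar R}) (f : U -> T) (K : U -> R) :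
  measurable_fun setT f -> m.-integrable setT (EFin \o K) ->
  (forall B, measurable B -> \int[m]_x (\1_B (f x) * K x) = 0) ->
  forall q : T -> R, measurable_fun setT q -> m.-integrable setT (EFin \o (fun x => q (f x) * K x)) ->
  \int[m]_x (q (f x) * K x) = 0.
Proof.
move=> mf Ki h0 q mq qKi.
have mK : measurable_fun setT K by apply/measurable_EFinP; exact: measurable_int Ki.
have mKp : measurable_fun setT (K^\+)%R by exact: measurable_funrpos.
have mKn : measurable_fun setT (K^\-)%R by exact: measurable_funrneg.
have KE x : K x = (K^\+)%R x - (K^\-)%R x by rewrite -[K in LHS]funrposBneg.
have part (p : T -> R) (a : U -> R) : (forall x, `|a x| <= `|K x|) -> measurable_fun setT a ->
    measurable_fun setT p -> m.-integrable setT (EFin \o (fun x => p (f x) * K x)) ->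
    m.-integrable setT (EFin \o (fun x => p (f x) * a x)).
  move=> aK ma mp pKi.
  apply: (@integrable_le _ _ _ m _ (fun x => `|p (f x) * K x|)).
  - by apply: measurable_funM => //; exact: measurableT_comp.
  - by move=> x; rewrite !normrM ler_wpM2l.
  - exact: (integrable_norm pKi).
have NE x : `|K x| = (K^\+)%R x + (K^\-)%R x by have := congr1 (fun g => g x) (funrposDneg K).
have pK x : `|(K^\+)%R x| <= `|K x|.
  by rewrite NE ger0_norm ?lerDl// ?funrpos_ge0 ?funrneg_ge0.
have nK x : `|(K^\-)%R x| <= `|K x|.
  by rewrite NE ger0_norm ?lerDr// ?funrpos_ge0 ?funrneg_ge0.
have mI B : measurable B -> measurable_fun setT (\1_B : T -> R) by move=> mB; exact: measurable_indic.
have IKi B : measurable B -> m.-integrable setT (EFin \o (fun x => \1_B (f x) * K x)).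
  move=> mB; apply: (@integrable_le _ _ _ m _ (fun x => `|K x|)).
  - by apply: measurable_funM => //; apply: measurableT_comp => //; exact: mI.
  - by move=> x; rewrite normrM indicE; case: (_ \in _); rewrite ?normr1 ?normr0 ?mul1r ?mul0r.
  - exact: (integrable_norm Ki).
have split (p : T -> R) : measurable_fun setT p -> m.-integrable setT (EFin \o (fun x => p (f x) * K x)) ->
   \int[m]_x (p (f x) * K x) = \int[m]_x (p (f x) * (K^\+)%R x) - \int[m]_x (p (f x) * (K^\-)%R x).
  move=> mp pKi; rewrite -RintegralB//; [|exact: part|exact: part].
  by apply: eq_Rintegral => x _; rewrite -mulrBr -KE.
have qi : m.-integrable setT (EFin \o (fun x => q (f x) * (K^\-)%R x)) by exact: part.
have [|||||_ E] := @Rintegral_transfer _ _ _ _ _ _ R m m f f (K^\+)%R (K^\-)%R mf mf _ _ _ _ _ q mq qi => //.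
- move=> B mB; have := h0 B mB; rewrite (split _ (mI B mB) (IKi B mB)) => /eqP.
  rewrite subr_eq0 /Rintegral => /eqP E; move: (congr1 EFin E).
  have fn (a : U -> R) : (forall x, `|a x| <= `|K x|) -> measurable_fun setT a ->
     (\int[m]_x (\1_B (f x) * a x)%:E)%E \is a fin_num.
    by move=> aK ma; apply: integrable_fin_num => //; exact: (part _ _ aK ma (mI _ mB) (IKi _ mB)).
  by rewrite !fineK; [move=> EE; exact: EE|exact: fn|exact: fn].
by rewrite split// E subrr.
Qed.

(** * Brownian increments against the past *)

Section increments.
Context {R : realType} {d : nat} {dO} {Omega : measurableType dO}.
Variables (F : R -> set (set Omega)) (P : probability Omega R) (W : R -> Omega -> borel R d).
Hypothesis hF : filtration F.
Hypothesis hW : brownian_motion F P W.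

Definition increment (X : R -> Omega -> borel R d) (s t : R) (i : 'I_d) (w : Omega) : R :=
  (X t w - X s w : 'cV[R]_d) i 0.

Lemma adapted_measurable (X : R -> Omega -> borel R d) t : adapted F X -> 0 <= t -> measurable_fun setT (X t).
Proof.
move=> aX t0 _ B mB; have [_ + _] := hF; apply; first exact: t0.
by apply: (aX t t0); exists B => //.
Qed.

Lemma adapted_coord_measurable (X : R -> Omega -> borel R d) t i : adapted F X -> 0 <= t ->
  measurable_fun setT (fun w => (X t w : 'cV[R]_d) i 0).
Proof.
move=> aX t0; apply: (@measurableT_comp _ _ _ _ _ _ (fun x : borel R d => (x : 'cV[R]_d) i 0) _ (X t)).
  exact: measurable_coord.
exact: adapted_measurable.
Qed.

Lemma increment_measurable (X : R -> Omega -> borel R d) s t i : adapted F X -> 0 <= s -> s <= t ->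
  measurable_fun setT (increment X s t i).
Proof.
move=> aX s0 st; rewrite (_ : increment _ _ _ _ = (fun w => (X t w : 'cV[R]_d) i 0 - (X s w : 'cV[R]_d) i 0)); last first.
  by apply/funext => w; rewrite /increment !mxE.
by apply: measurable_funB; apply: adapted_coord_measurable => //; exact: le_trans st.
Qed.

Variables (s t : R).
Hypotheses (s0 : 0 <= s) (st : s < t).
Local Notation V := (increment W s t).
Local Notation N := (normal_prob 0 (Num.sqrt (t - s))).

Let aW : adapted F W. Proof. by case: hW. Qed.
Let mV i : measurable_fun setT (V i). Proof. by apply: increment_measurable => //; exact: ltW. Qed.
Let sq0 : 0 < Num.sqrt (t - s). Proof. by rewrite sqrtr_gt0 subr_gt0. Qed.

Lemma filtration_measurable A : F s A -> measurable A.
Proof. by have [_ + _] := hF; apply. Qed.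

Lemma NT : N setT = 1%E.
Proof. by rewrite /normal_prob integral_normal_pdf. Qed.

Lemma increment_indep2 A i j B B' : F s A -> i != j -> measurable B -> measurable B' ->
  P (A `&` (V i @^-1` B `&` V j @^-1` B')) = (P A * (N B * N B'))%E.
Proof.
move=> FA ij mB mB'; have [_ _ _ /(_ s t s0 st A FA)] := hW.
move=> /(_ (fun k => if k == i then B else if k == j then B' else setT)) H.
transitivity (P (A `&` [set w | forall k, (if k == i then B else if k == j then B' else setT)
    ((W t w - W s w : 'cV[R]_d) k 0)])).
  congr (P (_ `&` _)); apply/seteqP; split=> w /=.
    by move=> [h1 h2] k; case: eqP => [->//|_]; case: eqP => [->//|_].
  move=> h; split; first by have := h i; rewrite eqxx.
  by have := h j; rewrite eq_sym (negbTE ij) eqxx.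
rewrite H; last by move=> k; case: ifP => // _; case: ifP.
congr (_ * _)%E; rewrite (bigD1 i)//= eqxx (bigD1 j)/=; last by rewrite eq_sym.
rewrite eq_sym (negbTE ij) eqxx big1 ?mule1// => k /andP[/negbTE -> /negbTE ->]; exact: NT.
Qed.

Lemma increment_indep A i B : F s A -> measurable B -> P (A `&` V i @^-1` B) = (P A * N B)%E.
Proof.
move=> FA mB; have [_ _ _ /(_ s t s0 st A FA)] := hW.
move=> /(_ (fun k => if k == i then B else setT)) H.
transitivity (P (A `&` [set w | forall k, (if k == i then B else setT)
    ((W t w - W s w : 'cV[R]_d) k 0)])).
  congr (P (_ `&` _)); apply/seteqP; split=> w /=.
    by move=> h1 k; case: eqP => [->//|_].
  by move=> h; have := h i; rewrite eqxx.
rewrite H; last by move=> k; case: ifP.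
congr (_ * _)%E; rewrite (bigD1 i)//= eqxx big1 ?mule1// => k /negbTE ->; exact: NT.
Qed.

Let indicM (A : set Omega) (B : set R) i w : ((\1_B (V i w))%:E * (\1_A w)%:E = (\1_(A `&` V i @^-1` B) w)%:E :> \bar R)%E.
Proof. by rewrite -EFinM mulrC !indicE in_setI; case: (w \in A); rewrite ?mul0r ?mul1r. Qed.

Let integral_indicZ C r : measurable C -> 0 <= r ->
  (\int[N]_x ((\1_C x)%:E * (cst r x)%:E) = r%:E * N C)%E.
Proof.
move=> mC r0; transitivity (\int[N]_x (r%:E * (\1_C x)%:E))%E.
  by apply: eq_integral => x _; rewrite muleC.
rewrite ge0_integralZl_EFin//; first by rewrite integral_indic// setIT.
by apply/measurable_EFinP; exact: measurable_indic.
Qed.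

(** Restricted to [A], the increment has the law [P A] times the normal law; this constant enters as
    a weight. *)
Lemma increment_moment A i k : F s A -> (k <= 4)%N ->
  P.-integrable setT (EFin \o (fun w => V i w ^+ k * \1_A w)) /\
  \int[P]_w (V i w ^+ k * \1_A w) = fine (P A) * \int[N]_x (x ^+ k).
Proof.
move=> FA k4; have mA := filtration_measurable FA.
have PA : 0 <= fine (P A) by apply: fine_ge0.
have Ni : N.-integrable setT (EFin \o (fun x => x ^+ k * cst (fine (P A)) x)).
  by have := @integrableZr _ _ _ N setT measurableT (fine (P A)) _ (normal_moment_integrable sq0 k4).
have [|||||||i1 E1] := @Rintegral_transfer _ _ _ _ _ _ R P N (V i) id (\1_A) (cst (fine (P A)))
   _ _ _ _ _ _ _ (fun x => x ^+ k) (exprn_measurable k) Ni => //.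
- move=> B mB; under eq_integral do rewrite indicM.
  rewrite integral_indic//; last by apply: measurableI => //; rewrite -[X in measurable X]setTI; exact: mV.
  rewrite setIT; transitivity (P A * N B)%E; first exact: increment_indep.
  by rewrite integral_indicZ// fineK// fin_num_measure.
split => //; rewrite E1 RintegralZr//; first by rewrite mulrC.
exact: normal_moment_integrable.
Qed.

Lemma increment_integrable i k : (k <= 4)%N -> P.-integrable setT (EFin \o (fun w => V i w ^+ k)).
Proof.
move=> k4; have [_ FT _] := hF; have FsT : F s setT.
  by have [+ _ _] := hF => /(_ s s0) [h1 h2 _]; have := h2 _ h1; rewrite setD0.
have [+ _] := increment_moment i FsT k4.
by rewrite (_ : (fun w => _ * \1_setT w) = (fun w => V i w ^+ k))//; apply/funext => w; rewrite indicT mulr1.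
Qed.

(** On [A] intersected with an event of [V i], joint independence still makes [V j] a centred normal
    variable. Hence [V j] is orthogonal to every function of [V i], in particular to the
    identity. *)
Lemma increment_moment11 A i j : F s A -> i != j ->
  P.-integrable setT (EFin \o (fun w => V i w * V j w)) /\
  \int[P]_w (V i w * V j w * \1_A w) = 0.
Proof.
move=> FA ij; have mA := filtration_measurable FA.
have mVV : measurable_fun setT (fun w => V i w * V j w) by exact: measurable_funM.
have ii : P.-integrable setT (EFin \o (fun w => V i w * V j w)).
  apply: (@integrable_le _ _ _ P _ (fun w => V i w ^+ 2 + V j w ^+ 2)) => //.
    move=> w; have := sqr_ge0 (V i w + V j w); have := sqr_ge0 (V i w - V j w).
    by rewrite ler_norml => h1 h2; apply/andP; split; nra.
  exact: (integrableD measurableT (increment_integrable i (isT : (2 <= 4)%N)) (increment_integrable j (isT : (2 <= 4)%N))).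
split => //.
pose K w := V j w * \1_A w.
have KE w : V i w * V j w * \1_A w = V i w * K w by rewrite mulrA.
under eq_Rintegral do rewrite KE.
have [Ki _] := increment_moment j FA (isT : (1 <= 4)%N).
apply: (@Rintegral_orthogonal _ _ _ _ R P (V i) K (mV i) Ki _ id) => //.
- move=> B mB; pose A' := A `&` V i @^-1` B.
  have mA' : measurable A'.
    by apply: measurableI => //; rewrite -[X in measurable X]setTI; exact: mV.
  have E w : \1_B (V i w) * K w = V j w * \1_A' w.
    rewrite /K /A' !indicE in_setI.
    have -> : (w \in V i @^-1` B) = (V i w \in B) by apply/idP/idP; rewrite !inE.
    by case: (w \in A); case: (_ \in B); rewrite ?mulr1 ?mulr0 ?mul1r ?mul0r.
  under eq_Rintegral do rewrite E.
  have PA' : 0 <= fine (P A') by apply: fine_ge0.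
  have Ni : N.-integrable setT (EFin \o (fun x => id x * cst (fine (P A')) x)).
    by have := @integrableZr _ _ _ N setT measurableT (fine (P A')) _ (normal_moment_integrable sq0 (isT : (1 <= 4)%N)).
  have [|||||||_ E1] := @Rintegral_transfer _ _ _ _ _ _ R P N (V j) id (\1_A') (cst (fine (P A')))
     _ _ _ _ _ _ _ id (@measurable_id _ _ _) Ni => //.
  + move=> C mC; under eq_integral do rewrite indicM.
    rewrite integral_indic//; last by apply: measurableI => //; rewrite -[X in measurable X]setTI; exact: mV.
    rewrite setIT /A' -setIA.
    transitivity (P (A `&` V i @^-1` B) * N C)%E.
      transitivity (P A * (N B * N C))%E; first exact: increment_indep2.
      by rewrite muleA; congr (_ * _)%E; symmetry; exact: increment_indep.
    by rewrite integral_indicZ// fineK// fin_num_measure.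
  rewrite E1 RintegralZr//; last exact: (normal_moment_integrable sq0 (isT : (1 <= 4)%N)).
  by rewrite normal_moment1// mul0r.
- apply: (@integrable_le _ _ _ P _ (fun w => `|V i w * V j w|)).
  + by apply: measurable_funM => //; apply: measurable_funM => //; exact: measurable_indic.
  + move=> w; rewrite mulrA normrM -[leRHS]mulr1 ler_wpM2l//.
    by rewrite indicE; case: (_ \in _); rewrite ?normr1 ?normr0.
  + exact: (integrable_norm ii).
Qed.

Section against_past.
Variables (Z : R -> Omega -> borel R d) (q : borel R d -> R) (C : R).
Hypothesis aZ : adapted F Z.
Hypotheses (mq : measurable_fun setT q) (qC : forall x, `|q x| <= C).

Let mZ : measurable_fun setT (Z s). Proof. exact: adapted_measurable. Qed.

Let FZ B : measurable B -> F s (Z s @^-1` B).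
Proof. by move=> mB; apply: (aZ s0); exists B => //; rewrite setTI. Qed.

Lemma past_integrable (K : Omega -> R) : P.-integrable setT (EFin \o K) ->
  P.-integrable setT (EFin \o (fun w => q (Z s w) * K w)).
Proof.
move=> Ki; apply: (@integrable_le _ _ _ P _ (fun w => C * `|K w|)).
- apply: measurable_funM; first exact: measurableT_comp.
  by apply/measurable_EFinP; exact: measurable_int Ki.
- by move=> w; rewrite normrM ler_wpM2r.
- rewrite (_ : _ \o _ = (fun w => C%:E * `|K w|%:E)%E)//.
  by apply: integrableZl => //; exact: (integrable_norm Ki).
Qed.

(** The hypothesis says that [K] has conditional expectation [c] given the past. Orthogonality is
    applied to [K - c], because it yields products with arbitrary bounded functions of [Z s]. *)
Lemma past_orthogonal (K : Omega -> R) (c : R) : P.-integrable setT (EFin \o K) ->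
  (forall A, F s A -> \int[P]_w (K w * \1_A w) = fine (P A) * c) ->
  \int[P]_w (q (Z s w) * K w) = c * \int[P]_w q (Z s w).
Proof.
move=> Ki hK.
have qi : P.-integrable setT (EFin \o (fun w => q (Z s w))).
  apply: (@bounded_integrable _ _ _ P _ C) => //; last exact: measurableT_comp.
  exact: probability_lty.
have ci : P.-integrable setT (EFin \o (cst c)) by exact: finite_measure_integrable_cst.
have Kci : P.-integrable setT (EFin \o (fun w => K w - c)) by exact: (integrableB measurableT Ki ci).
have := @Rintegral_orthogonal _ _ _ _ R P (Z s) (fun w => K w - c) mZ Kci _ q mq (past_integrable Kci).
under eq_Rintegral do rewrite mulrBr.
rewrite RintegralB//; [|exact: past_integrable|].
  rewrite RintegralZr// => h; apply/eqP; rewrite -subr_eq0 mulrC; apply/eqP; apply: h => B mB.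
  have mZB : measurable (Z s @^-1` B) by rewrite -[X in measurable X]setTI; exact: mZ.
  have IE w : \1_B (Z s w) = \1_(Z s @^-1` B) w :> R by rewrite !indicE.
  under eq_Rintegral do rewrite IE mulrBr.
  have bi (K' : Omega -> R) : P.-integrable setT (EFin \o K') -> P.-integrable setT (EFin \o (fun w => \1_(Z s @^-1` B) w * K' w)).
    move=> Ki'; apply: (@integrable_le _ _ _ P _ (fun w => `|K' w|)).
    - apply: measurable_funM; first exact: measurable_indic.
      by apply/measurable_EFinP; exact: measurable_int Ki'.
    - by move=> w; rewrite normrM indicE; case: (_ \in _); rewrite ?normr1 ?normr0 ?mul1r ?mul0r.
    - exact: (integrable_norm Ki').
  rewrite RintegralB//; [|exact: bi|exact: bi].
  have -> : \int[P]_x (\1_(Z s @^-1` B) x * K x) = fine (P (Z s @^-1` B)) * c.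
    rewrite -hK; last exact: FZ.
    by apply: eq_Rintegral => w _; rewrite mulrC.
  rewrite RintegralZr//; last by apply: integrable_indic.
  by rewrite /Rintegral integral_indic// setIT subrr.
by have := past_integrable ci.
Qed.

Lemma past_increment1 i : \int[P]_w (q (Z s w) * V i w) = 0.
Proof.
have i1 := increment_integrable i (isT : (1 <= 4)%N).
rewrite (@past_orthogonal (V i) 0) ?mul0r// => A FA.
have [_] := increment_moment i FA (isT : (1 <= 4)%N).
by rewrite normal_moment1// => ->.
Qed.

Lemma past_increment2 i j :
  \int[P]_w (q (Z s w) * (V i w * V j w)) = (if i == j then t - s else 0) * \int[P]_w q (Z s w).
Proof.
have [<-|ij] := eqVneq i j.
  apply: past_orthogonal; first exact: (increment_integrable i (isT : (2 <= 4)%N)).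
  move=> A FA; have [_] := increment_moment i FA (isT : (2 <= 4)%N).
  by rewrite normal_moment2// sqr_sqrtr// subr_ge0 ltW.
have FsT : F s setT.
  by have [+ _ _] := hF => /(_ s s0) [h1 h2 _]; have := h2 _ h1; rewrite setD0.
apply: past_orthogonal; first by have [] := increment_moment11 FsT ij.
by move=> A FA; have [_ ->] := increment_moment11 FA ij; rewrite mulr0.
Qed.

End against_past.

Lemma increment_moment4 i : \int[P]_w (V i w ^+ 4) = 3 * (t - s) ^+ 2.
Proof.
have FsT : F s setT.
  by have [+ _ _] := hF => /(_ s s0) [h1 h2 _]; have := h2 _ h1; rewrite setD0.
have [_] := increment_moment i FsT (isT : (4 <= 4)%N).
rewrite probability_setT mul1r normal_moment4// (_ : Num.sqrt _ ^+ 4 = (t - s) ^+ 2) => [<-|].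
  by apply: eq_Rintegral => w _; rewrite indicT mulr1.
by rewrite (exprM _ 2 2) sqr_sqrtr// subr_ge0 ltW.
Qed.

End increments.

(** * Occupation measures *)

Definition grid {R : realType} (n k : nat) : R := k%:R / n.+1%:R.

Section grid.
Context {R : realType}.

Lemma grid0 n : grid n 0 = 0 :> R. Proof. by rewrite /grid mul0r. Qed.

Lemma grid1 n : grid n n.+1 = 1 :> R. Proof. by rewrite /grid divff// pnatr_eq0. Qed.

Lemma grid_ge0 n k : 0 <= grid n k :> R. Proof. by rewrite /grid divr_ge0. Qed.

Lemma grid_step n k : grid n k.+1 - grid n k = n.+1%:R^-1 :> R.
Proof. by rewrite /grid -mulrBl -natr1 addrC addKr mul1r. Qed.

Lemma grid_lt n k : grid n k < grid n k.+1 :> R.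
Proof. by rewrite -subr_gt0 grid_step invr_gt0. Qed.

Lemma grid_le1 n k : (k <= n.+1)%N -> grid n k <= 1 :> R.
Proof. by move=> kn; rewrite /grid ler_pdivrMr// mul1r ler_nat. Qed.

End grid.

Section occupation.
Context {R : realType} {d : nat} {dO} {Omega : measurableType dO}.
Variables (P : probability Omega R) (Z : R -> Omega -> borel R d) (Y : R -> Omega -> R).
Variables (G : set Omega).
Hypothesis mZ : forall t, 0 <= t -> measurable_fun setT (Z t).
Hypothesis mY : forall t, 0 <= t -> measurable_fun setT (Y t).
Hypothesis mG : measurable G.
Hypothesis PG : P (~` G) = 0%E.
Hypothesis cZ : forall w, G w -> {within `[0, +oo[, continuous (fun t => Z t w : 'cV[R]_d)}.
Hypothesis Y0 : forall w, G w -> Y 0 w = 0.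
Hypothesis Yle : forall w, G w -> forall s t, 0 <= s -> s <= t -> Y s w <= Y t w.
Hypothesis iY : P.-integrable setT (EFin \o Y 1).

Local Notation L := (@lebesgue_measure R).
Local Notation M := (P \x L)%E.

(** The section over [w] in [G] has length [Y t w - Y s w], and half-open intervals make the cells
    of a grid a partition of [D]. *)
Let cell (s t : R) : set (Omega * R) := [set z | G z.1 /\ Y s z.1 <= z.2 < Y t z.1].
Let D := cell 0 1.

Let mcell s t : 0 <= s -> 0 <= t -> measurable (cell s t).
Proof.
move=> s0 t0.
have m2 : measurable_fun setT (fun z : Omega * R => z.2) by exact: measurable_snd.
have m1 r : 0 <= r -> measurable_fun setT (fun z : Omega * R => Y r z.1).
  by move=> r0; apply: measurableT_comp; [exact: mY|exact: measurable_fst].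
have mG' : measurable_fun setT (fun z : Omega * R => z.1) by exact: measurable_fst.
rewrite (_ : cell s t = (fst @^-1` G) `&` ([set z | Y s z.1 <= z.2] `&` [set z | z.2 < Y t z.1])); last first.
  apply/seteqP; split=> z /=; first by move=> [? /andP[]].
  by move=> [? [? ?]]; split => //; apply/andP.
apply: measurableI; first by rewrite -[X in measurable X]setTI; exact: mG'.
apply: measurableI.
  rewrite -[X in measurable X]setTI; exact: (measurable_fun_ler (m1 _ s0) m2 measurableT (Y := [set true])).
rewrite -[X in measurable X]setTI; exact: (measurable_fun_ltr m2 (m1 _ t0) measurableT (Y := [set true])).
Qed.

Let mD : measurable D. Proof. exact: mcell. Qed.

(* The measure is built by a change of clock: tau is the right-continuous inverse of the path of Y, and
   the occupation measure is the image under (w, u) |-> Z (tau u) w of P x Lebesgue on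
   {(w, u) | Y 0 w <= u < Y 1 w}. *)
Let tau (z : Omega * R) : R := sup [set s | 0 <= s <= 1 /\ Y s z.1 <= z.2].

Let tau_lb z s : 0 <= s <= 1 -> Y s z.1 <= z.2 -> s <= tau z.
Proof.
move=> s01 Ys; apply: ub_le_sup; last by split.
by exists 1 => r /= [/andP[]].
Qed.

Let tau_ub z t : D z -> 0 <= t -> z.2 < Y t z.1 -> tau z <= t.
Proof.
move=> [Gz /andP[u0 u1]] t0 ut; apply: ge_sup.
  by exists 0; split => //; rewrite lexx ler01.
move=> s /= [/andP[s0 s1] Ys]; rewrite leNgt; apply/negP => ts.
have := le_lt_trans Ys ut; rewrite ltNge => /negP; apply; apply: Yle => //; exact: ltW.
Qed.

Let tau01 z : D z -> 0 <= tau z <= 1.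
Proof.
move=> /[dup] Dz [Gz /andP[u0 u1]]; apply/andP; split.
  by apply: tau_lb => //; rewrite lexx ler01.
exact: tau_ub.
Qed.

Let Psi (z : Omega * R) : borel R d := if z \in D then Z (tau z) z.1 else (0 : 'cV[R]_d).

Let J n k (z : Omega * R) : R := \1_(cell (grid n k) (grid n k.+1)) z.

(** The Riemann sum of [q(Z)] against [Y], lifted to the product space: integrating [J n k] over the
    second variable gives back the increment of [Y]. *)
Let S n (q : 'cV[R]_d -> R) z := \sum_(k < n.+1) q (Z (grid n k) z.1) * J n k z.

Let sumJ n z : \sum_(k < n.+1) J n k z = \1_D z.
Proof.
have [Gz|Gz] := pselect (G z.1); last first.
  rewrite big1 => [|k _]; first by rewrite indicE memNset// => -[].
  by rewrite /J indicE memNset// => -[].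
pose b (k : nat) : R := (Y (grid n k) z.1 <= z.2)%R%:R.
have bound s t : 0 <= s -> s <= t ->
    \1_(cell s t) z = (Y s z.1 <= z.2)%R%:R - (Y t z.1 <= z.2)%R%:R :> R.
  move=> s0 st; rewrite indicE.
  have -> : (z \in cell s t) = (Y s z.1 <= z.2 < Y t z.1).
    by apply/idP/idP => [|h]; rewrite inE => //; case.
  have := Yle Gz s0 st; rewrite (ltNge z.2).
  have [a|a] := leP (Y s z.1) z.2; have [c|c] := leP (Y t z.1) z.2 => /= h; rewrite ?subr0 ?subrr//.
  by move: (lt_le_trans (lt_le_trans a h) c); rewrite ltxx.
rewrite (eq_bigr (fun k : 'I_n.+1 => - (b k.+1 - b k))); last first.
  by move=> k _; rewrite /J bound ?grid_ge0 ?(ltW (grid_lt _ _))// opprB.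
rewrite sumrN -(big_mkord xpredT (fun k => b k.+1 - b k)) telescope_sumr//.
by rewrite opprB /b grid0 grid1 bound.
Qed.

Let J0 n k z : 0 <= J n k z. Proof. by rewrite /J indicE. Qed.

Let S_le n q C z : (forall x, `|q x| <= C) -> `|S n q z| <= C * \1_D z.
Proof.
move=> qC; rewrite -(sumJ n) mulr_sumr; apply: le_trans (ler_norm_sum _ _ _) _.
by apply: ler_sum => k _; rewrite normrM (ger0_norm (J0 _ _ _)) ler_wpM2r.
Qed.

(** If [z] lies in the cell of index [k], then [tau z] lies between [grid n k] and [grid n k.+1]. So
    the only surviving term evaluates the path at a time within [1/(n+1)] of [tau z]. *)
Let S_cvg q z : continuous q -> S n q z @[n --> \oo] --> q (Psi z : 'cV[R]_d) * \1_D z.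
Proof.
move=> qc; have [Dz|Dz] := pselect (D z); last first.
  rewrite indicE memNset// mulr0; apply: cvg_near_cst; apply: nearW => n.
  apply/eqP; rewrite -normr_le0 /S; apply: le_trans (ler_norm_sum _ _ _) _.
  rewrite big1// => k _; suff -> : J n k z = 0 by rewrite mulr0 normr0.
  apply/eqP; rewrite eq_le J0 andbT.
  have : \sum_(k < n.+1) J n k z = 0 by rewrite sumJ indicE memNset.
  by rewrite (bigD1 k)//= => <-; rewrite lerDl sumr_ge0.
have Gz : G z.1 by case: Dz.
have := tau01 Dz => /andP[t0 t1].
rewrite indicE mem_set// mulr1 /Psi mem_set//.
apply/cvgrPdist_le => e e0.
have := cZ Gz; move=> /subspace_continuousP /(_ (tau z)).
rewrite /= in_itv /= t0 => /(_ isT) cz.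
have : \forall t \near within `[0, +oo[%classic (nbhs (tau z)), `|q (Z (tau z) z.1) - q (Z t z.1)| <= e.
  have := @cvg_comp _ _ _ _ q _ _ _ cz (qc _) => /cvgrPdist_le; exact.
rewrite /within /= => /nbhs_ballP[r /= r0 hr].
near=> n.
have nr : n.+1%:R^-1 < r by near: n; exact: (near_infty_natSinv_lt (PosNum r0)).
have -> : q (Z (tau z) z.1) = \sum_(k < n.+1) q (Z (tau z) z.1) * J n k z.
  by rewrite -mulr_sumr sumJ indicE mem_set// mulr1.
rewrite /S -sumrB (_ : e = \sum_(k < n.+1) e * J n k z); last first.
  by rewrite -mulr_sumr sumJ indicE mem_set// mulr1.
apply: le_trans (ler_norm_sum _ _ _) _; apply: ler_sum => k _.
rewrite -mulrBl normrM (ger0_norm (J0 _ _ _)) /J indicE.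
have [|_] := boolP (z \in _); last by rewrite !mulr0.
rewrite inE !mulr1 => -[_ /andP[h1 h2]].
apply: hr; last by rewrite /= in_itv /= grid_ge0.
have k1 : grid n k <= tau z by apply: tau_lb => //; rewrite grid_ge0 grid_le1// ltnW.
have k2 : tau z <= grid n k.+1 by apply: tau_ub => //; exact: grid_ge0.
rewrite -ball_normE /= ger0_norm ?subr_ge0//; apply: le_lt_trans nr.
by rewrite -(grid_step n k) lerB.
Unshelve. all: by end_near. Qed.

Let mS n q : continuous q -> measurable_fun setT (S n q).
Proof.
move=> qc; apply: measurable_sum => k; apply: measurable_funM.
  apply: (@measurableT_comp _ _ _ _ _ _ (q : borel R d -> R) _ (fun z : Omega * R => Z (grid n k) z.1)).
    exact: borel_continuous.
  by apply: measurableT_comp; [apply: mZ; exact: grid_ge0|exact: measurable_fst].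
by apply: measurable_indic; apply: mcell; exact: grid_ge0.
Qed.

(** Measurability is not derived from [tau]: for each cutoff [q] of an open set, [q] composed with
    [Psi] is a pointwise limit of Riemann sums. *)
Let mPsi : measurable_fun setT Psi.
Proof.
apply: measurable_to_borel => U oU; have [q [qc q01 qU]] := open_cutoff oU.
have mq : measurable_fun setT (fun z => q (Psi z : 'cV[R]_d)).
  (* The second summand accounts for the value 0 that [Psi] takes off [D]. *)
  apply: (@measurable_fun_cvg _ _ _ _ (fun n z => S n q z + q 0 * \1_(~` D) z)).
  - move=> n; apply: measurable_funD; first exact: mS.
    by apply: measurable_funM => //; apply: measurable_indic; exact: measurableC.
  - move=> z _; rewrite (_ : q (Psi z : 'cV[R]_d) = q (Psi z : 'cV[R]_d) * \1_D z + q 0 * \1_(~` D) z).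
      by apply: cvgD; [exact: S_cvg|exact: cvg_cst].
    rewrite !indicE in_setC /Psi; case: ifPn => zD; first by rewrite mulr1 mulr0 addr0.
    by rewrite mulr0 mulr1 add0r.
rewrite (_ : Psi @^-1` U = [set: Omega * R] `&` (fun z => q (Psi z : 'cV[R]_d)) @^-1` `]0, +oo[%classic); last first.
  by apply/seteqP; split=> z /=; rewrite in_itv /= andbT; [move=> /qU|move=> [_ /qU]].
by apply: mq => //; exact: measurable_itv.
Qed.

Let dY n k w : R := \1_G w * (Y (grid n k.+1) w - Y (grid n k) w).

Let dY_ge0 n k w : 0 <= dY n k w.
Proof.
rewrite /dY indicE; case: (boolP (w \in G)) => [|_]; last by rewrite mul0r.
by rewrite inE mul1r subr_ge0 => Gw; apply: Yle => //; [exact: grid_ge0|exact/ltW/grid_lt].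
Qed.

Let mdiff n k : measurable_fun setT (fun w => Y (grid n k.+1) w - Y (grid n k) w).
Proof. by apply: measurable_funB; apply: mY; exact: grid_ge0. Qed.

Let mdY n k : measurable_fun setT (dY n k).
Proof. by apply: measurable_funM; [exact: measurable_indic|exact: mdiff]. Qed.

Let dY_le n k w : (k < n.+1)%N -> `|dY n k w| <= `|Y 1 w|.
Proof.
move=> kn; rewrite (ger0_norm (dY_ge0 _ _ _)) /dY indicE; case: (boolP (w \in G)) => [|_]; last by rewrite mul0r.
rewrite inE mul1r => Gw; rewrite -[leRHS]/(`|Y 1 w|).
have h0 : 0 <= Y (grid n k) w by rewrite -(Y0 Gw); apply: Yle => //; exact: grid_ge0.
have h1 : Y (grid n k.+1) w <= Y 1 w by apply: Yle => //; [exact: grid_ge0|exact: grid_le1].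
by rewrite (le_trans _ (ler_norm _))// (le_trans _ h1)// gerBl.
Qed.

(** By Tonelli, integration over the second variable replaces the indicator of a cell by the length
    of its section. *)
Let J_transfer n k (q : borel R d -> R) C : (k < n.+1)%N -> measurable_fun setT q -> (forall x, `|q x| <= C) ->
  M.-integrable setT (EFin \o (fun z => q (Z (grid n k) z.1) * J n k z)) /\
  \int[M]_z (q (Z (grid n k) z.1) * J n k z) =
  \int[P]_w (q (Z (grid n k) w) * (Y (grid n k.+1) w - Y (grid n k) w)).
Proof.
move=> kn mq qC; set Zk := Z (grid n k).
have mZk : measurable_fun setT Zk by apply: mZ; exact: grid_ge0.
have mZf : measurable_fun setT (fun z : Omega * R => Zk z.1).
  by apply: measurableT_comp => //; exact: measurable_fst.
have mJ : measurable_fun setT (J n k) by apply: measurable_indic; apply: mcell; exact: grid_ge0.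
have qi : P.-integrable setT (EFin \o (fun w => q (Zk w) * dY n k w)).
  apply: (@integrable_le _ _ _ P _ (fun w => C * `|Y 1 w|)).
  - by apply: measurable_funM => //; exact: measurableT_comp.
  - by move=> w; rewrite normrM ler_pM// dY_le.
  - rewrite (_ : _ \o _ = (fun w => C%:E * `|Y 1 w|%:E)%E)//.
    by apply: integrableZl => //; exact: (integrable_norm iY).
have [|||i1 E1] := @Rintegral_transfer _ _ _ _ _ _ R M P (fun z => Zk z.1) Zk (J n k) (dY n k)
  mZf mZk mJ (mdY n k) _ _ _ q mq qi => //.
- move=> B mB; rewrite fubini_tonelli1//=; last 2 first.
    apply/measurable_EFinP; apply: measurable_funM => //; exact: measurableT_comp.
    by move=> z; rewrite mule_ge0// lee_fin.
  apply: eq_integral => w _; rewrite /fubini_F /=.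
  rewrite ge0_integralZl_EFin//; last 2 first.
    by move=> x _; rewrite lee_fin.
    by apply/measurable_EFinP; exact: measurable_fun_pair2.
  congr (_ * _)%E; rewrite /dY indicE; case: (boolP (w \in G)); last first.
    move=> Gw; rewrite mul0r; apply: integral0_eq => y _; rewrite /J indicE memNset// => -[] /= Gw' _.
    by move: Gw; rewrite mem_set.
  rewrite inE => Gw; rewrite mul1r.
  transitivity (L `[Y (grid n k) w, Y (grid n k.+1) w[%classic).
    transitivity (\int[L]_y (\1_`[Y (grid n k) w, Y (grid n k.+1) w[ y)%:E)%E; last first.
      by rewrite integral_indic ?setIT.
    apply: eq_integral => y _; rewrite /J !indicE; congr (_%:R%:E).
    by congr nat_of_bool; apply/idP/idP => [|h]; rewrite !inE /= ?in_itv /= => //; [case|move: h; rewrite inE /= in_itv].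
  rewrite lebesgue_measure_itv /= lte_fin.
  have : Y (grid n k) w <= Y (grid n k.+1) w.
    by apply: Yle => //; [exact: grid_ge0|exact/ltW/grid_lt].
  by rewrite le_eqVlt => /predU1P[->|->//]; rewrite ltxx subrr.
split=> //; rewrite E1; apply: (eq_Rintegral_null mG PG).
- by apply: measurable_funM; [exact: measurableT_comp|exact: mdY].
- by apply: measurable_funM; [exact: measurableT_comp|exact: mdiff].
- by move=> w Gw; rewrite /dY indicE mem_set// mul1r.
Qed.

Let occ : {measure set (borel R d) -> \bar R} := image_measure (mrestr M mD) mPsi.

Let MD : (M D < +oo)%E.
Proof.
(* For [n = 0] the only cell is [D], so that its mass is the expectation of [Y 1], which is
   finite. *)
have [] := @J_transfer 0 0 (cst 1) 1 isT (@measurable_cst _ _ _ _ _ _) _.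
  by move=> x; rewrite normr1.
move=> /integrable_lty + _ => /(_ measurableT).
rewrite (_ : (fun z => _) = (fun z => (\1_D z)%:E)) ?integral_indic ?setIT//.
by apply/funext => z /=; rewrite mul1r /J grid0 grid1.
Qed.

(** Riemann sums, lifted by [S], converge by domination with [C * \1_D]. For the last clause, a path
    that is off the closed set [B] at time [tau] stays off it nearby, so [Y] would be constant
    around [tau], against the choice of [tau]. *)
Lemma occupation_measure : exists m : {measure set (borel R d) -> \bar R}, [/\
  (m setT < +oo)%E,
  forall (q : 'cV[R]_d -> R) C, continuous q -> (forall x, `|q x| <= C) ->
    \sum_(k < n.+1) \int[P]_w (q (Z (grid n k) w) * (Y (grid n k.+1) w - Y (grid n k) w)) @[n --> \oo]
      --> \int[m]_x q x &
  forall B : set 'cV[R]_d, closed B ->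
    (forall w s t, G w -> 0 <= s -> s <= t -> (forall u, s <= u <= t -> ~ B (Z u w)) -> Y s w = Y t w) ->
    m (~` B) = 0%E].
Proof.
exists occ; split.
- by change (M (Psi @^-1` setT `&` D) < +oo)%E; rewrite preimage_setT setTI.
- move=> q C qc qC; have mq := borel_continuous qc.
  have mI : measurable_fun setT (\1_D : Omega * R -> R) by exact: measurable_indic.
  have iD : M.-integrable setT (EFin \o (fun z => C * \1_D z)).
    have : M.-integrable setT (EFin \o \1_D).
      apply/integrableP; split; first exact/measurable_EFinP.
      under eq_integral do rewrite /= ger0_norm//.
      by rewrite integral_indic// setIT.
    by move=> /(@integrableZl _ _ _ _ _ measurableT C).
  have mqP : measurable_fun setT (fun z => q (Psi z : 'cV[R]_d) * \1_D z).
    by apply: measurable_funM => //; exact: (measurableT_comp mq mPsi).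
  have iq : M.-integrable setT (EFin \o (fun z => q (Psi z : 'cV[R]_d) * \1_D z)).
    apply: (@integrable_le _ _ _ M _ (fun z => C * \1_D z)) => //.
    by move=> z; rewrite normrM [`|\1_D z|]ger0_norm// ler_wpM2r.
  have [|||||_ E] := @Rintegral_transfer _ _ _ _ _ _ R occ M id Psi (cst 1) \1_D _ mPsi _ mI _ _ _ q mq iq => //.
    move=> B mB; under eq_integral do rewrite mule1.
    rewrite integral_indic// setIT.
    have mPB : measurable (Psi @^-1` B) by rewrite -[X in measurable X]setTI; exact: mPsi.
    transitivity (\int[M]_z (\1_(Psi @^-1` B `&` D) z)%:E)%E.
      by rewrite integral_indic ?setIT//; exact: measurableI.
    apply: eq_integral => z _; rewrite -EFinM !indicE in_setI.
    have -> : (z \in Psi @^-1` B) = (Psi z \in B) by apply/idP/idP; rewrite !inE.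
    by case: (_ \in B); case: (_ \in D); rewrite ?mulr1 ?mulr0.
  have -> : \int[occ]_x q x = \int[M]_z (q (Psi z : 'cV[R]_d) * \1_D z).
    by rewrite -E; apply: eq_Rintegral => x _; rewrite mulr1.
  rewrite (_ : (fun n => _) = (fun n => \int[M]_z S n q z)); last first.
    apply/funext => n; rewrite /S.
    rewrite {2}/Rintegral.
    under eq_integral do rewrite -sumEFin.
    rewrite integral_sum//; last first.
      by move=> k; have [] := @J_transfer n k q C (ltn_ord k) mq qC.
    rewrite -sum_fine/=; last first.
      move=> k _; apply: integrable_fin_num => //.
      by have [] := @J_transfer n k q C (ltn_ord k) mq qC.
    by apply: eq_bigr => k _; have [_ <-] := @J_transfer n k q C (ltn_ord k) mq qC.
  apply: (@Rintegral_dominated_cvg _ _ _ M _ _ (fun z => C * \1_D z)) => //.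
  + by move=> n; exact: mS.
  + by apply: aeW => z; exact: S_cvg.
  + by apply: aeW => z n; exact: S_le.
- move=> B cB hB; rewrite /occ /=; change (M (Psi @^-1` (~` B) `&` D) = 0%E).
  rewrite (_ : _ `&` D = set0) ?measure0//; apply/seteqP; split=> // z [/= nB].
  move=> /[dup] Dz [Gz /andP[u0 u1]]; have /andP[t0 t1] := tau01 Dz.
  rewrite /Psi mem_set// in nB.
  have := cZ Gz; move=> /subspace_continuousP /(_ (tau z)).
  rewrite /= in_itv /= t0 => /(_ isT) cz.
  have : \forall t \near within `[0, +oo[%classic (nbhs (tau z)), ~ B (Z t z.1).
    have oB : nbhs (Z (tau z) z.1 : 'cV[R]_d) (~` B).
      by apply: open_nbhs_nbhs; split => //; exact: closed_openC.
    exact: (cz _ oB).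
  rewrite /within /= => /nbhs_ballP[r /= r0 hr].
  (* [[a, b]] is a neighbourhood of [tau z] among nonnegative times. The definition of [tau] gives
     [Y a <= u < Y b] for the level [u = z.2], which contradicts [Y a = Y b]. *)
  pose a := Num.max 0 (tau z - r / 2); pose b := tau z + r / 2.
  have a0 : 0 <= a by rewrite le_max lexx.
  have ab : a <= b by rewrite ge_max /b; apply/andP; split; [lra|lra].
  have Yab : Y a z.1 = Y b z.1.
    apply: hB => // u /andP[au ub]; apply: hr; last by rewrite /= in_itv /= (le_trans a0).
    rewrite -ball_normE /=; move: au ub; rewrite ge_max /b => /andP[h1 h2] h3.
    by rewrite ltr_norml; apply/andP; split; lra.
  have Ya : Y a z.1 <= z.2.
    rewrite /a; have [h|h] := leP (0 : R) (tau z - r / 2 : R); last exact: u0.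
    have [||s [/andP[s0 s1] Ys] as_] := @sup_gt _ [set s | 0 <= s <= 1 /\ Y s z.1 <= z.2] (tau z - r / 2).
    + by exists 0; split; [rewrite lexx ler01|exact: u0].
    + by rewrite -/(tau z); lra.
    apply: le_trans Ys; apply: Yle => //; exact: ltW.
  have Yb : z.2 < Y b z.1.
    have [b1|b1] := leP 1 b; first by rewrite (lt_le_trans u1)// Yle.
    rewrite ltNge; apply/negP => h; have := @tau_lb z b; rewrite (ltW b1) (le_trans a0 ab) => /(_ isT h).
    rewrite /b; lra.
  by move: (le_lt_trans Ya Yb); rewrite Yab ltxx.
Qed.

End occupation.

(** * Dynkin's formula *)

Section integrability_tools.
Context d (T : measurableType d) (R : realType) (m : {measure set T -> \bar R}).
Local Notation intg f := (m.-integrable setT (EFin \o f)).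

Lemma integrable_Zl (c : R) (f : T -> R) : intg f -> intg (fun x => c * f x).
Proof. by move=> fi; exact: (@integrableZl _ _ _ _ _ measurableT c _ fi). Qed.

Lemma integrable_fsum (I : Type) (s : seq I) (h : I -> T -> R) : (forall i, intg (h i)) ->
  intg (fun x => \sum_(i <- s) h i x).
Proof.
move=> hi; rewrite (_ : EFin \o _ = fun x => \sum_(i <- s) (h i x)%:E)%E.
  by apply: (@integrable_sum _ _ _ m setT measurableT I s xpredT (fun i x => (h i x)%:E)) => // i _; exact: hi.
by apply/funext => x /=; rewrite sumEFin.
Qed.

Lemma Rintegral_fsum (I : Type) (s : seq I) (h : I -> T -> R) : (forall i, intg (h i)) ->
  \int[m]_x (\sum_(i <- s) h i x) = \sum_(i <- s) \int[m]_x h i x.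
Proof.
move=> hi; elim: s => [|i s ih].
  by rewrite big_nil; under eq_Rintegral do rewrite big_nil; rewrite /Rintegral integral0.
rewrite big_cons -ih; under eq_Rintegral do rewrite big_cons.
by rewrite RintegralD//; exact: integrable_fsum.
Qed.

Lemma integrable_le_null (A : set T) (f g : T -> R) : measurable A -> m (~` A) = 0%E ->
  measurable_fun setT f -> (forall x, A x -> `|f x| <= g x) -> intg g -> intg f.
Proof.
move=> mA A0 mf fg gi; have mfE : measurable_fun setT (EFin \o f) by exact/measurable_EFinP.
apply/(negligible_integrable (measurableC mA) measurableT mfE A0).
have gi' := (negligible_integrable (measurableC mA) measurableT (measurable_int _ gi) A0).1 gi.
apply: le_integrable gi' => //.
- by apply: measurableD => //; exact: measurableC.
- exact: measurable_funTS.
- by move=> x [_ /= /contrapT Ax]; rewrite lee_fin (le_trans (fg _ Ax))// ler_norm.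
Qed.

End integrability_tools.

(** Cauchy-Schwarz, read off from the sum of all [(u i - u j)^2]. *)
Lemma sqr_sum_le (R : realType) n (u : 'I_n -> R) : (\sum_i u i) ^+ 2 <= n%:R * \sum_i u i ^+ 2.
Proof.
have : 0 <= \sum_i \sum_j (u i - u j) ^+ 2 by do 2! apply: sumr_ge0 => ? _; exact: sqr_ge0.
have -> : \sum_i \sum_j (u i - u j) ^+ 2 = 2 * (n%:R * \sum_i u i ^+ 2) - 2 * (\sum_i u i) ^+ 2.
  under eq_bigr => i _.
    under eq_bigr do rewrite sqrrB.
    rewrite big_split /= sumrB sumr_const card_ord.
    rewrite (_ : \sum_j (u i * u j *+ 2) = 2 * u i * \sum_j u j); last first.
      by rewrite mulr_sumr; apply: eq_bigr => j _; rewrite -mulr_natl mulrA.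
    over.
  rewrite big_split /= sumrB sumr_const card_ord.
  rewrite (_ : \sum_i 2 * u i * \sum_j u j = 2 * (\sum_i u i) ^+ 2); last first.
    by rewrite -mulr_suml expr2 mulrA -mulr_sumr.
  rewrite (_ : \sum_i (u i ^+ 2 *+ n) = n%:R * \sum_i u i ^+ 2); last first.
    by rewrite mulr_sumr; apply: eq_bigr => i _; rewrite mulr_natl.
  by rewrite -[X in _ + X]mulr_natl; ring.
by move=> h; lra.
Qed.

(** * Uniform continuity along a path *)

Section uniformity.
Context {R : realType}.

(** Compactness of [[0, 1]]. The local hypothesis concerns nonnegative [s] only, as paths are
    continuous relative to [[0, +oo[]. *)
Lemma unit_interval_uniform (Q : R -> R -> Prop) :
  (forall x, 0 <= x <= 1 -> exists2 e, 0 < e &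
     forall s r, 0 <= s -> `|s - x| < e -> 0 < r < e -> Q r s) ->
  exists2 e, 0 < e & forall s r, 0 <= s <= 1 -> 0 < r < e -> Q r s.
Proof.
move=> h; have /compact_near_coveringP := @segment_compact R 0 1.
move=> /(_ _ (0 : R)^'+ (fun r s => 0 <= s -> Q r s)) H.
have : \forall r \near (0 : R)^'+, `[0, 1]%classic `<=` (fun s => 0 <= s -> Q r s).
  apply: H => x; rewrite /= in_itv /= => /h[e e0 he].
  exists (ball x e, [set r | 0 < r < e]).
    split; first exact: nbhsx_ballx.
    near=> r; apply/andP; split; first by [].
    by near: r; exact: nbhs_right_lt.
  move=> [s r] /= [xs re] s0; apply: he => //.
  by move: xs; rewrite -ball_normE /= distrC.
move=> /nbhs_ballP[e /= e0 he]; exists e => // s r /andP[s0 s1] /andP[r0 re].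
apply: (he r) => //; last by rewrite /= in_itv /= s0.
by rewrite -ball_normE /= sub0r normrN gtr0_norm.
Unshelve. all: by end_near. Qed.

Lemma path_uniform (V : normedModType R) (g : R -> V) e : 0 < e ->
  {within `[0, +oo[, continuous g} ->
  exists2 del, 0 < del & forall s t, 0 <= s <= 1 -> 0 <= t -> `|t - s| < del -> `|g t - g s| < e.
Proof.
move=> e0 gc.
have [|del del0 H] := @unit_interval_uniform (fun r s => forall t, 0 <= t -> `|t - s| < r -> `|g t - g s| < e).
  move=> x /andP[x0 x1]; move/subspace_continuousP : gc => /(_ x).
  rewrite /= in_itv /= x0 => /(_ isT) /cvgrPdist_lt /(_ (e / 2)).
  rewrite divr_gt0// => /(_ isT); rewrite /within /= => /nbhs_ballP[r /= r0 hr].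
  exists (r / 2); first by rewrite divr_gt0.
  move=> s q s0 sx /andP[q0 qr] t t0 ts.
  have h u : 0 <= u -> `|u - x| < r -> `|g x - g u| < e / 2.
    move=> u0 ux; apply: hr; last by rewrite /= in_itv /= u0.
    by rewrite -ball_normE /= distrC.
  have hs : `|g x - g s| < e / 2 by apply: h => //; lra.
  have ht : `|g x - g t| < e / 2.
    apply: h => //; have := ler_normD (t - s) (s - x); rewrite addrA subrK; lra.
  by apply: le_lt_trans (ler_distD (g x) _ _) _; rewrite distrC; lra.
exists (del / 2); first by rewrite divr_gt0.
move=> s t s01 t0 ts; apply: (H s (del / 2)) => //.
by rewrite divr_gt0//= ltr_pdivrMr// ltr_pMr// ltr1n.
Qed.

Lemma along_path_uniform (V : normedModType R) (g : R -> V) (h : V -> R) e : 0 < e ->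
  {within `[0, +oo[, continuous g} -> continuous h ->
  exists2 del, 0 < del & forall s p, 0 <= s <= 1 -> `|p - g s| <= del -> `|h p - h (g s)| <= e.
Proof.
move=> e0 gc hc.
have [|del del0 H] := @unit_interval_uniform (fun r s => forall p, `|p - g s| <= r -> `|h p - h (g s)| <= e).
  move=> x /andP[x0 x1].
  have /cvgrPdist_lt /(_ (e / 2)) := hc (g x); rewrite divr_gt0// => /(_ isT) /nbhs_ballP[rho /= rho0 hrho].
  move/subspace_continuousP : gc => /(_ x).
  rewrite /= in_itv /= x0 => /(_ isT) /cvgrPdist_lt /(_ (rho / 2)).
  rewrite divr_gt0// => /(_ isT); rewrite /within /= => /nbhs_ballP[r /= r0 hr].
  exists (Num.min r (rho / 2)); first by rewrite lt_min r0 divr_gt0.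
  move=> s q s0; rewrite lt_min => /andP[sx _] /andP[q0]; rewrite lt_min => /andP[_ qr] p ps.
  have gs : `|g x - g s| < rho / 2.
    apply: hr; last by rewrite /= in_itv /= s0.
    by rewrite -ball_normE /= distrC.
  have h1 : `|h (g x) - h (g s)| < e / 2 by apply: hrho; rewrite -ball_normE /=; lra.
  have h2 : `|h (g x) - h p| < e / 2.
    apply: hrho; rewrite -ball_normE /= distrC.
    have := ler_normD (p - g s) (g s - g x); rewrite addrA subrK (distrC (g s)); lra.
  have -> : h p - h (g s) = (h (g x) - h (g s)) - (h (g x) - h p) by ring.
  by apply: le_trans (ler_normB _ _) _; lra.
exists (del / 2); first by rewrite divr_gt0.
move=> s p s01 ps; apply: (H s (del / 2)) => //.
by rewrite divr_gt0//= ltr_pdivrMr// ltr_pMr// ltr1n.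
Qed.

End uniformity.

(** * Taylor remainder with the noise separated from drift and regulators *)

Section remainder.
Context {R : realType} {d : nat}.
Implicit Types x y z p : 'cV[R]_d.
Variables (f : 'cV[R]_d -> R) (G : 'I_d -> 'cV[R]_d -> R) (H : 'I_d -> 'I_d -> 'cV[R]_d -> R) (C : R).
Hypothesis df : forall j x, oorthant x -> derivable f x (delta_mx j 0).
Hypothesis ddf : forall j k x, oorthant x -> derivable (partial k f) x (delta_mx j 0).
Hypothesis Gc : forall j, continuous (G j).
Hypothesis Hc : forall j k, continuous (H j k).
Hypothesis GE : forall j x, oorthant x -> G j x = partial j f x.
Hypothesis HE : forall j k x, oorthant x -> H j k x = partial j (partial k f) x.
Hypothesis fc : {within orthant, continuous f}.
Hypotheses (C0 : 0 < C) (fC : forall x, orthant x -> `|f x| <= C).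
Hypotheses (GC : forall j x, `|G j x| <= C) (HC : forall j k x, `|H j k x| <= C).

Definition remainder x y (xi : 'I_d -> R) := f y - f x - \sum_j G j x * (y - x) j 0
  - 2^-1 * \sum_j \sum_k H j k x * (xi j * xi k).

Section bounds.
Variables (x y : 'cV[R]_d) (xi : 'I_d -> R) (K a b : R).
Hypotheses (x0 : orthant x) (y0 : orthant y) (K0 : 0 <= K) (a0 : 0 <= a) (b0 : 0 <= b).
Hypothesis xia : forall j, `|xi j| <= K * a.
Hypothesis etab : forall j, `|(y - x) j 0 - xi j| <= K * b.

Let q := (d%:R * K) ^+ 2.
Let q0 : 0 <= q. Proof. exact: sqr_ge0. Qed.

Let sum_const2 (c : R) : \sum_(j < d) \sum_(k < d) c = d%:R ^+ 2 * c.
Proof. by rewrite !sumr_const !card_ord -[in LHS]mulrnA -[LHS]mulr_natl natrM. Qed.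

Let zab j : `|(y - x) j 0| <= K * (a + b).
Proof.
rewrite -[(y - x) j 0](subrK (xi j)) mulrDr addrC.
by apply: le_trans (ler_normD _ _) _; rewrite lerD.
Qed.

Let sumz : \sum_j `|(y - x) j 0| <= d%:R * K * (a + b).
Proof.
rewrite -mulrA (_ : d%:R * _ = \sum_(j < d) (K * (a + b))); last by rewrite sumr_const card_ord mulr_natl.
exact: ler_sum.
Qed.

(** In the bounds, [a] measures the noise and [b] the drift and regulators. Replacing products of
    increments by products of noises costs at most a multiple of [2 a b + b^2]. *)
Lemma remainder_taylor (e r : R) : 0 <= e -> `|y - x| < r ->
  (forall p, `|p - x| <= r -> forall j k, `|H j k p - H j k x| <= e) ->
  `|remainder x y xi| <= 2 * e * q * (a + b) ^+ 2 + C * q * (2 * a * b + b ^+ 2).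
Proof.
move=> e0 yxr he.
have T := taylor_orthant df ddf Gc Hc GE HE fc x0 y0 yxr he.
rewrite (_ : remainder x y xi = (f y - f x - taylor2 G H x (y - x)) +
    2^-1 * \sum_j \sum_k H j k x * ((y - x) j 0 * (y - x) k 0 - xi j * xi k)); last first.
  rewrite /remainder /taylor2.
  have -> : \sum_j \sum_k H j k x * ((y - x) j 0 * (y - x) k 0 - xi j * xi k) =
      \sum_j \sum_k H j k x * ((y - x) j 0 * (y - x) k 0) - \sum_j \sum_k H j k x * (xi j * xi k).
    by rewrite -sumrB; apply: eq_bigr => j _; rewrite -sumrB; apply: eq_bigr => k _; rewrite mulrBr.
  by ring.
apply: le_trans (ler_normD _ _) _; apply: lerD.
  apply: le_trans T _; rewrite /q -[in leRHS]mulrA -[in leRHS]exprMn.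
  rewrite ler_wpM2l ?mulr_ge0// ler_pXn2r// ?nnegrE ?sumr_ge0//.
  by rewrite !mulr_ge0 ?addr_ge0.
rewrite normrM gtr0_norm ?invr_gt0//.
have -> : C * q * (2 * a * b + b ^+ 2) = \sum_(j < d) \sum_(k < d) C * (K ^+ 2 * (2 * a * b + b ^+ 2)).
  by rewrite sum_const2 /q; ring.
apply: (@le_trans _ _ (\sum_(j < d) \sum_(k < d) `|H j k x * ((y - x) j 0 * (y - x) k 0 - xi j * xi k)|)).
  rewrite (@le_trans _ _ (1 * `|\sum_j \sum_k H j k x * ((y - x) j 0 * (y - x) k 0 - xi j * xi k)|))//.
    by rewrite ler_wpM2r// invf_le1// ler1n.
  rewrite mul1r; apply: le_trans (ler_norm_sum _ _ _) _; apply: ler_sum => j _; exact: ler_norm_sum.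
apply: ler_sum => j _; apply: ler_sum => k _; rewrite normrM ler_pM//.
have -> : (y - x) j 0 * (y - x) k 0 - xi j * xi k = xi j * ((y - x) k 0 - xi k) +
   ((y - x) j 0 - xi j) * (xi k + ((y - x) k 0 - xi k)) by ring.
apply: le_trans (ler_normD _ _) _; rewrite !normrM.
have h1 : `|xi j| * `|(y - x) k 0 - xi k| <= K * a * (K * b) by rewrite ler_pM.
have h2 : `|(y - x) j 0 - xi j| * `|xi k + ((y - x) k 0 - xi k)| <= K * b * (K * a + K * b).
  by rewrite ler_pM// (le_trans (ler_normD _ _))// lerD.
by apply: le_trans (lerD h1 h2) _; rewrite le_eqVlt; apply/orP; left; apply/eqP; ring.
Qed.

(** The bound is linear in [b], which only has a first moment. If [b <= 1], then [b^2 <= b] in the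
    Taylor estimate; if [b > 1], the boundedness of [f] and its derivatives is enough. *)
Lemma remainder_bound : `|remainder x y xi| <= 20 * C * (1 + q) * (a ^+ 2 + b).
Proof.
have [b1|b1] := leP b 1.
  have := @remainder_taylor (2 * C) (`|y - x| + 1).
  move=> H1; apply: le_trans (H1 _ _ _) _.
  - by rewrite mulr_ge0// ltW.
  - by rewrite ltrDl.
  -
    by move=> p _ j k; apply: le_trans (ler_normB _ _) _; rewrite mulr_natl mulr2n lerD.
  have h1 : (a + b) ^+ 2 <= 2 * (a ^+ 2 + b).
    have := sqr_ge0 (a - b); have : b ^+ 2 <= b by rewrite expr2 ler_piMr.
    rewrite !expr2; nra.
  have h2 : 2 * a * b + b ^+ 2 <= 2 * (a ^+ 2 + b).
    have := sqr_ge0 (a - b); have : b ^+ 2 <= b by rewrite expr2 ler_piMr.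
    rewrite !expr2; nra.
  have Cq : 0 <= C * q by rewrite mulr_ge0// ltW.
  have ab0 : 0 <= a ^+ 2 + b by rewrite addr_ge0// sqr_ge0.
  have h3 := ler_wpM2l Cq h1; have h4 := ler_wpM2l Cq h2.
  have h5 : 0 <= C * (a ^+ 2 + b) by rewrite mulr_ge0// ltW.
  have h6 : 0 <= C * q * (a ^+ 2 + b) by rewrite mulr_ge0.
  lra.
rewrite /remainder; apply: le_trans (ler_normB _ _) _.
have t1 : `|f y - f x - \sum_j G j x * (y - x) j 0| <= C + C + C * (d%:R * K * (a + b)).
  apply: le_trans (ler_normB _ _) _; apply: lerD.
    by apply: le_trans (ler_normB _ _) _; apply: lerD; exact: fC.
  apply: le_trans (ler_norm_sum _ _ _) _; apply: (@le_trans _ _ (\sum_j C * `|(y - x) j 0|)).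
    by apply: ler_sum => j _; rewrite normrM ler_wpM2r.
  by rewrite -mulr_sumr ler_pM2l.
have t2 : `|2^-1 * \sum_j \sum_k H j k x * (xi j * xi k)| <= C * (q * a ^+ 2).
  rewrite normrM gtr0_norm ?invr_gt0//.
  have -> : C * (q * a ^+ 2) = \sum_(j < d) \sum_(k < d) C * (K * a * (K * a)).
    by rewrite sum_const2 /q; ring.
  apply: (@le_trans _ _ (\sum_(j < d) \sum_(k < d) `|H j k x * (xi j * xi k)|)).
    rewrite (@le_trans _ _ (1 * `|\sum_j \sum_k H j k x * (xi j * xi k)|))//.
      by rewrite ler_wpM2r// invf_le1// ler1n.
    rewrite mul1r; apply: le_trans (ler_norm_sum _ _ _) _; apply: ler_sum => j _; exact: ler_norm_sum.
  by apply: ler_sum => j _; apply: ler_sum => k _; rewrite !normrM ler_pM// ?mulr_ge0// ler_pM.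
apply: le_trans (lerD t1 t2) _.
have dK : d%:R * K <= 1 + q.
  by rewrite /q; have := sqr_ge0 (d%:R * K - 1); move: (d%:R * K) => u; rewrite !expr2; nra.
have aa : a <= b + a ^+ 2 by rewrite expr2; nra.
have ab0 : 0 <= a ^+ 2 + b by rewrite addr_ge0// sqr_ge0.
have h1 : d%:R * K * (a + b) <= (1 + q) * (2 * (a ^+ 2 + b)).
  by rewrite ler_pM// ?mulr_ge0 ?addr_ge0//; have := sqr_ge0 a; lra.
have h2 := ler_wpM2l (ltW C0) h1.
have h5 : C <= C * (a ^+ 2 + b) by rewrite ler_peMr ?(ltW C0)//; have := sqr_ge0 a; lra.
have h6 : 0 <= C * q * (a ^+ 2 + b) by rewrite !mulr_ge0// ltW.
have h7 : 0 <= C * q * b by rewrite !mulr_ge0// ltW.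
have h8 : 0 <= C * b by rewrite !mulr_ge0// ltW.
have h9 : 0 <= C * a ^+ 2 by rewrite !mulr_ge0 ?sqr_ge0// ltW.
lra.
Qed.

(** When the oscillation is small, every term gains a factor [e]: from the Hessian, or from
    [2 a + b <= 3 e] in [2 a b + b^2]. *)
Lemma remainder_small (e r : R) : 0 <= e -> e <= 1 -> a + b <= e -> `|y - x| < r ->
  (forall p, `|p - x| <= r -> forall j k, `|H j k p - H j k x| <= e) ->
  `|remainder x y xi| <= e * (20 * (1 + C) * (1 + q)) * (a ^+ 2 + b).
Proof.
move=> e0 e1 abe yxr he; apply: le_trans (remainder_taylor e0 yxr he) _.
have b1 : b <= 1 by apply: le_trans e1; apply: le_trans abe; rewrite lerDr.
have h1 : (a + b) ^+ 2 <= 2 * (a ^+ 2 + b).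
  have := sqr_ge0 (a - b); have : b ^+ 2 <= b by rewrite expr2 ler_piMr.
  rewrite !expr2; nra.
have h2 : 2 * a * b + b ^+ 2 <= 3 * e * b.
  have L (u v w : R) : 0 <= u -> 0 <= v -> u + v <= w -> 2 * u + v <= 3 * w by lra.
  by rewrite expr2 -mulrDl ler_wpM2r// L.
have ab0 : 0 <= a ^+ 2 + b by rewrite addr_ge0// sqr_ge0.
have h3 := ler_wpM2l (mulr_ge0 e0 q0) h1.
have h4 := ler_wpM2l (mulr_ge0 (ltW C0) q0) h2.
have X := mulr_ge0 e0 ab0; have Xq := mulr_ge0 X q0; have XC := mulr_ge0 X (ltW C0).
have XCq := mulr_ge0 XC q0.
have B : 0 <= C * q * (e * a ^+ 2) by rewrite !mulr_ge0 ?sqr_ge0// ltW.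
lra.
Qed.

End bounds.

End remainder.

(* By AM-GM, the excess of |r| over del * Q^2 is dominated by an integrable function and tends to 0,
   while del * E Q^2 <= del * K. *)
Lemma vanishing_expectation d (T : measurableType d) (R : realType) (P : probability T R)
    (G : set T) (r Q : nat -> T -> R) (B : T -> R) (C K : R) :
  measurable G -> P (~` G) = 0%E ->
  (forall n, measurable_fun setT (r n)) -> (forall n, measurable_fun setT (Q n)) ->
  P.-integrable setT (EFin \o B) -> (forall w, G w -> 0 <= B w) -> (forall n w, 0 <= Q n w) ->
  0 <= C -> (forall n w, G w -> `|r n w| <= C * (Q n w + B w)) ->
  (forall w, G w -> forall e, 0 < e -> \forall n \near \oo, `|r n w| <= e * (Q n w + B w)) ->
  (forall n, P.-integrable setT (EFin \o (fun w => Q n w ^+ 2))) ->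
  (forall n, \int[P]_w (Q n w ^+ 2) <= K) ->
  (forall n, P.-integrable setT (EFin \o r n)) ->
  \int[P]_w r n w @[n --> \oo] --> (0 : R).
Proof.
move=> mG PG mr mQ iB B0 Q0 C0 rC re iQ QK ir.
have mB : measurable_fun setT B by apply/measurable_EFinP; exact: measurable_int iB.
have K0 : 0 <= K by apply: le_trans (QK 0%N); apply: Rintegral_ge0 => w _; exact: sqr_ge0.
have GA (Q' : T -> Prop) : (forall w, G w -> Q' w) -> {ae P, forall w, Q' w}.
  move=> h; exists (~` G); split=> //; first exact: measurableC.
  by move=> w /= nQ Gw; exact/nQ/h.
pose Tr (del : R) n w := Num.max 0 (`|r n w| - del * Q n w ^+ 2).
have key (del u q b : R) : 0 < del -> u * (q + b) - del * q ^+ 2 <= u ^+ 2 / (4 * del) + u * b.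
  move=> d0; rewrite -subr_ge0 (_ : _ - _ = (u - 2 * del * q) ^+ 2 / (4 * del)).
    by rewrite divr_ge0 ?sqr_ge0// mulr_ge0// ltW.
  by field; rewrite lt0r_neq0.
have mT del n : measurable_fun setT (Tr del n).
  apply: measurable_maxr => //; apply: measurable_funB; first exact: measurableT_comp.
  by apply: measurable_funM => //; exact: measurable_funX.
have T_dom del n w : 0 < del -> G w -> `|Tr del n w| <= C ^+ 2 / (4 * del) + C * B w.
  move=> d0 Gw; rewrite ger0_norm ?le_max ?lexx// ge_max addr_ge0 ?divr_ge0 ?sqr_ge0 ?mulr_ge0 ?B0 ?(ltW d0)//=.
  by apply: le_trans (key _ _ (Q n w) _ d0); rewrite lerD2r rC.
have iTd del : P.-integrable setT (EFin \o (fun w => C ^+ 2 / (4 * del) + C * B w)).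
  apply: (@integrableD _ _ _ P setT measurableT (EFin \o cst _) (EFin \o (fun w => C * B w))).
    exact: finite_measure_integrable_cst.
  exact: integrable_Zl.
have T_cvg del : 0 < del -> \int[P]_w Tr del n w @[n --> \oo] --> (0 : R).
  move=> d0; rewrite (_ : 0 = \int[P]_w cst 0 w :> R); last by rewrite /Rintegral integral0.
  apply: (@Rintegral_dominated_cvg _ _ _ P _ _ (fun w => C ^+ 2 / (4 * del) + C * B w)) => //.
  - apply: GA => w Gw; apply/cvgrPdist_le => e e0.
    (* With [e1 <= 1] one has [e1^2 <= e1], so that both terms of the bound are controlled linearly
       in [e1]. *)
    pose e1 := Num.min 1 (e / ((4 * del)^-1 + B w)).
    have c0 : 0 < (4 * del)^-1 + B w by rewrite ltr_pwDl ?B0// invr_gt0 mulr_gt0.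
    have e10 : 0 < e1 by rewrite lt_min ltr01 divr_gt0.
    have e11 : e1 <= 1 by rewrite ge_min lexx.
    have e12 : e1 * ((4 * del)^-1 + B w) <= e by rewrite -ler_pdivlMr// ge_min lexx orbT.
    apply: filterS (re w Gw e1 e10) => n hn.
    rewrite sub0r normrN ger0_norm ?le_max ?lexx// ge_max (ltW e0)/=.
    apply: le_trans e12; apply: le_trans (_ : e1 ^+ 2 / (4 * del) + e1 * B w <= _).
      by apply: le_trans (key _ _ (Q n w) _ d0); rewrite lerD2r.
    rewrite mulrDr lerD2r ler_wpM2r ?invr_ge0 ?mulr_ge0 ?(ltW d0)//.
    by rewrite expr2 ler_piMr// ltW.
  - by apply: GA => w Gw n; exact: T_dom.
have iT del n : 0 < del -> P.-integrable setT (EFin \o Tr del n).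
  by move=> d0; apply: (integrable_le_null mG PG (mT del n)) (iTd del) => w; exact: T_dom.
apply/cvgrPdist_le => e e0.
pose del := e / (2 * (K + 1)).
have K1 : 0 < K + 1 by rewrite ltr_wpDl.
have d0 : 0 < del by rewrite divr_gt0// mulr_gt0.
have := T_cvg del d0; move=> /cvgrPdist_le /(_ (e / 2)); rewrite divr_gt0// => /(_ isT).
apply: filterS => n; rewrite !sub0r !normrN => hn.
apply: le_trans (le_normr_Rintegral measurableT (ir n)) _.
apply: le_trans (_ : \int[P]_w (Tr del n w + del * Q n w ^+ 2) <= _).
  apply: le_Rintegral => //.
  - exact: (integrable_norm (ir n)).
  - apply: (@integrableD _ _ _ P setT measurableT (EFin \o _) (EFin \o (fun w => del * Q n w ^+ 2))); first exact: iT.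
    exact: integrable_Zl.
  - by move=> w _; rewrite -lerBlDr le_max lexx orbT.
rewrite RintegralD//; [|exact: iT|exact: integrable_Zl].
rewrite RintegralZl//; apply: le_trans (_ : e / 2 + del * K <= _).
  by rewrite lerD// ?ler_wpM2l// ?(ltW d0)//; exact: le_trans (ler_norm _) hn.
have : del * (K + 1) = e / 2 by rewrite /del; field; rewrite lt0r_neq0.
lra.
Qed.

Lemma big_option (R : nmodType) (I : finType) (f : option I -> R) :
  \sum_c f c = f None + \sum_i f (Some i).
Proof.
rewrite (bigD1 None)//=; congr (_ + _).
rewrite (reindex_omap (@Some I) id); last by case.
by apply: eq_bigl => i; rewrite eqxx.
Qed.

Lemma cvg_fsum (R : realType) (T I : Type) (F : set_system T) (s : seq I) (f : I -> T -> R) (l : I -> R) :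
  Filter F -> (forall i, f i x @[x --> F] --> l i) ->
  \sum_(i <- s) f i x @[x --> F] --> \sum_(i <- s) l i.
Proof. by move=> FF h; apply: cvg_big => //; exact: add_continuous. Qed.

(** * Expected Taylor expansion along the grid *)

Section dynkin.
Context {R : realType} {d : nat} {dO} {Omega : measurableType dO}.
Variables (F : R -> set (set Omega)) (P : probability Omega R).
Variables (Z W Y : R -> Omega -> borel R d).
Variables (mu : 'cV[R]_d) (Sigma Rmat S : 'M[R]_d) (x0 : 'cV[R]_d) (G : set Omega).
Hypothesis hF : filtration F.
Hypothesis aZ : adapted F Z.
Hypothesis aY : adapted F Y.
Hypothesis hW : brownian_motion F P W.
Hypothesis oZ : forall t w, 0 <= t -> orthant (Z t w).
Hypothesis cZ : forall w, {within `[0, +oo[, continuous (fun t => Z t w : 'cV[R]_d)}.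
Hypothesis SS : S *m S^T = Sigma.
Hypothesis mG : measurable G.
Hypothesis PG : P (~` G) = 0%E.
Hypothesis startG : forall w, G w -> Z 0 w = x0.
Hypothesis cW : forall w, G w -> {within `[0, +oo[, continuous (fun t => W t w : 'cV[R]_d)}.
Hypothesis regG : forall w, G w -> forall i,
  regulator_path i (fun t => Z t w) (fun t => (Y t w : 'cV[R]_d) i 0).
Hypothesis decG : forall w, G w -> forall t, 0 <= t ->
  Z t w = (Z 0 w : 'cV[R]_d) + t *: mu + S *m (W t w : 'cV[R]_d) + Rmat *m (Y t w : 'cV[R]_d)
  :> 'cV[R]_d.
Hypothesis iY1 : forall i, P.-integrable setT (EFin \o (fun w => (Y 1 w : 'cV[R]_d) i 0)).

Local Notation intg f := (P.-integrable setT (EFin \o f)).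

(* None indexes time itself, Some i the regulator Y_i. *)
Definition clock (c : option 'I_d) (t : R) (w : Omega) : R :=
  if c is Some i then (Y t w : 'cV[R]_d) i 0 else t.

Definition clock_coef (c : option 'I_d) (j : 'I_d) : R :=
  if c is Some i then Rmat j i else mu j 0.

Definition clock_increment c s t w := clock c t w - clock c s w.

Let aW : adapted F W. Proof. by case: hW. Qed.

Let mclock c t : 0 <= t -> measurable_fun setT (clock c t).
Proof. by move=> t0; case: c => [i|]; [exact: (adapted_coord_measurable hF i aY t0)|exact: measurable_cst]. Qed.

Let clock_le c w s t : G w -> 0 <= s -> s <= t -> clock c s w <= clock c t w.
Proof. by move=> Gw; case: c => [i|//]; have [_ _ + _] := regG Gw i; apply. Qed.

Let clock0 c w : G w -> clock c 0 w = 0.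
Proof. by move=> Gw; case: c => [i|//]; have [_ + _ _] := regG Gw i; apply. Qed.

Let clock_ge0 c w t : G w -> 0 <= t -> 0 <= clock c t w.
Proof. by move=> Gw t0; rewrite -(clock0 c Gw) clock_le. Qed.

Let clock_cont c w : G w -> {within `[0, +oo[, continuous (clock c ^~ w)}.
Proof.
move=> Gw; case: c => [i|]; first by have [+ _ _ _] := regG Gw i.
by apply: continuous_subspaceT => x; exact: cvg_id.
Qed.

Let iclock c t : 0 <= t -> t <= 1 -> intg (clock c t).
Proof.
move=> t0 t1; case: c => [i|]; last exact: finite_measure_integrable_cst.
apply: (integrable_le_null mG PG) (iY1 i); first exact: (mclock (Some i)).
by move=> w Gw; rewrite ger0_norm ?(clock_le (Some i))// (clock_ge0 (Some i)).
Qed.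

Let iclock_inc c s t : 0 <= s -> s <= t -> t <= 1 -> intg (clock_increment c s t).
Proof.
move=> s0 st t1; apply: (@integrableB _ _ _ P setT measurableT (EFin \o clock c t) (EFin \o clock c s)).
  by apply: iclock => //; exact: le_trans st.
by apply: iclock => //; exact: le_trans t1.
Qed.

Lemma increment_decomposition w s t j : G w -> 0 <= s -> s <= t ->
  increment Z s t j w = \sum_c clock_coef c j * clock_increment c s t w
    + \sum_l S j l * increment W s t l w.
Proof.
move=> Gw s0 st; rewrite big_option /= /increment /clock_increment /=.
have -> : \sum_i Rmat j i * ((Y t w : 'cV[R]_d) i 0 - (Y s w : 'cV[R]_d) i 0) =
    (Rmat *m (Y t w : 'cV[R]_d)) j 0 - (Rmat *m (Y s w : 'cV[R]_d)) j 0.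
  by rewrite !mxE -sumrB; apply: eq_bigr => i _; rewrite mulrBr.
have -> : \sum_l S j l * (W t w - W s w : 'cV[R]_d) l 0 =
    (S *m (W t w : 'cV[R]_d)) j 0 - (S *m (W s w : 'cV[R]_d)) j 0.
  by rewrite !mxE -sumrB; apply: eq_bigr => i _; rewrite !mxE mulrBr.
rewrite (decG Gw (le_trans s0 st)) (decG Gw s0).
move: (S *m _) (S *m _) (Rmat *m _) (Rmat *m _) => a1 a2 a3 a4; rewrite !mxE; ring.
Qed.

Section step.
Variables (s t : R).
Hypotheses (s0 : 0 <= s) (st : s < t) (t1 : t <= 1).

Let s1 : s <= 1. Proof. exact: le_trans (ltW st) t1. Qed.
Let t0 : 0 <= t. Proof. exact: le_trans s0 (ltW st). Qed.

Let imx j w := \sum_c clock_coef c j * clock_increment c s t w + \sum_l S j l * increment W s t l w.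

Let iimx j : intg (imx j).
Proof.
apply: (@integrableD _ _ _ P setT measurableT (EFin \o (fun w => \sum_c clock_coef c j * clock_increment c s t w))
  (EFin \o (fun w => \sum_l S j l * increment W s t l w))).
  by apply: integrable_fsum => c; apply: integrable_Zl; apply: iclock_inc => //; exact: ltW.
apply: integrable_fsum => l; apply: integrable_Zl.
exact: (increment_integrable hF hW s0 st l (isT : (1 <= 4)%N)).
Qed.

Lemma increment_integrable1 j : intg (increment Z s t j).
Proof.
apply: (integrable_le_null mG PG) (integrable_norm (iimx j)).
  by apply: (increment_measurable hF) => //; exact: ltW.
by move=> w Gw; rewrite increment_decomposition// ltW.
Qed.

Section against.
Variables (q : borel R d -> R) (C : R).
Hypotheses (mq : measurable_fun setT q) (qC : forall x, `|q x| <= C).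

Let iq (K : Omega -> R) : intg K -> intg (fun w => q (Z s w) * K w).
Proof. exact: (past_integrable hF s0 aZ mq qC). Qed.

(** The noise has conditional mean 0 given the past, so only the clocks contribute. *)
Lemma past_increment_Z j : \int[P]_w (q (Z s w) * increment Z s t j w) =
  \sum_c clock_coef c j * \int[P]_w (q (Z s w) * clock_increment c s t w).
Proof.
transitivity (\int[P]_w (q (Z s w) * imx j w)).
  have mi (K : Omega -> R) : intg K -> measurable_fun setT (fun w => q (Z s w) * K w).
    by move=> /iq Ki; apply/measurable_EFinP; exact: measurable_int Ki.
  apply: (eq_Rintegral_null mG PG); [exact/mi/increment_integrable1|exact/mi/iimx|].
  by move=> w Gw; rewrite increment_decomposition// ltW.
transitivity (\int[P]_w (\sum_c clock_coef c j * (q (Z s w) * clock_increment c s t w)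
    + \sum_l S j l * (q (Z s w) * increment W s t l w))).
  apply: eq_Rintegral => w _; rewrite /imx mulrDr !mulr_sumr.
  by congr (_ + _); apply: eq_bigr => c _; rewrite mulrCA.
have ic c : intg (fun w => q (Z s w) * clock_increment c s t w).
  by apply: iq; apply: iclock_inc => //; exact: ltW.
have iw l : intg (fun w => q (Z s w) * increment W s t l w).
  by apply: iq; exact: (increment_integrable hF hW s0 st l (isT : (1 <= 4)%N)).
rewrite RintegralD//; last 2 first.
- by apply: integrable_fsum => c; apply: integrable_Zl.
- by apply: integrable_fsum => l; apply: integrable_Zl.
rewrite !Rintegral_fsum; [|by move=> l; exact: integrable_Zl|by move=> c; exact: integrable_Zl].
rewrite [X in _ + X]big1 ?addr0 => [|l _]; last first.
  by rewrite RintegralZl// (past_increment1 hF hW s0 st aZ mq qC) mulr0.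
by apply: eq_bigr => c _; rewrite RintegralZl.
Qed.

Definition noise j w := \sum_l S j l * increment W s t l w.

Let noise2 j k w : noise j w * noise k w =
  \sum_l \sum_m S j l * S k m * (increment W s t l w * increment W s t m w).
Proof.
rewrite /noise mulr_suml; apply: eq_bigr => l _; rewrite mulr_sumr; apply: eq_bigr => m _; ring.
Qed.

Let iww l m : intg (fun w => increment W s t l w * increment W s t m w).
Proof.
have FsT : F s setT.
  by have [+ _ _] := hF => /(_ s s0) [h1 h2 _]; have := h2 _ h1; rewrite setD0.
have [->|lm] := eqVneq l m; first exact: (increment_integrable hF hW s0 st m (isT : (2 <= 4)%N)).
by have [] := increment_moment11 hF hW s0 st FsT lm.
Qed.

(** The conditional covariance of the noise is [t - s] times [S *m S^T], that is, [Sigma] times the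
    increment of the clock [None]. *)
Lemma past_noise2 j k : intg (fun w => q (Z s w) * (noise j w * noise k w)) /\
  \int[P]_w (q (Z s w) * (noise j w * noise k w)) =
  Sigma j k * \int[P]_w (q (Z s w) * clock_increment None s t w).
Proof.
have E w : q (Z s w) * (noise j w * noise k w) =
    \sum_l \sum_m S j l * S k m * (q (Z s w) * (increment W s t l w * increment W s t m w)).
  rewrite noise2 mulr_sumr; apply: eq_bigr => l _; rewrite mulr_sumr; apply: eq_bigr => m _; ring.
rewrite (funext E).
have i1 l m : intg (fun w => S j l * S k m * (q (Z s w) * (increment W s t l w * increment W s t m w))).
  by apply: integrable_Zl; exact: iq.
split; first by apply: integrable_fsum => l; exact: integrable_fsum.
rewrite Rintegral_fsum; last by move=> l; exact: integrable_fsum.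
transitivity (\sum_l S j l * S k l * ((t - s) * \int[P]_w q (Z s w))).
  apply: eq_bigr => l _; rewrite Rintegral_fsum// (bigD1 l)//= big1 ?addr0 => [|m ml].
    rewrite RintegralZl//; last exact: iq.
    by rewrite (past_increment2 hF hW s0 st aZ mq qC) eqxx.
  rewrite RintegralZl//; last exact: iq.
  by rewrite (past_increment2 hF hW s0 st aZ mq qC) eq_sym (negbTE ml) mul0r mulr0.
rewrite -mulr_suml -SS mxE.
congr (_ * _); first by apply: eq_bigr => l _; rewrite mxE.
have -> : \int[P]_w (q (Z s w) * clock_increment None s t w) = \int[P]_w (q (Z s w) * (t - s)) by [].
rewrite RintegralZr//; first by rewrite mulrC.
by apply: (bounded_integrable _ _ (C := C)) => //; [exact: probability_lty|
  apply: measurableT_comp => //; exact: (adapted_measurable hF)].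
Qed.

End against.
End step.

Lemma closed_face i : closed (@face R d i).
Proof.
rewrite (_ : face i = orthant `&` (fun x : 'cV[R]_d => x i 0) @^-1` [set 0])//.
apply: closedI; first exact: closed_orthant.
by apply: preimage_closed; [move=> x _; exact: coord_cvg|exact: closed_eq].
Qed.

Lemma clock_occupation c : exists m : {measure set (borel R d) -> \bar R}, [/\
  (m setT < +oo)%E, \int[m]_x (1 : R) = \int[P]_w clock c 1 w,
  forall (q : 'cV[R]_d -> R) C, continuous q -> (forall x, `|q x| <= C) ->
    \sum_(k < n.+1) \int[P]_w (q (Z (grid n k) w) * clock_increment c (grid n k) (grid n k.+1) w)
      @[n --> \oo] --> \int[m]_x q x &
  m (~` (if c is Some i then face i else orthant)) = 0%E].
Proof.
have cZ' w : G w -> {within `[0, +oo[, continuous (fun t => Z t w : 'cV[R]_d)} by move=> _; exact: cZ.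
have [|||||m [m1 m2 m3]] := @occupation_measure _ _ _ _ P Z (clock c) G _ _ mG PG cZ' _ _ _.
- by move=> t t0; exact: (adapted_measurable hF).
- exact: mclock.
- by move=> w Gw; exact: clock0.
- by move=> w Gw s t; exact: clock_le.
- exact: iclock.
exists m; split => //.
  (* For [q = 1] every Riemann sum telescopes to the same number, which is therefore the mass. *)
  have n1 (x : 'cV[R]_d) : `|cst (1 : R) x| <= 1 by rewrite normr1.
  have := m2 (cst 1) 1 (@cst_continuous _ _ _) n1.
  rewrite (_ : (fun n => _) = cst (\int[P]_w clock c 1 w)).
    by move=> h; apply: esym; apply: (cvg_unique _ (cvg_cst _) h).
  apply/funext => n; have ig k : (k <= n.+1)%N -> intg (clock c (grid n k)).
    by move=> kn; apply: iclock; [exact: grid_ge0|exact: grid_le1].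
  transitivity (\sum_(0 <= k < n.+1) (\int[P]_w clock c (grid n k.+1) w - \int[P]_w clock c (grid n k) w)).
    rewrite big_mkord; apply: eq_bigr => k _.
    rewrite -RintegralB//; [|exact: ig|by apply: ig; exact: ltnW].
    by apply: eq_Rintegral => w _; rewrite mul1r.
  rewrite (telescope_sumr (fun k => \int[P]_w clock c (grid n k) w))// grid1 grid0.
  rewrite (_ : \int[P]_w clock c 0 w = \int[P]_w (0 : R)) ?[X in _ - X]Rintegral_cst// ?mul0r ?subr0//.
  by apply: (eq_Rintegral_null mG PG) => [||w Gw] //; [exact: mclock|exact: clock0].
case: c m m1 m2 m3 => [i|] m _ _ m3; last first.
  apply: m3; first exact: closed_orthant.
  (* The path never leaves the orthant, so the hypothesis [h] fails already at time [s]. *)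
  move=> w s t Gw s0 st h; exfalso; apply: (h s) => //; first by rewrite lexx.
  exact: oZ.
apply: m3; last by move=> w s t Gw s0 st; have [_ _ _ +] := regG Gw i; apply.
exact: closed_face.
Qed.

Section formula.
Variables (f : 'cV[R]_d -> R) (Df : 'I_d -> 'cV[R]_d -> R) (Hf : 'I_d -> 'I_d -> 'cV[R]_d -> R) (C : R).
Hypothesis df : forall j x, oorthant x -> derivable f x (delta_mx j 0).
Hypothesis ddf : forall j k x, oorthant x -> derivable (partial k f) x (delta_mx j 0).
Hypothesis Dc : forall j, continuous (Df j).
Hypothesis Hc : forall j k, continuous (Hf j k).
Hypothesis DE : forall j x, oorthant x -> Df j x = partial j f x.
Hypothesis HE : forall j k x, oorthant x -> Hf j k x = partial j (partial k f) x.
Hypothesis fc : {within orthant, continuous f}.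
Hypotheses (C0 : 0 < C) (fC : forall x, orthant x -> `|f x| <= C).
Hypotheses (DC : forall j x, `|Df j x| <= C) (HC : forall j k x, `|Hf j k x| <= C).

Let fp : 'cV[R]_d -> R := f \o pos_part.

Let fpc : continuous fp. Proof. exact: continuous_pos_part. Qed.

Let fpE s w : 0 <= s -> fp (Z s w) = f (Z s w).
Proof. by move=> s0; rewrite /fp /= pos_part_id//; exact: oZ. Qed.

Let ifp s : 0 <= s -> intg (fun w => fp (Z s w)).
Proof.
move=> s0; apply: (bounded_integrable _ _ (C := C)); first exact: probability_lty.
  apply: (measurableT_comp (borel_continuous fpc)); exact: (adapted_measurable hF).
by move=> w; rewrite fpE//; apply: fC; exact: oZ.
Qed.

Definition step_remainder s t w := remainder f Df Hf (Z s w) (Z t w) (fun j => noise s t j w).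

Section step.
Variables (s t : R).
Hypotheses (s0 : 0 <= s) (st : s < t) (t1 : t <= 1).

Let t0 : 0 <= t. Proof. exact: le_trans s0 (ltW st). Qed.

Let iD j : intg (fun w => Df j (Z s w) * increment Z s t j w).
Proof.
apply: (past_integrable hF s0 aZ (borel_continuous (@Dc j)) (DC j)).
exact: increment_integrable1.
Qed.

Let iH j k : intg (fun w => Hf j k (Z s w) * (noise s t j w * noise s t k w)).
Proof. by have [] := past_noise2 s0 st (borel_continuous (@Hc j k)) (HC j k) j k. Qed.

Let srE w : step_remainder s t w = fp (Z t w) - fp (Z s w)
   - \sum_j Df j (Z s w) * increment Z s t j w
   - 2^-1 * \sum_j \sum_k Hf j k (Z s w) * (noise s t j w * noise s t k w).
Proof. by rewrite /step_remainder /remainder !fpE. Qed.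

Let iff : intg (fun w => fp (Z t w) - fp (Z s w)).
Proof. by apply: (@integrableB _ _ _ P setT measurableT (EFin \o _) (EFin \o (fun w => fp (Z s w)))); exact: ifp. Qed.

Let iS1 : intg (fun w => \sum_j Df j (Z s w) * increment Z s t j w).
Proof. exact: integrable_fsum. Qed.

Let iS2 : intg (fun w => 2^-1 * \sum_j \sum_k Hf j k (Z s w) * (noise s t j w * noise s t k w)).
Proof. by apply: integrable_Zl; apply: integrable_fsum => j; exact: integrable_fsum. Qed.

Let iff1 : intg (fun w => fp (Z t w) - fp (Z s w) - \sum_j Df j (Z s w) * increment Z s t j w).
Proof. exact: (@integrableB _ _ _ P setT measurableT (EFin \o _) (EFin \o _) iff iS1). Qed.

Lemma step_remainder_integrable : intg (step_remainder s t).
Proof. by rewrite (funext srE); exact: (@integrableB _ _ _ P setT measurableT (EFin \o _) (EFin \o _) iff1 iS2). Qed.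

Lemma Rintegral_step_remainder : \int[P]_w step_remainder s t w =
  \int[P]_w fp (Z t w) - \int[P]_w fp (Z s w)
  - \sum_c \sum_j clock_coef c j * \int[P]_w (Df j (Z s w) * clock_increment c s t w)
  - 2^-1 * \sum_j \sum_k Sigma j k * \int[P]_w (Hf j k (Z s w) * clock_increment None s t w).
Proof.
rewrite (funext srE) RintegralB// RintegralB// RintegralB//; [|exact: ifp|exact: ifp].
congr (_ - _ - _).
  rewrite Rintegral_fsum// exchange_big /=; apply: eq_bigr => j _.
  exact: (past_increment_Z s0 st t1 (borel_continuous (@Dc j)) (DC j)).
rewrite RintegralZl//; last by apply: integrable_fsum => j; exact: integrable_fsum.
rewrite Rintegral_fsum; last by move=> j; exact: integrable_fsum.
congr (_ * _); apply: eq_bigr => j _; rewrite Rintegral_fsum//; apply: eq_bigr => k _.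
by have [] := past_noise2 s0 st (borel_continuous (@Hc j k)) (HC j k) j k.
Qed.

End step.

(** Sum over the grid of the squares of the noise size [a] in the remainder estimates; it plays the
    part of [Q] in [vanishing_expectation]. *)
Definition quad_var n w := \sum_(k < n.+1) (\sum_l `|increment W (grid n k) (grid n k.+1) l w|) ^+ 2.

Let mgrid n (k : nat) l : measurable_fun setT (increment W (grid n k) (grid n k.+1) l).
Proof. by apply: (increment_measurable hF) => //; [exact: grid_ge0|exact/ltW/grid_lt]. Qed.

Let mquad n : measurable_fun setT (quad_var n).
Proof.
apply: measurable_sum => k; apply: measurable_funX.
by apply: measurable_sum => l; apply: measurableT_comp.
Qed.

(** Cauchy-Schwarz over the [n+1] steps gives the factor [n+1], and twice over the [d] coordinates
    gives [d^3]. *)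
Let quad_le n w : quad_var n w ^+ 2 <=
  \sum_(k < n.+1) \sum_l n.+1%:R * d%:R ^+ 3 * increment W (grid n k) (grid n k.+1) l w ^+ 4.
Proof.
apply: le_trans (sqr_sum_le _) _; rewrite mulr_sumr; apply: ler_sum => k _.
rewrite -mulr_sumr -mulrA ler_wpM2l//.
set v := increment W _ _.
have h1 := sqr_sum_le (fun l => `|v l w|).
have h2 := sqr_sum_le (fun l => `|v l w| ^+ 2).
have h3 : \sum_(i < d) (`|v i w| ^+ 2) ^+ 2 = \sum_(i < d) v i w ^+ 4.
  by apply: eq_bigr => i _; rewrite real_normK ?num_real// -exprM.
rewrite h3 in h2.
apply: (@le_trans _ _ ((d%:R * \sum_(i < d) `|v i w| ^+ 2) ^+ 2)).
  by rewrite ler_pXn2r// nnegrE ?sqr_ge0// mulr_ge0// sumr_ge0.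
by rewrite exprMn [d%:R ^+ 3]exprSr -[in leRHS]mulrA ler_wpM2l// exprn_ge0.
Qed.

Let i4 n (k : nat) l : intg (fun w => increment W (grid n k) (grid n k.+1) l w ^+ 4).
Proof. exact: (increment_integrable hF hW (grid_ge0 _ _) (grid_lt _ _) l (isT : (4 <= 4)%N)). Qed.

Let i44 n : intg (fun w => \sum_(k < n.+1) \sum_l n.+1%:R * d%:R ^+ 3 * increment W (grid n k) (grid n k.+1) l w ^+ 4).
Proof. by apply: integrable_fsum => k; apply: integrable_fsum => l; apply: integrable_Zl. Qed.

Lemma quad_var_integrable n : intg (fun w => quad_var n w ^+ 2).
Proof.
apply: (@integrable_le _ _ _ P _ _ _ _ (i44 n)); first exact: measurable_funX.
by move=> w; rewrite ger0_norm ?sqr_ge0//; exact: quad_le.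
Qed.

(** There are [(n+1) d] increments of fourth moment [3/(n+1)^2], which cancels the factor [n+1] of
    [quad_le] and makes the bound uniform in [n]. *)
Lemma quad_var_moment n : \int[P]_w (quad_var n w ^+ 2) <= 3 * d%:R ^+ 4.
Proof.
apply: le_trans (_ : \int[P]_w (\sum_(k < n.+1) \sum_l n.+1%:R * d%:R ^+ 3 * increment W (grid n k) (grid n k.+1) l w ^+ 4) <= _).
  by apply: le_Rintegral => //; exact: quad_var_integrable.
rewrite Rintegral_fsum; last by move=> k; apply: integrable_fsum => l; exact: integrable_Zl.
rewrite (eq_bigr (fun=> d%:R * (n.+1%:R * d%:R ^+ 3 * (3 * n.+1%:R^-1 ^+ 2)))); last first.
  move=> k _; rewrite Rintegral_fsum; last by move=> l; exact: integrable_Zl.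
  rewrite (eq_bigr (fun=> n.+1%:R * d%:R ^+ 3 * (3 * n.+1%:R^-1 ^+ 2))) => [|l _].
    by rewrite sumr_const card_ord [RHS]mulr_natl.
  rewrite RintegralZl// (increment_moment4 hF hW (grid_ge0 _ _) (grid_lt _ _)) -(@grid_step _ n k)//.
rewrite sumr_const card_ord -[leLHS]mulr_natl le_eqVlt; apply/orP; left; apply/eqP.
have : n.+1%:R != 0 :> R by rewrite pnatr_eq0.
by move: (n.+1%:R) (d%:R) => u v u0; field.
Qed.

Let Kc : R := \sum_j \sum_l `|S j l| + \sum_j \sum_c `|clock_coef c j|.

Let Kc0 : 0 <= Kc. Proof. by rewrite addr_ge0// !sumr_ge0// => i _; rewrite sumr_ge0. Qed.

Let S_le j l : `|S j l| <= Kc.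
Proof.
rewrite /Kc (bigD1 j)//= (bigD1 l)//= -!addrA lerDl addr_ge0 ?sumr_ge0// addr_ge0 ?sumr_ge0// => i _; rewrite sumr_ge0//.
Qed.

Let coef_le c j : `|clock_coef c j| <= Kc.
Proof.
rewrite /Kc addrC (bigD1 j)//= (bigD1 c)//= -!addrA lerDl addr_ge0 ?sumr_ge0// addr_ge0 ?sumr_ge0// => i _; rewrite sumr_ge0//.
Qed.

Let noise_le s t j w : `|noise s t j w| <= Kc * \sum_l `|increment W s t l w|.
Proof.
apply: le_trans (ler_norm_sum _ _ _) _; rewrite mulr_sumr; apply: ler_sum => l _.
by rewrite normrM ler_wpM2r.
Qed.

Let clock_inc_ge0 c s t w : G w -> 0 <= s -> s <= t -> 0 <= clock_increment c s t w.
Proof. by move=> Gw s0 st; rewrite subr_ge0 clock_le. Qed.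

Let drift_le s t j w : G w -> 0 <= s -> s <= t ->
  `|(Z t w - Z s w : 'cV[R]_d) j 0 - noise s t j w| <= Kc * \sum_c clock_increment c s t w.
Proof.
move=> Gw s0 st; have := increment_decomposition j Gw s0 st; rewrite {1}/increment => ->.
rewrite addrK; apply: le_trans (ler_norm_sum _ _ _) _; rewrite mulr_sumr; apply: ler_sum => c _.
by rewrite normrM [`|clock_increment _ _ _ _|]ger0_norm ?clock_inc_ge0// ler_wpM2r ?clock_inc_ge0.
Qed.

Let q : R := (d%:R * Kc) ^+ 2.

Let total w := \sum_c clock c 1 w.

Let total_grid n w : G w -> \sum_(k < n.+1) \sum_c clock_increment c (grid n k) (grid n k.+1) w = total w.
Proof.
move=> Gw; rewrite exchange_big /=; apply: eq_bigr => c _.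
rewrite -(big_mkord xpredT (fun k => clock_increment c (grid n k) (grid n k.+1) w)) /clock_increment.
by rewrite (telescope_sumr (fun k => clock c (grid n k) w))// grid1 grid0 clock0// subr0.
Qed.

Let rem n w := \sum_(k < n.+1) step_remainder (grid n k) (grid n k.+1) w.

Let sum_le n w (e : R) : G w ->
  (forall k : 'I_n.+1, `|step_remainder (grid n k) (grid n k.+1) w| <=
     e * ((\sum_l `|increment W (grid n k) (grid n k.+1) l w|) ^+ 2
          + \sum_c clock_increment c (grid n k) (grid n k.+1) w)) ->
  `|rem n w| <= e * (quad_var n w + total w).
Proof.
move=> Gw h; apply: le_trans (ler_norm_sum _ _ _) _; apply: le_trans (ler_sum _ (fun k _ => h k)) _.
by rewrite -mulr_sumr big_split /= total_grid.
Qed.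

Let rem_le n w : G w -> `|rem n w| <= 20 * C * (1 + q) * (quad_var n w + total w).
Proof.
move=> Gw; apply: sum_le => // k; have g0 := @grid_ge0 R n k; have gl := ltW (@grid_lt R n k).
apply: (remainder_bound df ddf Dc Hc DE HE fc C0 fC DC HC) => //.
- exact: oZ.
- by apply: oZ; exact: grid_ge0.
- exact: sumr_ge0.
- by apply: sumr_ge0 => c _; exact: clock_inc_ge0.
- by move=> j; exact: drift_le.
Qed.

Let finite_lower (I : finType) (D : I -> R) : (forall i, 0 < D i) ->
  exists2 e, 0 < e & forall i, e <= D i.
Proof.
move=> D0; exists (\big[Num.min/1]_i D i); first by apply/bigmin_gtP; split.
by move=> i; exact: bigmin_le.
Qed.

Let rem_small w (e : R) : G w -> 0 < e -> \forall n \near \oo, `|rem n w| <= e * (quad_var n w + total w).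
Proof.
move=> Gw e0; pose L := 20 * (1 + C) * (1 + q).
have q0 : 0 <= q by exact: sqr_ge0.
have L0 : 0 < L by rewrite !mulr_gt0// ltr_pwDl// ltW.
pose e1 := Num.min 1 (e / L).
have e10 : 0 < e1 by rewrite lt_min ltr01 divr_gt0.
have e11 : e1 <= 1 by rewrite ge_min lexx.
have e1L : e1 * L <= e by rewrite -ler_pdivlMr// ge_min lexx orbT.
have [D D0 hD] : exists2 D, 0 < D & forall s p, 0 <= s <= 1 -> `|p - Z s w| <= D ->
    forall j k, `|Hf j k p - Hf j k (Z s w)| <= e1.
  have /choice[D' hD'] : forall jk : 'I_d * 'I_d, exists D, 0 < D /\ forall s p, 0 <= s <= 1 ->
      `|p - Z s w| <= D -> `|Hf jk.1 jk.2 p - Hf jk.1 jk.2 (Z s w)| <= e1.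
    by move=> jk; have [D D0 hD] := along_path_uniform e10 (@cZ w) (@Hc jk.1 jk.2); exists D.
  have [D D0 DD'] := finite_lower (fun jk => (hD' jk).1).
  exists D => // s p s01 ps j k; apply: (hD' (j, k)).2 => //; exact: le_trans (DD' _).
have [aZ' aZ0 hZ] := path_uniform D0 (@cZ w).
(* [a + b] is a sum of [d] noise terms and [d+1] clock increments, each at most [eta], hence at most
   [e1]. *)
pose eta := e1 / (2 * d.+1%:R).
have eta0 : 0 < eta by rewrite divr_gt0// mulr_gt0.
have [aW' aW0 hWu] := path_uniform eta0 (cW Gw).
have /choice[D' hD'] : forall c : option 'I_d, exists D, 0 < D /\ forall s t, 0 <= s <= 1 -> 0 <= t ->
    `|t - s| < D -> `|clock c t w - clock c s w| < eta.
  by move=> c; have [D1 D10 hD1] := path_uniform eta0 (@clock_cont c w Gw); exists D1.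
have [aC aC0 hC] := finite_lower (fun c => (hD' c).1).
pose a := Num.min aZ' (Num.min aW' aC).
have a0 : 0 < a by rewrite !lt_min aZ0 aW0.
have := near_infty_natSinv_lt (PosNum a0); apply: filterS => n /= hn.
apply: (@le_trans _ _ (e1 * L * (quad_var n w + total w))); last first.
  rewrite ler_wpM2r// addr_ge0 ?sumr_ge0// => [k _|c _]; first exact: sqr_ge0.
  exact: clock_ge0.
apply: sum_le => // k; have g0 := @grid_ge0 R n k; have gl := ltW (@grid_lt R n k).
have g01 : 0 <= (grid n k : R) <= 1 by rewrite g0 grid_le1// ltnW.
have gk : `|grid n k.+1 - grid n k| < a by rewrite grid_step ger0_norm.
have g0' : 0 <= grid n k.+1 :> R by exact: grid_ge0.
have kZ : `|(grid n k.+1 : R) - grid n k| < aZ' by apply: lt_le_trans gk _; rewrite ge_min lexx.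
have kW : `|(grid n k.+1 : R) - grid n k| < aW' by apply: lt_le_trans gk _; rewrite !ge_min lexx orbT.
have kC c : `|(grid n k.+1 : R) - grid n k| < D' c.
  by apply: lt_le_trans gk _; rewrite !ge_min hC !orbT.
have rs x y xi K a' b := @remainder_small _ _ f Df Hf C df ddf Dc Hc DE HE fc C0 HC x y xi K a' b.
apply: (rs _ _ _ Kc _ _ _ _ _ _ _ _ _ e1 D) => //.
- exact: oZ.
- exact: oZ.
- exact: sumr_ge0.
- by apply: sumr_ge0 => c _; exact: clock_inc_ge0.
- by move=> j; exact: drift_le.
- exact: ltW.
- apply: (@le_trans _ _ (\sum_(l < d) eta + \sum_(c : option 'I_d) eta)).
    apply: lerD; apply: ler_sum => i _; last first.
      by apply: le_trans (ler_norm _) _; apply: ltW; exact: (hD' i).2.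
    apply: le_trans (cV_coord_le (W (grid n k.+1) w - W (grid n k) w : 'cV[R]_d) i) _; apply: ltW; exact: hWu.
  rewrite !sumr_const card_option card_ord -mulrnDr -[leLHS]mulr_natl.
  by rewrite /eta mulrA ler_pdivrMr ?mulr_gt0// mulrC ler_pM2l// -natrM ler_nat mul2n -addnn leq_add2r leqnSn.
- exact: hZ.
- by move=> p ph j k'; apply: hD.
Qed.

(** The expected increments of [f] over the grid telescope. Their first and second order terms are
    Riemann sums that converge to occupation integrals, and the expected remainders tend to 0. *)
Lemma dynkin_formula (m : option 'I_d -> {measure set (borel R d) -> \bar R}) :
  (forall c (q : 'cV[R]_d -> R) C, continuous q -> (forall x, `|q x| <= C) ->
    \sum_(k < n.+1) \int[P]_w (q (Z (grid n k) w) * clock_increment c (grid n k) (grid n k.+1) w)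
      @[n --> \oo] --> \int[m c]_x q x) ->
  \int[P]_w f (Z 1 w) - f x0 = \sum_c \sum_j clock_coef c j * \int[m c]_x Df j x
    + 2^-1 * \sum_j \sum_k Sigma j k * \int[m None]_x Hf j k x.
Proof.
move=> hm.
have ird n : intg (rem n).
  by apply: integrable_fsum => k; apply: step_remainder_integrable; [exact: grid_ge0|exact: grid_lt|exact: grid_le1].
have lim0 : \int[P]_w rem n w @[n --> \oo] --> (0 : R).
  apply: (@vanishing_expectation _ _ _ P G rem quad_var total (20 * C * (1 + q)) (3 * d%:R ^+ 4)) => //.
  - by move=> n; apply/measurable_EFinP; exact: measurable_int (ird n).
  - by apply: integrable_fsum => c; exact: iclock.
  - by move=> w Gw; apply: sumr_ge0 => c _; exact: clock_ge0.
  - by move=> n w; apply: sumr_ge0 => k _; exact: sqr_ge0.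
  - by rewrite !mulr_ge0 ?(ltW C0)// addr_ge0// sqr_ge0.

  - by move=> w Gw e e0; exact: rem_small.
  - exact: quad_var_integrable.
  - exact: quad_var_moment.
have E n : \int[P]_w rem n w = \int[P]_w f (Z 1 w) - f x0
    - \sum_c \sum_j clock_coef c j * \sum_(k < n.+1) \int[P]_w (Df j (Z (grid n k) w) * clock_increment c (grid n k) (grid n k.+1) w)
    - 2^-1 * \sum_j \sum_l Sigma j l * \sum_(k < n.+1) \int[P]_w (Hf j l (Z (grid n k) w) * clock_increment None (grid n k) (grid n k.+1) w).
  rewrite Rintegral_fsum; last first.
    by move=> k; apply: step_remainder_integrable; [exact: grid_ge0|exact: grid_lt|exact: grid_le1].
  under eq_bigr => k _ do rewrite (Rintegral_step_remainder (grid_ge0 _ _) (grid_lt _ _) (grid_le1 (ltn_ord k))).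
  rewrite !sumrB; congr (_ - _ - _).
  - rewrite -sumrB -(big_mkord xpredT (fun k => \int[P]_w fp (Z (grid n k.+1) w) - \int[P]_w fp (Z (grid n k) w))).
    rewrite (telescope_sumr (fun k => \int[P]_w fp (Z (grid n k) w)))// grid1 grid0; congr (_ - _).
      by apply: eq_Rintegral => w _; rewrite fpE.
    transitivity (\int[P]_w cst (f x0) w).
      apply: (eq_Rintegral_null mG PG) => //.
        by apply/measurable_EFinP; exact: measurable_int (ifp (lexx 0)).
      by move=> w Gw; rewrite fpE// startG.
    transitivity (f x0 * \int[P]_w (1 : R)); last by rewrite Rintegral1 mulr1.
    rewrite -RintegralZl//; last exact: finite_measure_integrable_cst.
    by apply: eq_Rintegral => w _; rewrite mulr1.
  - rewrite exchange_big /=; apply: eq_bigr => c _; rewrite exchange_big /=; apply: eq_bigr => j _.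
    by rewrite mulr_sumr.
  - rewrite -mulr_sumr; congr (_ * _); rewrite exchange_big /=; apply: eq_bigr => j _.
    rewrite exchange_big /=; apply: eq_bigr => l _.
    by rewrite mulr_sumr.
have lim1 : \int[P]_w rem n w @[n --> \oo] --> \int[P]_w f (Z 1 w) - f x0
    - \sum_c \sum_j clock_coef c j * \int[m c]_x Df j x
    - 2^-1 * \sum_j \sum_k Sigma j k * \int[m None]_x Hf j k x.
  rewrite (funext E); apply: cvgB; first apply: cvgB; first exact: cvg_cst.
  - apply: cvg_fsum => c; apply: cvg_fsum => j; apply: cvgMr; exact: (hm c _ C).
  - apply: cvgMr; apply: cvg_fsum => j; apply: cvg_fsum => k; apply: cvgMr; exact: (hm None _ C).
have /eqP : 0 = \int[P]_w f (Z 1 w) - f x0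
    - \sum_c \sum_j clock_coef c j * \int[m c]_x Df j x
    - 2^-1 * \sum_j \sum_k Sigma j k * \int[m None]_x Hf j k x.
  exact: (cvg_unique _ lim0 lim1).
by rewrite -addrA -opprD eq_sym subr_eq0 => /eqP.
Qed.

End formula.
End dynkin.

(** Derivatives of [f] in the form used for integration: global continuous functions with one common
    bound [C]. *)
Record test_data {R : realType} {d : nat} (f : 'cV[R]_d -> R) (Df : 'I_d -> 'cV[R]_d -> R)
    (Hf : 'I_d -> 'I_d -> 'cV[R]_d -> R) (C : R) : Prop := {
  td_df : forall j x, oorthant x -> derivable f x (delta_mx j 0);
  td_ddf : forall j k x, oorthant x -> derivable (partial k f) x (delta_mx j 0);
  td_Dc : forall j, continuous (Df j);
  td_Hc : forall j k, continuous (Hf j k);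
  td_DE : forall j x, oorthant x -> Df j x = partial j f x;
  td_HE : forall j k x, oorthant x -> Hf j k x = partial j (partial k f) x;
  td_fc : {within orthant, continuous f};
  td_C0 : 0 < C;
  td_fC : forall x, orthant x -> `|f x| <= C;
  td_DC : forall j x, `|Df j x| <= C;
  td_HC : forall j k x, `|Hf j k x| <= C }.

Lemma Cb2_test_data {R : realType} {d : nat} (f : 'cV[R]_d -> R) : Cb2 f ->
  exists Df Hf C, [/\ test_data f Df Hf C,
    forall j x, orthant x -> extension (partial j f) x = Df j x &
    forall j k x, orthant x -> extension (partial j (partial k f)) x = Hf j k x].
Proof.
move=> [[fc [Mf [_ fM]]] df ddf be1 be2].
have /choice[Df hD] := fun j => bounded_extension (be1 j).
have /choice[Hf hH] := fun jk : 'I_d * 'I_d => bounded_extension (be2 jk.1 jk.2).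
have /choice[CD hCD] : forall j, exists C, 0 < C /\ forall x, `|Df j x| <= C.
  by move=> j; have [_ _ _ [C C0 hC]] := hD j; exists C.
have /choice[CH hCH] : forall jk : 'I_d * 'I_d, exists C, 0 < C /\ forall x, `|Hf jk x| <= C.
  by move=> j; have [_ _ _ [C C0 hC]] := hH j; exists C.
pose sD := \sum_j CD j; pose sH := \sum_jk CH jk; pose Cf := `|Mf| + 1.
have sD0 : 0 <= sD by apply: sumr_ge0 => j _; apply: ltW; exact: (hCD j).1.
have sH0 : 0 <= sH by apply: sumr_ge0 => j _; apply: ltW; exact: (hCH j).1.
have Cf0 : 0 < Cf by rewrite ltr_pwDr.
have leD j : CD j <= sD.
  by rewrite /sD (bigD1 j)//= lerDl sumr_ge0// => k _; apply: ltW; exact: (hCD k).1.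
have leH j : CH j <= sH.
  by rewrite /sH (bigD1 j)//= lerDl sumr_ge0// => k _; apply: ltW; exact: (hCH k).1.
exists Df, (fun j k => Hf (j, k)), (Cf + sD + sH); split.
- split => //.
  + by move=> j; have [] := hD j.
  + by move=> j k; have [] := hH (j, k).
  + by move=> j x x0; have [_ _ + _] := hD j; apply.
  + by move=> j k x x0; have [_ _ + _] := hH (j, k); apply.
  + by rewrite -addrA ltr_pwDl// addr_ge0.
  + move=> x x0; apply: (@le_trans _ _ Cf); last by rewrite -addrA lerDl addr_ge0.
    by apply: fM => //; rewrite /Cf; apply: le_lt_trans (ler_norm _) _; rewrite ltrDl.
  + move=> j x; apply: le_trans ((hCD j).2 x) _; apply: le_trans (leD j) _.
    by rewrite addrAC lerDr addr_ge0// ltW.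
  + move=> j k x; apply: le_trans ((hCH (j, k)).2 x) _; apply: le_trans (leH (j, k)) _.
    by rewrite lerDr addr_ge0// ltW.
- by move=> j x x0; have [_ E _ _] := hD j; rewrite E.
- by move=> j k x x0; have [_ E _ _] := hH (j, k); rewrite E.
Qed.

Lemma ae_full_set d (T : measurableType d) (R : realType) (P : probability T R) (Q : T -> Prop) :
  {ae P, forall w, Q w} -> exists G, [/\ measurable G, P (~` G) = 0%E & forall w, G w -> Q w].
Proof.
move=> [N [mN N0 hN]]; exists (~` N); split; [exact: measurableC|by rewrite setCK|].
by move=> w nN; apply: contrapT => nQ; apply: nN; exact: hN.
Qed.

(** * Occupation families of the process *)

Section srbm.
Context {R : realType} {d : nat} {dO} {Omega : measurableType dO}.
Variables (F : R -> set (set Omega)) (P : borel R d -> probability Omega R).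
Variables (Z : R -> {mfun Omega >-> borel R d}) (W Y : R -> Omega -> borel R d).
Variables (mu : 'cV[R]_d) (Sigma Rmat : 'M[R]_d).
Hypothesis hSRBM : is_SRBM F P Z mu Sigma Rmat W Y.
Hypothesis hY : forall i : 'I_d,
      (ereal_sup [set 'E_(P x)[fun w => (Y 1%R w : 'cV[R]_d) i 0%R]
                 | x in @orthant R d] < +oo)%E.

Lemma srbm_good_set : exists S : 'M[R]_d, S *m S^T = Sigma /\ forall x, orthant x ->
  exists G, [/\ measurable G, P x (~` G) = 0%E & forall w, G w -> [/\ Z 0 w = x,
   {within `[0, +oo[, continuous (fun t => W t w : 'cV[R]_d)},
   (forall i, regulator_path i (fun t => Z t w) (fun t => (Y t w : 'cV[R]_d) i 0)) &
   (forall t, 0 <= t ->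
      Z t w = (Z 0 w : 'cV[R]_d) + t *: mu + S *m (W t w : 'cV[R]_d) + Rmat *m (Y t w : 'cV[R]_d)
      :> 'cV[R]_d)]].
Proof.
have [S [[Ss _] SS] hS] := srbm_decomposition hSRBM.
exists S; split; first by rewrite Ss.
move=> x x0; apply: ae_full_set.
have [_ _ Wc _] := srbm_brownian hSRBM x0.
have st := srbm_start hSRBM x0; have rg := srbm_regulator hSRBM x0; have dc := hS x x0.
by apply: filterS (filterI (filterI Wc st) (filterI rg dc)) => w [[? ?] [? ?]].
Qed.

Let mY1 i : measurable_fun setT (fun w => (Y 1 w : 'cV[R]_d) i 0).
Proof.
exact: (adapted_coord_measurable (srbm_filtration hSRBM) i (srbm_regulator_adapted hSRBM) ler01).
Qed.

Lemma regulator_integrable x i : orthant x ->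
  (P x).-integrable setT (EFin \o (fun w => (Y 1 w : 'cV[R]_d) i 0)).
Proof.
move=> x0; have mYE : measurable_fun setT (fun w => ((Y 1 w : 'cV[R]_d) i 0)%:E) by exact/measurable_EFinP.
have [S [_ /(_ x x0) [G [mG PG hG]]]] := srbm_good_set.
apply/integrableP; split => //.
have -> : (\int[P x]_w `|((Y 1 w : 'cV[R]_d) i 0)%:E| = 'E_(P x)[fun w => (Y 1%R w : 'cV[R]_d) i 0%R])%E.
  rewrite unlock; apply: ae_eq_integral => //; first exact: measurableT_comp.
  exists (~` G); split => //; first exact: measurableC.
  move=> w /= h Gw; apply: h => _; have [_ _ /(_ i) [_ y0 yl _] _] := hG w Gw.
  by rewrite ger0_norm// -y0 yl.
by apply: le_lt_trans (hY i); apply: ereal_sup_ubound; exists x.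
Qed.

(** A constant that is uniform in the starting point is what keeps mixtures over a finite measure
    finite. *)
Lemma regulator_bound : exists2 C : R, 0 <= C & forall x i, orthant x ->
  \int[P x]_w (Y 1 w : 'cV[R]_d) i 0 <= C.
Proof.
have h x i : orthant x -> exists r : R, ('E_(P x)[fun w => (Y 1%R w : 'cV[R]_d) i 0%R] = r%:E)%E.
  move=> x0; exists (\int[P x]_w (Y 1 w : 'cV[R]_d) i 0); rewrite unlock /Rintegral fineK//.
  by apply: integrable_fin_num => //; exact: regulator_integrable.
have /choice[C hC] : forall i, exists C : R, forall x, orthant x -> \int[P x]_w (Y 1 w : 'cV[R]_d) i 0 <= C.
  move=> i; have [x0|/asboolPn nx] := pselect (exists x : 'cV[R]_d, orthant x); last first.
    by exists 0 => x x0; exfalso; move/asboolPn : nx; apply; exists x.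
  have /(@fin_numPlt _) : ((-oo < ereal_sup [set 'E_(P x)[fun w => (Y 1%R w : 'cV[R]_d) i 0%R] | x in @orthant R d]) &&
    (ereal_sup [set 'E_(P x)[fun w => (Y 1%R w : 'cV[R]_d) i 0%R] | x in @orthant R d] < +oo))%E.
    rewrite hY andbT; have [x x1] := x0; have [r hr] := h x i x1.
    by apply: (lt_le_trans (ltNyr r)); rewrite -hr; apply: ereal_sup_ubound; exists x.
  move=> /fineK hs; exists (fine (ereal_sup [set 'E_(P x)[fun w => (Y 1%R w : 'cV[R]_d) i 0%R] | x in @orthant R d])%E).
  move=> x x1; rewrite -lee_fin hs; apply: ereal_sup_ubound; exists x => //.
  by rewrite unlock /Rintegral fineK//; apply: integrable_fin_num => //; exact: regulator_integrable.
exists (\sum_i `|C i|); first by apply: sumr_ge0.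
move=> x i x0; apply: le_trans (hC i x x0) _; apply: le_trans (ler_norm _) _.
by rewrite (bigD1 i)//= lerDl sumr_ge0.
Qed.

Definition riemann_sum (c : option 'I_d) (q : 'cV[R]_d -> R) (x : borel R d) (n : nat) : R :=
  \sum_(k < n.+1) \int[P x]_w (q (Z (grid n k) w) * clock_increment Y c (grid n k) (grid n k.+1) w).

(** [of_riemann] determines the measures from the process, and is the source of their measurable
    dependence on [x]. *)
Record occupation_family (x : borel R d) (m : option 'I_d -> {measure set (borel R d) -> \bar R}) : Prop := {
  of_finite : forall c, (m c setT < +oo)%E;
  of_mass : forall c, \int[m c]_y (1 : R) = \int[P x]_w clock Y c 1 w;
  of_riemann : forall c (q : 'cV[R]_d -> R) C, continuous q -> (forall y, `|q y| <= C) ->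
    riemann_sum c q x n @[n --> \oo] --> \int[m c]_y q y;
  of_support : forall c, m c (~` (if c is Some i then face i else orthant)) = 0%E;
  of_dynkin : forall f Df Hf C, test_data f Df Hf C ->
    \int[P x]_w f (Z 1 w) - f x = \sum_c \sum_j clock_coef mu Rmat c j * \int[m c]_y Df j y
    + 2^-1 * \sum_j \sum_k Sigma j k * \int[m None]_y Hf j k y }.

(** The families are chosen separately for each starting point, so that no regularity in [x] comes
    with the choice. *)
Lemma occupation_family_exists : exists m : borel R d -> option 'I_d -> {measure set (borel R d) -> \bar R},
  forall x, orthant x -> occupation_family x (m x).
Proof.
suff /choice[m hm] : forall x : borel R d, exists m, orthant x -> occupation_family x m by exists m.
move=> x.
have [x0|nx] := pselect (orthant x); last first.
  by exists (fun=> mzero) => x0; exfalso; exact: nx.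
have [S [SS /(_ x x0) [G [mG PG hG]]]] := srbm_good_set.
have hF := srbm_filtration hSRBM.
have aZ : adapted F (fun t => Z t : Omega -> borel R d) by exact: (srbm_adapted hSRBM).
have aY := srbm_regulator_adapted hSRBM.
have oZ : forall t w, 0 <= t -> orthant (Z t w) by exact: (srbm_orthant hSRBM).
have cZ w := srbm_continuous hSRBM w.
have hW := srbm_brownian hSRBM x0.
have rg : forall w, G w -> forall i, regulator_path i (fun t => Z t w) (fun t => (Y t w : 'cV[R]_d) i 0).
  by move=> w /hG[].
have iY1 i := regulator_integrable i x0.
have /choice[m hm] := clock_occupation hF aZ aY oZ cZ mG PG rg iY1.
exists m => _; split.
- by move=> c; have [] := hm c.
- by move=> c; have [] := hm c.
- by move=> c q C qc qC; have [_ _ + _] := hm c; move=> /(_ q C qc qC).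
- by move=> c; have [_ _ _] := hm c.
- move=> f Df Hf C [a1 a2 a3 a4 a5 a6 a7 a8 a9 a10 a11].
  apply: (dynkin_formula hF aZ aY hW oZ cZ SS mG PG _ _ rg _ _ a1 a2 a3 a4 a5 a6 a7 a8 a9 a10 a11) => //.
  + by move=> w /hG[].
  + by move=> w /hG[].
  + by move=> w /hG[].
  + by move=> c q C' qc qC; have [_ _ + _] := hm c; move=> /(_ q C' qc qC).
Qed.
End srbm.

(** * The Markov property and measurable dependence on the starting point *)

Section markov.
Context {R : realType} {d : nat} {dO} {Omega : measurableType dO}.
Variables (F : R -> set (set Omega)) (P : borel R d -> probability Omega R).
Variables (Z : R -> {mfun Omega >-> borel R d}).
Hypothesis hF : filtration F.
Hypothesis aZ : adapted F Z.
Hypothesis oZ : forall t w, 0 <= t -> orthant (Z t w).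
Hypothesis hM : strong_markov F P Z.

Local Notation T := (transition P Z).

Let mZ t : measurable_fun setT (Z t : Omega -> borel R d).
Proof. exact: measurable_funPT. Qed.

(** The strong Markov property at the constant time [s], for which the events in its hypotheses are
    either trivial or in [F s]. *)
Lemma markov_events x s u A B : orthant x -> 0 <= s -> 0 <= u -> measurable A -> measurable B ->
  P x (Z s @^-1` A `&` Z (s + u) @^-1` B) = (\int[P x]_(w in Z s @^-1` A) T u (Z s w) B)%E.
Proof.
move=> x0 s0 u0 mA mB; have [_ /(_ x (fun=> s%:E) (Z s @^-1` A) u B x0)] := hM.
have [Fs Fm Fle] := hF.
have cst_event t (Q : Prop) : 0 <= t -> F t [set _ : Omega | Q].
  move=> t0; have [h0 hC _] := Fs t t0; have [q|nq] := pselect Q.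
    rewrite (_ : [set _ | Q] = setT); first by have := hC _ h0; rewrite setD0.
    by apply/seteqP; split.
  by rewrite (_ : [set _ | Q] = set0)//; apply/seteqP; split.
have FA : F s (Z s @^-1` A) by apply: (aZ s0); exists A => //; rewrite setTI.
move=> h; rewrite (_ : Z s @^-1` A `&` Z (s + u) @^-1` B =
   Z s @^-1` A `&` [set w | (s%:E < +oo)%E /\ B (Z (fine s%:E + u) w)]); last first.
  by congr (_ `&` _); apply/seteqP; split => [w Bw|w []//]; split => //; exact: ltry.
rewrite h //.
- rewrite (_ : _ `&` _ = Z s @^-1` A)//; apply/seteqP; split => [w []//|w Aw]; split => //; exact: ltry.
- split; first by move=> _; rewrite lee_fin.
  by move=> t t0; exact: cst_event.
- split; first exact: (Fm s).
  move=> t t0; have [st|ts] := leP s t.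
    rewrite (_ : _ `&` _ = Z s @^-1` A); first exact: (Fle s).
    by apply/seteqP; split => [w []//|w Aw]; split => //=; rewrite lee_fin.
  rewrite (_ : _ `&` _ = set0); first by have [] := Fs t t0.
  by apply/seteqP; split => // w [_] /=; rewrite lee_fin leNgt ts.
Qed.

(* Extended by 0 because the laws P x are meaningless off the orthant. *)
Definition kernel_integral (u : R) (f : borel R d -> \bar R) (z : borel R d) : \bar R :=
  if `[< @orthant R d z >] then (\int[T u z]_y f y)%E else 0%E.

Lemma kernel_integral_like u z : integral_like (fun f => kernel_integral u f z).
Proof.
rewrite /kernel_integral; case: asboolP => _; first exact: integral_like_integral.
exact: integral_like0.
Qed.

Lemma kernel_integral_indic u B z : measurable B ->
  kernel_integral u (fun y => (\1_B y)%:E) z = if `[< @orthant R d z >] then T u z B else 0%E.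
Proof. by move=> mB; rewrite /kernel_integral; case: asboolP => // _; rewrite integral_indic// setIT. Qed.

Lemma kernel_integral_measurable u (f : borel R d -> \bar R) : 0 <= u -> measurable_fun setT f ->
  (forall x, (0 <= f x)%E) -> measurable_fun setT (kernel_integral u f).
Proof.
move=> u0; apply: (@integral_like_measurable _ _ _ _ (borel R d) setT (fun z f => kernel_integral u f z)).
  by move=> z _; exact: kernel_integral_like.
move=> B mB.
rewrite (_ : (fun z => _) = (fun z => T u z B) \_ (orthant : set (borel R d))).
  by apply/(measurable_restrictT _ measurable_orthant); have [h _] := hM; exact: h.
by apply/funext => z; rewrite kernel_integral_indic// patchE.
Qed.

Lemma kernel_integral_ge0 u (f : borel R d -> \bar R) z : (forall x, (0 <= f x)%E) -> (0 <= kernel_integral u f z)%E.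
Proof. by move=> f0; rewrite /kernel_integral; case: asboolP => // _; apply: integral_ge0. Qed.

(** Reduced twice to indicators: in [g] because both sides are integral-like, and in [a] by transfer
    of the weights. What remains is [markov_events]. *)
Lemma two_time x s u (a : borel R d -> R) (g : borel R d -> \bar R) : orthant x -> 0 <= s -> 0 <= u ->
  measurable_fun setT a -> (forall z, 0 <= a z) -> measurable_fun setT g -> (forall z, (0 <= g z)%E) ->
  (\int[P x]_w ((a (Z s w))%:E * g (Z (s + u) w)) =
   \int[P x]_w ((a (Z s w))%:E * kernel_integral u g (Z s w)))%E.
Proof.
move=> x0 s0 u0 ma a0.
have maZ : measurable_fun setT (fun w => a (Z s w)) by exact: measurableT_comp.
have mI B : measurable B -> measurable_fun setT (fun y : borel R d => (\1_B y)%:E : \bar R).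
  by move=> mB; apply/measurable_EFinP; exact: measurable_indic.
apply: (@integral_like_eq _ _ _ (fun g => \int[P x]_w ((a (Z s w))%:E * g (Z (s + u) w)))%E
  (fun g => \int[P x]_w ((a (Z s w))%:E * kernel_integral u g (Z s w)))%E).
- apply: (@integral_like_mix _ _ _ _ _ (P x) (fun w => a (Z s w)) (fun w f => f (Z (s + u) w))) => //.
  by move=> A mA; exact: (measurableT_comp (mI A mA) (mZ (s + u))).
- apply: (@integral_like_mix _ _ _ _ _ (P x) (fun w => a (Z s w)) (fun w f => kernel_integral u f (Z s w))) => //.
    by move=> w; exact: kernel_integral_like.
  move=> A mA; apply: (@measurableT_comp _ _ _ _ _ _ (kernel_integral u (fun y => (\1_A y)%:E)) _ (Z s)) => //.
  by apply: kernel_integral_measurable => //; exact: mI.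
- move=> B mB.
  pose a2 (z : borel R d) : R := fine (kernel_integral u (fun y => (\1_B y)%:E) z).
  have Kfin z : kernel_integral u (fun y => (\1_B y)%:E) z = (a2 z)%:E.
    rewrite /a2 fineK// kernel_integral_indic//; case: ifP => // _.
    by rewrite fin_num_measure.
  have ma2 : measurable_fun setT a2.
    apply/measurable_EFinP; rewrite /comp (funext (fun z => esym (Kfin z))).
    by apply: kernel_integral_measurable => //; exact: mI.
  have a20 z : 0 <= a2 z.
    by rewrite -lee_fin -Kfin kernel_integral_ge0.
  have mBZ : measurable_fun setT (fun w => \1_B (Z (s + u) w) : R).
    by apply: measurableT_comp => //; exact: measurable_indic.
  under [RHS]eq_integral do rewrite Kfin.
  apply: (@ge0_integral_transfer _ _ _ _ _ _ R (P x) (P x) (Z s) (Z s) (fun w => \1_B (Z (s + u) w))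
    (fun w => a2 (Z s w)) (mZ s) (mZ s) mBZ _ _ _ _ (EFin \o a)) => //.
  + exact: measurableT_comp.
  + move=> A mA.
    have mP t C : measurable C -> measurable (Z t @^-1` C).
      by move=> mC; rewrite -[X in measurable X]setTI; exact: mZ.
    transitivity (P x (Z s @^-1` A `&` Z (s + u) @^-1` B)).
      transitivity (\int[P x]_w (\1_(Z s @^-1` A `&` Z (s + u) @^-1` B) w)%:E)%E.
        apply: eq_integral => w _; rewrite -EFinM !indicE in_setI.
        have inE' t C : (w \in Z t @^-1` C) = (Z t w \in C) by apply/idP/idP; rewrite !inE.
        by rewrite !inE'; case: (_ \in A); case: (_ \in B); rewrite ?mulr1 ?mulr0.
      by rewrite integral_indic ?setIT//; apply: measurableI; exact: mP.
    rewrite markov_events// [LHS]integral_mkcond; apply: eq_integral => w _.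
    rewrite patchE; have E : T u (Z s w) B = (a2 (Z s w))%:E.
      by rewrite -Kfin kernel_integral_indic//; case: asboolP => // n; exfalso; apply: n; exact: oZ.
    rewrite indicE; have -> : (w \in Z s @^-1` A) = (Z s w \in A) by apply/idP/idP; rewrite !inE.
    by case: ifP => _; rewrite ?mul1e ?mul0e.
  + exact/measurable_EFinP.
Qed.

Lemma kernel_integralE u f x : orthant x -> measurable_fun setT f -> (forall z, (0 <= f z)%E) ->
  kernel_integral u f x = (\int[P x]_w f (Z u w))%E.
Proof.
move=> x0 mf f0; rewrite /kernel_integral; case: asboolP => // _.
by rewrite ge0_integral_distribution.
Qed.

(** By the Markov property this function of [x] is [P_s (a P_u g)]; measurability in the starting
    point is assumed for one-time transitions only. *)
Lemma two_time_measurable s u (a : borel R d -> R) (g : borel R d -> \bar R) : 0 <= s -> 0 <= u ->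
  measurable_fun setT a -> (forall z, 0 <= a z) -> measurable_fun setT g -> (forall z, (0 <= g z)%E) ->
  measurable_fun (orthant : set (borel R d)) (fun x => \int[P x]_w ((a (Z s w))%:E * g (Z (s + u) w)))%E.
Proof.
move=> s0 u0 ma a0 mg g0; pose h z := ((a z)%:E * kernel_integral u g z)%E.
have h0 z : (0 <= h z)%E by rewrite mule_ge0 ?lee_fin ?kernel_integral_ge0.
have mh : measurable_fun setT h.
  by apply: emeasurable_funM; [exact/measurable_EFinP|exact: kernel_integral_measurable].
apply: (@eq_measurable_fun _ _ _ _ _ (kernel_integral s h)).
  by move=> x /set_mem x0; rewrite kernel_integralE// two_time.
by apply: measurable_funTS; exact: kernel_integral_measurable.
Qed.

End markov.

Section occupation_measurable.
Context {R : realType} {d : nat} {dO} {Omega : measurableType dO}.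
Variables (F : R -> set (set Omega)) (P : borel R d -> probability Omega R).
Variables (Z : R -> {mfun Omega >-> borel R d}) (W Y : R -> Omega -> borel R d).
Variables (mu : 'cV[R]_d) (Sigma Rmat : 'M[R]_d).
Hypothesis hSRBM : is_SRBM F P Z mu Sigma Rmat W Y.
Hypothesis hY : forall i : 'I_d,
      (ereal_sup [set 'E_(P x)[fun w => (Y 1%R w : 'cV[R]_d) i 0%R]
                 | x in @orthant R d] < +oo)%E.
Hypothesis hM : strong_markov F P Z.
Hypothesis hR : Rmat \in unitmx.

Local Notation OR := (orthant : set (borel R d)).

Let hF : filtration F. Proof. exact: srbm_filtration hSRBM. Qed.
Let aZ : adapted F (fun t => Z t : Omega -> borel R d). Proof. exact: srbm_adapted hSRBM. Qed.
Let aY : adapted F Y. Proof. exact: srbm_regulator_adapted hSRBM. Qed.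
Let oZ : forall t w, 0 <= t -> orthant (Z t w). Proof. exact: srbm_orthant hSRBM. Qed.
Let mZ t : measurable_fun setT (Z t : Omega -> borel R d). Proof. exact: measurable_funPT. Qed.

Let rg (x : borel R d) (G : set Omega) (S : 'M[R]_d) : (forall w, G w -> [/\ Z 0 w = x,
   {within `[0, +oo[, continuous (fun t => W t w : 'cV[R]_d)},
   (forall i, regulator_path i (fun t => Z t w) (fun t => (Y t w : 'cV[R]_d) i 0)) &
   (forall t, 0 <= t ->
      Z t w = (Z 0 w : 'cV[R]_d) + t *: mu + S *m (W t w : 'cV[R]_d) + Rmat *m (Y t w : 'cV[R]_d)
      :> 'cV[R]_d)]) -> (forall w, G w -> forall i, regulator_path i (fun t => Z t w) (fun t => (Y t w : 'cV[R]_d) i 0)) /\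
   (forall w, G w -> (forall t, 0 <= t ->
      Z t w = (Z 0 w : 'cV[R]_d) + t *: mu + S *m (W t w : 'cV[R]_d) + Rmat *m (Y t w : 'cV[R]_d)
      :> 'cV[R]_d)).
Proof. by move=> h; split => w /h[]. Qed.

Lemma coord_integrable x t j : orthant x -> 0 <= t -> t <= 1 ->
  (P x).-integrable setT (EFin \o (fun w => (Z t w : 'cV[R]_d) j 0)).
Proof.
move=> x0 t0 t1; have [S [SS /(_ x x0) [G [mG PG hG]]]] := srbm_good_set hSRBM.
have [rgG decG] := rg hG.
have mc : measurable_fun setT (fun w => (Z t w : 'cV[R]_d) j 0).
  exact: (measurableT_comp (measurable_coord j) (mZ t)).
have ic : (P x).-integrable setT (EFin \o cst `|x j 0|) by exact: finite_measure_integrable_cst.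
have [->|tn0] := eqVneq t 0.
  apply: (integrable_le_null mG PG) ic; first exact: (measurableT_comp (measurable_coord j) (mZ 0)).
  by move=> w /hG[-> _ _ _].
have t0' : 0 < t by rewrite lt_neqAle eq_sym tn0.
have ii := increment_integrable1 hF aZ aY (srbm_brownian hSRBM x0) mG PG rgG decG
   (fun i => regulator_integrable hSRBM hY i x0) (lexx 0) t0' t1 j.
apply: (integrable_le_null mG PG mc (g := fun w => `|increment Z 0 t j w| + `|x j 0|)).
  move=> w /hG[Z0 _ _ _]; rewrite /increment !mxE Z0.
  by apply: le_trans (ler_normD _ _); rewrite subrK.
exact: (integrableD measurableT (integrable_norm ii) ic).
Qed.

Section two_times.
Variables (q : borel R d -> R) (C : R).
Hypotheses (mq : measurable_fun setT q) (qC : forall x, `|q x| <= C).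

Let q0 z : 0 <= q z + C. Proof. by have := qC z; rewrite ler_norml => /andP[]; lra. Qed.

Let iq x s : (P x).-integrable setT (EFin \o (fun w => q (Z s w))).
Proof.
by apply: (bounded_integrable _ _ (C := C)) => //; [exact: probability_lty|exact: measurableT_comp].
Qed.

Lemma past_measurable (g : borel R d -> R) s t : 0 <= s -> s <= t -> measurable_fun setT g ->
  (forall z, 0 <= g z) ->
  (forall x, orthant x -> (P x).-integrable setT (EFin \o (fun w => g (Z t w)))) ->
  measurable_fun OR (fun x => \int[P x]_w (q (Z s w) * g (Z t w))).
Proof.
move=> s0 st mg g0 ig; have u0 : 0 <= t - s by rewrite subr_ge0.
have mgE : measurable_fun setT (EFin \o g) by exact/measurable_EFinP.
have g0E z : (0 <= (EFin \o g) z)%E by rewrite lee_fin.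
(* The weight [q + C] is nonnegative; the excess [C E[g(Z_t)]] is obtained from the weight 1 in [m2]
   and subtracted. *)
have m1 := two_time_measurable hF aZ oZ hM s0 u0 (measurable_funD mq (measurable_cst C)) q0 mgE g0E.
have mc1 : measurable_fun setT (cst 1 : borel R d -> R) by exact: measurable_cst.
have m2 := two_time_measurable hF aZ oZ hM s0 u0 mc1 (fun=> ler01) mgE g0E.
rewrite /= (_ : s + (t - s) = t) in m1 m2; last by rewrite addrC subrK.
apply: (@eq_measurable_fun _ _ _ _ _ (fun x => fine (\int[P x]_w ((q (Z s w) + C)%:E * (g (Z t w))%:E))
    - C * fine (\int[P x]_w (1%:E * (g (Z t w))%:E)))).
  move=> x /set_mem x0; have ix := ig x x0.
  have iqg : (P x).-integrable setT (EFin \o (fun w => q (Z s w) * g (Z t w))).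
    apply: (@integrable_le _ _ _ _ _ (fun w => C * g (Z t w))); last exact: integrable_Zl.
      by apply: measurable_funM; [exact: measurableT_comp|apply/measurable_EFinP; exact: measurable_int ix].
    by move=> w; rewrite normrM [`|g _|]ger0_norm// ler_wpM2r.
  transitivity (\int[P x]_w (q (Z s w) * g (Z t w) + C * g (Z t w)) - C * \int[P x]_w g (Z t w)).
    congr (_ - _ * _); rewrite /Rintegral; congr fine; apply: eq_integral => w _; rewrite -EFinM ?mul1r//.
    by rewrite mulrDl.
  rewrite RintegralD//; last exact: integrable_Zl.
  by rewrite RintegralZl// addrK.
apply: measurable_funB; first by apply: measurableT_comp => //; exact: m1.
by apply: measurable_funM => //; apply: measurableT_comp => //; exact: m2.
Qed.

Lemma past_measurable1 s : 0 <= s -> measurable_fun OR (fun x => \int[P x]_w q (Z s w)).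
Proof.
move=> s0; apply: (@eq_measurable_fun _ _ _ _ _ (fun x => \int[P x]_w (q (Z s w) * cst 1 (Z s w)))).
  by move=> x _; apply: eq_Rintegral => w _; rewrite mulr1.
by apply: past_measurable => // x x0; exact: finite_measure_integrable_cst.
Qed.

Lemma past_coord_measurable s t j : 0 <= s -> s <= t -> t <= 1 ->
  measurable_fun OR (fun x => \int[P x]_w (q (Z s w) * (Z t w : 'cV[R]_d) j 0)).
Proof.
move=> s0 st t1; have t0 := le_trans s0 st.
(* On the path the coordinate equals its positive part, which is nonnegative on the whole space as
   [past_measurable] demands. *)
pose g (y : borel R d) : R := Num.max 0 ((y : 'cV[R]_d) j 0).
have gE w : g (Z t w) = (Z t w : 'cV[R]_d) j 0 by apply/max_idPr; exact: oZ.
apply: (@eq_measurable_fun _ _ _ _ _ (fun x => \int[P x]_w (q (Z s w) * g (Z t w)))).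
  by move=> x _; apply: eq_Rintegral => w _; rewrite gE.
apply: past_measurable => //.
- by apply: measurable_maxr => //; exact: measurable_coord.
- by move=> z; rewrite le_max lexx.
- by move=> x x0; rewrite (_ : (fun w => _) = (fun w => (Z t w : 'cV[R]_d) j 0)); [exact: coord_integrable|exact/funext].
Qed.

(* The noise being orthogonal to the past, E_x[q(Z_s) (Y_t - Y_s)] is R^-1 applied to
   E_x[q(Z_s) (Z_t - Z_s - mu (t - s))], which only involves two-time laws of Z. *)
Lemma past_clock_measurable c s t : 0 <= s -> s < t -> t <= 1 ->
  measurable_fun OR (fun x => \int[P x]_w (q (Z s w) * clock_increment Y c s t w)).
Proof.
move=> s0 st t1; have t0 := le_trans s0 (ltW st); have s1 := le_trans (ltW st) t1.
case: c => [i|]; last first.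
  apply: (@eq_measurable_fun _ _ _ _ _ (fun x => (t - s) * \int[P x]_w q (Z s w))).
    move=> x _; rewrite -RintegralZl//; last exact: iq.
    by apply: eq_Rintegral => w _; rewrite mulrC.
  by apply: measurable_funM => //; exact: past_measurable1.
pose z x j := \int[P x]_w (q (Z s w) * (Z t w : 'cV[R]_d) j 0)
   - \int[P x]_w (q (Z s w) * (Z s w : 'cV[R]_d) j 0) - mu j 0 * ((t - s) * \int[P x]_w q (Z s w)).
apply: (@eq_measurable_fun _ _ _ _ _ (fun x => \sum_j invmx Rmat i j * z x j)); last first.
  apply: measurable_sum => j; apply: measurable_funM => //; apply: measurable_funB.
    by apply: measurable_funB; apply: past_coord_measurable => //; exact: ltW.
  by apply: measurable_funM => //; apply: measurable_funM => //; exact: past_measurable1.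
move=> x /set_mem x0.
have [S [SS /(_ x x0) [G [mG PG hG]]]] := srbm_good_set hSRBM.
have [rgG decG] := rg hG.
have iZ r j : 0 <= r -> r <= 1 -> (P x).-integrable setT (EFin \o (fun w => q (Z s w) * (Z r w : 'cV[R]_d) j 0)).
  move=> r0 r1; apply: (past_integrable hF s0 aZ mq qC); exact: coord_integrable.
have E j : z x j = \sum_l Rmat j l * \int[P x]_w (q (Z s w) * clock_increment Y (Some l) s t w).
  have := past_increment_Z hF aZ aY (srbm_brownian hSRBM x0) mG PG rgG decG
    (fun i => regulator_integrable hSRBM hY i x0) s0 st t1 mq qC j.
  rewrite big_option /= => h; rewrite /z -RintegralB; [|by []|exact: iZ|exact: iZ].
  rewrite (_ : \int[P x]_w (_ - _) = \int[P x]_w (q (Z s w) * increment Z s t j w)); last first.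
    by apply: eq_Rintegral => w _; rewrite -mulrBr /increment !mxE.
  rewrite h (_ : \int[P x]_w (q (Z s w) * clock_increment Y None s t w) = (t - s) * \int[P x]_w q (Z s w)).
    by rewrite addrC addrK.
  by rewrite -RintegralZl//; [apply: eq_Rintegral => w _; rewrite mulrC|exact: iq].
pose y := \col_l \int[P x]_w (q (Z s w) * clock_increment Y (Some l) s t w).
transitivity ((invmx Rmat *m (Rmat *m y)) i 0).
  by rewrite !mxE; apply: eq_bigr => j _; rewrite E mxE; congr (_ * _); apply: eq_bigr => l _; rewrite mxE.
by rewrite mulmxA mulVmx// mul1mx mxE.
Qed.

End two_times.

Variable m : borel R d -> option 'I_d -> {measure set (borel R d) -> \bar R}.
Hypothesis hm : forall x, orthant x -> occupation_family P Z Y mu Sigma Rmat x (m x).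

Lemma occupation_integral_measurable c (q : 'cV[R]_d -> R) C : continuous q -> (forall y, `|q y| <= C) ->
  measurable_fun OR (fun x => \int[m x c]_y q y).
Proof.
move=> qc qC; apply: (measurable_fun_cvg (h := fun n x => riemann_sum P Z Y c q x n)); last first.
  by move=> x x0; have [_ _ + _ _] := hm x0; move=> /(_ c q C qc qC).
move=> n; apply: measurable_sum => k.
by apply: (past_clock_measurable (borel_continuous qc) qC); [exact: grid_ge0|exact: grid_lt|exact: grid_le1].
Qed.

(** The indicator of [U] is the pointwise limit of the bounded continuous functions [min 1 (n q)],
    for which measurability comes from Riemann sums. *)
Lemma occupation_open_measurable c (U : set 'cV[R]_d) : open U -> measurable_fun OR (fun x => m x c U).
Proof.
move=> oU; have [q [qc q01 qU]] := open_cutoff oU.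
pose p n (y : 'cV[R]_d) : R := Num.min 1 (n%:R * q y).
have pc n : continuous (p n).
  rewrite (_ : p n = fun y => (1 + n%:R * q y - `|1 - n%:R * q y|) / 2); last first.
    by apply/funext => y; rewrite /p minr_absE.
  move=> y; have cq : n%:R * q x @[x --> nbhs y] --> n%:R * q y.
    by apply: (@cvgM _ _ (nbhs y)); [exact: cvg_cst|exact: qc].
  have c1 : (1 : R) @[x --> nbhs y] --> (1 : R) by exact: cvg_cst.
  apply: (@cvgM _ _ (nbhs y)); last exact: cvg_cst.
  apply: (@cvgB _ _ _ (nbhs y)); first exact: (@cvgD _ _ _ (nbhs y)).
  by apply: (@cvg_norm _ _ _ (nbhs y)); exact: (@cvgB _ _ _ (nbhs y)).
have q0 y : 0 <= q y by case/andP: (q01 y).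
have p0 n y : 0 <= p n y by rewrite le_min ler01 mulr_ge0.
have p1 n y : `|p n y| <= 1 by rewrite ger0_norm// ge_min lexx.
have mU : measurable (U : set (borel R d)) by exact: borel_open.
have fm x : orthant x -> m x c U \is a fin_num.
  move=> x0; rewrite ge0_fin_numE//; apply: le_lt_trans (of_finite (hm x0) c).
  by apply: le_measure => //; rewrite inE.
have cvg x : orthant x -> \int[m x c]_y p n y @[n --> \oo] --> \int[m x c]_y (\1_U y : R).
  move=> x0; apply: (@Rintegral_dominated_cvg _ _ _ (m x c) _ _ (cst 1)).
  - by move=> n; exact: (borel_continuous (pc n)).
  - exact: (@measurable_indic _ (borel R d)).
  - apply: aeW => y; rewrite indicE; have [|nU] := boolP (y \in U).
      rewrite inE => /qU qy; apply: cvg_near_cst; near=> n.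
      apply/min_idPl; rewrite -ler_pdivrMr// mul1r; near: n; exact: nbhs_infty_ger.
    have qy : q y = 0.
      apply/eqP; rewrite eq_le q0 andbT leNgt; apply/negP => /qU Uy.
      by move: nU; rewrite notin_setE.
    apply: cvg_near_cst; apply: nearW => n; rewrite /p qy mulr0.
    exact/min_idPr.
  - apply: (bounded_integrable (of_finite (hm x0) c) (C := 1)) => //.
    by move=> y; rewrite normr1.
  - by apply: aeW => y n; exact: p1.
apply: (@eq_measurable_fun _ _ _ _ _ (EFin \o (fun x => \int[m x c]_y (\1_U y : R)))).
  move=> x /set_mem x0.
  transitivity (fine (\int[m x c]_(y in [set: borel R d]) (\1_(U : set (borel R d)) y)%:E)%E)%:E; first by [].
  by rewrite integral_indic// setIT fineK// fm.
apply/measurable_EFinP; apply: (measurable_fun_cvg (h := fun n x => \int[m x c]_y p n y)) => //.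
by move=> n; exact: (occupation_integral_measurable c (pc n) (p1 n)).
Unshelve. all: by end_near. Qed.

Lemma occupation_measurable c (B : set (borel R d)) : measurable B -> measurable_fun OR (fun x => m x c B).
Proof.
apply: (@dynkin_induction _ (borel R d) (@open 'cV[R]_d) (fun B => measurable_fun OR (fun x => m x c B))) => //.
- by move=> U V oU oV; exact: openI.
- by apply: occupation_open_measurable; exact: openT.
- by move=> U oU; exact: occupation_open_measurable.
- move=> S mS hS; apply: (@eq_measurable_fun _ _ _ _ _ (fun x => m x c setT - m x c S)%E).
    move=> x /set_mem x0.
    have fS : m x c S \is a fin_num.
      rewrite ge0_fin_numE//; apply: le_lt_trans (of_finite (hm x0) c).
      by apply: le_measure => //; rewrite inE.
    rewrite -setTD measureD//; [by rewrite setTI|exact: of_finite (hm x0) c].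
  apply: emeasurable_funB => //; apply: occupation_open_measurable; exact: openT.
- move=> S mS tS hS; apply: (@eq_measurable_fun _ _ _ _ _ (fun x => \sum_(0 <= k <oo) m x c (S k))%E).
    by move=> x _; rewrite measure_bigcup//; apply: eq_eseriesl => k; rewrite in_setT.
  exact: ge0_emeasurable_sum.
Qed.

End occupation_measurable.

(** * Signed measures, mixtures and the potential of a pair of points *)

Section finite_measures.
Context d (T : measurableType d) (R : realType).
Implicit Types m a b c e : {measure set T -> \bar R}.

Lemma Rintegral_norm_le m (h : T -> R) K :
  (m setT < +oo)%E -> measurable_fun setT h -> (forall x, `|h x| <= K) ->
  `|\int[m]_x h x| <= K * fine (m setT).
Proof.
move=> mf mh hK; have ih := bounded_integrable mf mh hK.
apply: le_trans (le_normr_Rintegral measurableT ih) _.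
rewrite -(Rintegral_cst _ measurableT K); apply: le_Rintegral => //; first exact: (integrable_norm ih).
by apply: (bounded_integrable mf (C := `|K|)).
Qed.

(** Reduces a bounded integrand to a nonnegative one, for which integrals are additive in the
    measure without integrability conditions. *)
Lemma Rintegral_shift m (F : T -> R) C : (m setT < +oo)%E -> measurable_fun setT F ->
  (forall x, `|F x| <= C) ->
  \int[m]_x F x = fine (\int[m]_x (F x + C)%:E)%E - C * fine (m setT).
Proof.
move=> mfin mF FC; have iF := bounded_integrable mfin mF FC.
have iC : m.-integrable setT (EFin \o cst C).
  by apply: (bounded_integrable mfin (C := `|C|)).
transitivity (\int[m]_x (F x + cst C x) - C * fine (m setT)); last by [].
by rewrite RintegralD// Rintegral_cst// addrK.
Qed.

Lemma eq_ge0_integral m1 m2 : (forall A, measurable A -> m1 A = m2 A) ->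
  forall f : T -> \bar R, (\int[m1]_x f x = \int[m2]_x f x)%E.
Proof. by move=> h f; apply: eq_measure_integral => A mA _; exact: h. Qed.

Lemma shift_fin_num m (F : T -> R) C : (m setT < +oo)%E -> measurable_fun setT F ->
  (forall x, `|F x| <= C) -> (\int[m]_x (F x + C)%:E)%E \is a fin_num.
Proof.
move=> mfin mF FC; apply: integrable_fin_num => //.
apply: (bounded_integrable mfin (C := C + C)) => [|x]; first exact: measurable_funD.
apply: le_trans (ler_normD _ _) _; rewrite lerD//.
by rewrite ger0_norm//; exact: le_trans (FC x).
Qed.

(** The equality [a - c = e - b] of signed measures, written without subtraction. *)
Lemma Rintegral_measure4 a b c e (F : T -> R) C :
  (a setT < +oo)%E -> (b setT < +oo)%E -> (c setT < +oo)%E -> (e setT < +oo)%E ->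
  (forall A, measurable A -> (a A + b A = c A + e A)%E) ->
  measurable_fun setT F -> (forall x, `|F x| <= C) ->
  \int[a]_x F x + \int[b]_x F x = \int[c]_x F x + \int[e]_x F x.
Proof.
move=> fa fb fc fe h mF FC.
rewrite (Rintegral_shift fa mF FC) (Rintegral_shift fb mF FC) (Rintegral_shift fc mF FC) (Rintegral_shift fe mF FC).
have E : (\int[a]_x (F x + C)%:E + \int[b]_x (F x + C)%:E = \int[c]_x (F x + C)%:E + \int[e]_x (F x + C)%:E)%E.
  have F0 x : (0 <= (F x + C)%:E)%E by rewrite lee_fin; have := FC x; rewrite ler_norml => /andP[]; lra.
  have mFC : measurable_fun setT (fun x => (F x + C)%:E) by apply/measurable_EFinP; exact: measurable_funD.
  by rewrite -!ge0_integral_measure_add//; apply: eq_ge0_integral => A mA; transitivity (a A + b A)%E;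
    [exact: measure_addE|rewrite h//; exact/esym/measure_addE].
have E1 : fine (\int[a]_x (F x + C)%:E)%E + fine (\int[b]_x (F x + C)%:E)%E =
    fine (\int[c]_x (F x + C)%:E)%E + fine (\int[e]_x (F x + C)%:E)%E.
  rewrite -(fineD (shift_fin_num fa mF FC) (shift_fin_num fb mF FC)).
  by rewrite -(fineD (shift_fin_num fc mF FC) (shift_fin_num fe mF FC)) E.
have E2 : fine (a setT) + fine (b setT) = fine (c setT) + fine (e setT).
  by have := congr1 fine (h setT measurableT); rewrite !fineD ?ge0_fin_numE.
have aux (x y z t x' y' z' t' : R) : x + y = z + t -> x' + y' = z' + t' ->
    x - C * x' + (y - C * y') = z - C * z' + (t - C * t').
  move=> h1 h2; have : C * (x' + y') = C * (z' + t') by rewrite h2.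
  lra.
exact: aux.
Qed.

Lemma Rintegral_measure_sum m1 m2 m (F : T -> R) C : (m1 setT < +oo)%E -> (m2 setT < +oo)%E ->
  (forall A, measurable A -> m A = (m1 A + m2 A)%E) -> measurable_fun setT F -> (forall x, `|F x| <= C) ->
  \int[m]_x F x = \int[m1]_x F x + \int[m2]_x F x.
Proof.
move=> f1 f2 hE mF FC.
have f : (m setT < +oo)%E by rewrite hE// lte_add_pinfty.
have := @Rintegral_measure4 m mzero m1 m2 F C f _ f1 f2 _ mF FC.
rewrite /mzero ltry => /(_ isT); rewrite {2}/Rintegral integral_measure_zero addr0; apply.
by move=> A mA; rewrite adde0 hE.
Qed.

Variables (m1 m2 : {measure set T -> \bar R}).
Hypotheses (f1 : (m1 setT < +oo)%E) (f2 : (m2 setT < +oo)%E).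

Lemma measure_lty (m : {measure set T -> \bar R}) A : (m setT < +oo)%E -> measurable A -> (m A < +oo)%E.
Proof. by move=> mf mA; apply: le_lt_trans mf; apply: le_measure => //; rewrite inE. Qed.

Lemma measure_fin_num (m : {measure set T -> \bar R}) A : (m setT < +oo)%E -> measurable A -> m A \is a fin_num.
Proof. by move=> mf mA; rewrite ge0_fin_numE// measure_lty. Qed.

Definition difference (A : set T) : \bar R := (m1 A - m2 A)%E.

Let difference0 : difference set0 = 0%E. Proof. by rewrite /difference !measure0 sube0. Qed.

Let difference_fin : fin_num_fun difference.
Proof.
move=> A mA; rewrite /difference fin_numB; apply/andP.
by split; [exact: measure_fin_num f1 mA|exact: measure_fin_num f2 mA].
Qed.

Let difference_sigma : semi_sigma_additive difference.
Proof.
move=> G mG tG mU; rewrite /difference.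
have s1 n : (\sum_(0 <= i < n) m1 (G i))%E \is a fin_num.
  by apply/sum_fin_numP => i _ _; exact: measure_fin_num f1 (mG i).
have s2 n : (\sum_(0 <= i < n) m2 (G i))%E \is a fin_num.
  by apply/sum_fin_numP => i _ _; exact: measure_fin_num f2 (mG i).
rewrite (_ : (fun n => _) = (fun n => (\sum_(0 <= i < n) m1 (G i) - \sum_(0 <= i < n) m2 (G i))%E)); last first.
  apply/funext; elim => [|n ih]; first by rewrite !big_nil sube0.
  rewrite !big_nat_recr//= ih oppeD ?fin_num_adde_defr//; first by rewrite addeACA.
apply: cvgeB; [|exact: measure_semi_sigma_additive|exact: measure_semi_sigma_additive].
apply: fin_num_adde_defr; exact: measure_fin_num f1 mU.
Qed.

HB.instance Definition _ := isCharge.Build _ _ _ difference difference0 difference_fin difference_sigma.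

Lemma charge_difference : exists nu : {charge set T -> \bar R}, forall A, nu A = (m1 A - m2 A)%E.
Proof. by exists difference. Qed.

Lemma jordan_lty (nu : {charge set T -> \bar R}) : (jordan_pos (hahnP nu) setT < +oo)%E /\
  (jordan_neg (hahnP nu) setT < +oo)%E.
Proof. by rewrite -!ge0_fin_numE//; split; exact: fin_num_measure. Qed.

(** Any decomposition of a charge into two finite measures computes its integral, because the Jordan
    parts satisfy [jordan_pos + m2 = m1 + jordan_neg]. *)
Lemma jordan_integral (nu : {charge set T -> \bar R}) (F : T -> R) C :
  (forall A, measurable A -> nu A = (m1 A - m2 A)%E) -> measurable_fun setT F -> (forall x, `|F x| <= C) ->
  \int[jordan_pos (hahnP nu)]_x F x - \int[jordan_neg (hahnP nu)]_x F x = \int[m1]_x F x - \int[m2]_x F x.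
Proof.
move=> nuE mF FC; have [fp fn] := jordan_lty nu.
suff : \int[jordan_pos (hahnP nu)]_x F x + \int[m2]_x F x = \int[m1]_x F x + \int[jordan_neg (hahnP nu)]_x F x.
  by move=> h; apply/eqP; rewrite subr_eq addrAC eq_sym subr_eq -h.
apply: (Rintegral_measure4 fp f2 f1 fn _ mF FC) => A mA.
have := nuE A mA; rewrite (jordan_decomp (hahnP nu) mA) /=.
rewrite /cadd /= /cscale /=.
set u := jordan_pos _ A; set v := jordan_neg _ A.
have fv : v \is a fin_num by exact: fin_num_measure.
have fu : u \is a fin_num by exact: fin_num_measure.
have f1' := measure_fin_num f1 mA; have f2' := measure_fin_num f2 mA.
move: fu fv f1' f2'; move: u v (m1 A) (m2 A) => [u| |] [v| |] [x| |] [y| |] //= _ _ _ _.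
by rewrite -!EFinM mulN1r => -[h]; rewrite -!EFinD; congr _%:E; lra.
Qed.

End finite_measures.

(** * Mixtures of a kernel *)

Section mixture.
Context d0 (T0 : measurableType d0) d (T : measurableType d) (R : realType).
Variables (D : set T0) (K : T0 -> {measure set T -> \bar R}) (Cb : R).
Hypothesis mD : measurable D.
Hypothesis mK : forall A, measurable A -> measurable_fun D (fun z => K z A).
Hypothesis Cb0 : 0 <= Cb.
Hypothesis KCb : forall z, D z -> (K z setT <= Cb%:E)%E.

Definition kernel_apply (F : T -> R) (z : T0) : R := if `[< D z >] then \int[K z]_y F y else 0.

Let J (z : T0) (f : T -> \bar R) : \bar R := if `[< D z >] then (\int[K z]_y f y)%E else 0%E.

Let Kfin z : D z -> (K z setT < +oo)%E.
Proof. by move=> Dz; apply: le_lt_trans (KCb Dz) (ltry _). Qed.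

Let J_like z : integral_like (J z).
Proof. by rewrite /J; case: asboolP => _; [exact: integral_like_integral|exact: integral_like0]. Qed.

Let J_indic A : measurable A -> measurable_fun setT (fun z => J z (fun x => (\1_A x)%:E)).
Proof.
move=> mA; rewrite (_ : (fun z => _) = (fun z => K z A) \_ D).
  by apply/(measurable_restrictT _ mD); exact: mK.
apply/funext => z; rewrite patchE /J.
have -> : (z \in D) = `[< D z >] by apply/idP/asboolP; rewrite inE.
by case: ifP => // _; rewrite integral_indic// setIT.
Qed.

Let J_measurable f : measurable_fun setT f -> (forall x, (0 <= f x)%E) -> measurable_fun setT (J^~ f).
Proof. by apply: integral_like_measurable => // z _; exact: J_like. Qed.

Section bounded.
Variables (F : T -> R) (C : R).
Hypotheses (mF : measurable_fun setT F) (FC : forall x, `|F x| <= C).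

Let FC0 x : (0 <= (F x + C)%:E)%E.
Proof. by rewrite lee_fin; have := FC x; rewrite ler_norml => /andP[]; lra. Qed.

Let mFC : measurable_fun setT (fun x => (F x + C)%:E).
Proof. by apply/measurable_EFinP; exact: measurable_funD. Qed.

Lemma kernel_apply_shift z :
  (J z (fun x => (F x + C)%:E) = (kernel_apply F z + C * kernel_apply (cst 1) z)%:E)%E.
Proof.
rewrite /J /kernel_apply; case: asboolP => [Dz|_]; last by rewrite mulr0 addr0.
rewrite (Rintegral_shift (Kfin Dz) mF FC) Rintegral_cst// mul1r subrK fineK//.
exact: (shift_fin_num (Kfin Dz) mF FC).
Qed.

Lemma kernel_apply_le z : `|kernel_apply F z| <= `|C| * Cb.
Proof.
rewrite /kernel_apply; case: asboolP => [Dz|_]; last by rewrite normr0 mulr_ge0.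
have FC' x : `|F x| <= `|C| by apply: le_trans (FC x) (ler_norm _).
apply: le_trans (Rintegral_norm_le (Kfin Dz) mF FC') _.
rewrite ler_wpM2l//; rewrite -lee_fin fineK; first exact: KCb.
by rewrite ge0_fin_numE// Kfin.
Qed.

End bounded.

Lemma kernel_apply1_measurable : measurable_fun setT (kernel_apply (cst 1)).
Proof.
rewrite (_ : kernel_apply _ = fine \o J^~ (fun x => (\1_setT x)%:E)); last first.
  apply/funext => z; rewrite /kernel_apply /J /=; case: asboolP => // _.
  by rewrite /Rintegral; congr fine; apply: eq_integral => x _; rewrite indicT.
by apply: measurableT_comp => //; exact: J_indic.
Qed.

Lemma kernel_apply_measurable (F : T -> R) C : measurable_fun setT F -> (forall x, `|F x| <= C) ->
  measurable_fun setT (kernel_apply F).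
Proof.
move=> mF FC.
rewrite (_ : kernel_apply F = (fun z => fine (J z (fun x => (F x + C)%:E)) - C * kernel_apply (cst 1) z)); last first.
  by apply/funext => z; rewrite (kernel_apply_shift mF FC)/= addrK.
apply: measurable_funB; last by apply: measurable_funM => //; exact: kernel_apply1_measurable.
apply: measurableT_comp => //; apply: J_measurable.
  by apply/measurable_EFinP; exact: measurable_funD.
by move=> x; rewrite lee_fin; have := FC x; rewrite ler_norml => /andP[]; lra.
Qed.

Variable rho : {measure set T0 -> \bar R}.
Hypothesis rho_fin : (rho setT < +oo)%E.

(** Integrating the kernel against [rho] is an integral-like functional, hence a measure. The kernel
    counts as 0 off [D], where nothing is known of it; the uniform mass bound makes the result
    finite. *)
Lemma mixture : exists m : {measure set T -> \bar R}, [/\ (m setT < +oo)%E,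
  forall A, measurable A -> (forall z, D z -> K z A = 0%E) -> m A = 0%E &
  forall (F : T -> R) C, measurable_fun setT F -> (forall x, `|F x| <= C) ->
    \int[m]_x F x = \int[rho]_z kernel_apply F z].
Proof.
have IL : integral_like (fun f => \int[rho]_z ((cst (1 : R) z)%:E * J z f))%E.
  by apply: integral_like_mix => // A mA; exact: J_indic.
have [m hm] := integral_like_measure IL.
have m1 (A : set T) : measurable A -> m A = (\int[rho]_z J z (fun x => (\1_A x)%:E))%E.
  move=> mA; transitivity (\int[m]_x (\1_A x)%:E)%E; first by rewrite integral_indic// setIT.
  rewrite hm//; first by apply: eq_integral => z _; rewrite mul1e.
  by apply/measurable_EFinP; exact: measurable_indic.
have b1 x : `|cst (1 : R) x| <= 1 by rewrite normr1.
have ib (F : T0 -> R) C : measurable_fun setT F -> (forall x, `|F x| <= C) -> rho.-integrable setT (EFin \o F).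
  by move=> mF FC; exact: (bounded_integrable rho_fin mF FC).
have i1 : rho.-integrable setT (EFin \o kernel_apply (cst 1)).
  apply: (ib _ (`|1| * Cb)); first exact: kernel_apply1_measurable.
  by move=> z; apply: kernel_apply_le.
have J1 z : J z (fun x => (\1_setT x)%:E) = (kernel_apply (cst 1) z)%:E.
  rewrite /J /kernel_apply; case: asboolP => // Dz; rewrite Rintegral_cst// mul1r.
  by rewrite integral_indic// setIT fineK// ge0_fin_numE// Kfin.
have mT : m setT = (\int[rho]_z kernel_apply (cst 1) z)%:E.
  rewrite m1//; under eq_integral do rewrite J1.
  by rewrite /Rintegral fineK//; exact: integrable_fin_num.
have mfin : (m setT < +oo)%E by rewrite mT ltry.
exists m; split => //.
- move=> A mA h; rewrite m1//; rewrite (_ : (fun z => _) = cst 0%E) ?integral0//.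
  apply/funext => z; rewrite /J; case: asboolP => // Dz.
  by rewrite integral_indic// setIT h.
- move=> F C mF FC; rewrite (Rintegral_shift mfin mF FC) hm; last 2 first.
  + by apply/measurable_EFinP; exact: measurable_funD.
  + by move=> x; rewrite lee_fin; have := FC x; rewrite ler_norml => /andP[]; lra.
  under eq_integral do rewrite mul1e (kernel_apply_shift mF FC).
  have iF : rho.-integrable setT (EFin \o kernel_apply F).
    apply: (ib _ (`|C| * Cb)); first exact: (kernel_apply_measurable mF FC).
    by move=> z; apply: kernel_apply_le.
  transitivity (\int[rho]_z (kernel_apply F z + C * kernel_apply (cst 1) z) - C * fine (m setT)); first by [].
  rewrite RintegralD//; last exact: integrable_Zl.
  by rewrite RintegralZl// mT /= addrK.
Qed.

End mixture.

Section potential.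
Context d (T : measurableType d) (R : realType).

Lemma integral_one (m : {measure set T -> \bar R}) : (\int[m]_x (1 : R)%:E = m setT)%E.
Proof. by transitivity (1%:E * m setT)%E; [exact: integral_cst|rewrite mul1e]. Qed.

Lemma mseries_Rintegral (m : nat -> {measure set T -> \bar R}) (F : T -> R) C :
  (mseries m 0 setT < +oo)%E -> measurable_fun setT F -> (forall x, `|F x| <= C) ->
  \sum_(0 <= k < n) \int[m k]_x F x @[n --> \oo] --> \int[mseries m 0]_x F x.
Proof.
move=> mfin mF FC.
have kfin k : (m k setT < +oo)%E.
  apply: le_lt_trans mfin; rewrite /mseries.
  apply: le_trans (nneseries_lim_ge k.+1 _); last by move=> *; exact: measure_ge0.
  by rewrite big_nat_recr//= leeDr// sume_ge0// => *; exact: measure_ge0.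
have shift_cvg (f : T -> R) (K : R) : measurable_fun setT f -> (forall x, `|f x| <= K) -> (forall x, 0 <= f x) ->
    \sum_(0 <= k < n) fine (\int[m k]_x (f x)%:E)%E @[n --> \oo] --> fine (\int[mseries m 0]_x (f x)%:E)%E.
  move=> mf fK f0; have mfE : measurable_fun setT (EFin \o f) by exact/measurable_EFinP.
  have fin k : (\int[m k]_x (f x)%:E)%E \is a fin_num.
    by apply: integrable_fin_num => //; exact: (bounded_integrable (kfin k) mf fK).
  have h : (\sum_(0 <= k < n) (\int[m k]_x (f x)%:E))%E @[n --> \oo] --> (\int[mseries m 0]_x (f x)%:E)%E.
    rewrite ge0_integral_measure_series//; last by move=> x _; rewrite lee_fin.
    by apply: is_cvg_nneseries => k _ _; apply: integral_ge0 => x _; rewrite lee_fin.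
  rewrite (_ : (fun n => _) = fine \o (fun n => (\sum_(0 <= k < n) (\int[m k]_x (f x)%:E))%E)).
    apply: fine_cvg; rewrite fineK//.
    by apply: integrable_fin_num => //; exact: (bounded_integrable mfin mf fK).
  by apply/funext => n /=; rewrite sum_fine// => k _; exact: fin.
have FC0 x : 0 <= F x + C by have := FC x; rewrite ler_norml => /andP[]; lra.
have FCC x : `|F x + C| <= C + C.
  by rewrite ger0_norm// lerD2r; exact: le_trans (ler_norm _) (FC x).
have c1 := shift_cvg (fun x => F x + C) _ (measurable_funD mF (measurable_cst C)) FCC FC0.
have n1 (x : T) : `|cst (1 : R) x| <= 1 by rewrite normr1.
have c2 := shift_cvg (cst 1) 1 (measurable_cst _) n1 (fun=> ler01).
rewrite (Rintegral_shift mfin mF FC).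
rewrite (_ : (fun n => _) = (fun n => \sum_(0 <= k < n) fine (\int[m k]_x (F x + C)%:E)%E -
   C * \sum_(0 <= k < n) fine (\int[m k]_x (1%:E))%E)).
  apply: cvgB => //.
  have E : (\int[mseries m 0]_x (cst (1 : R) x)%:E = (mseries m 0 : {measure set T -> \bar R}) setT)%E.
    exact: integral_one.
  by rewrite -E; apply: cvgMr; exact: c2.
apply/funext => n; rewrite mulr_sumr -sumrB; apply: eq_bigr => k _.
by rewrite (Rintegral_shift (kfin k) mF FC) integral_one.
Qed.

Lemma geometric_mseries (m : nat -> {measure set T -> \bar R}) (c r : R) : 0 <= c -> 0 <= r -> r < 1 ->
  (forall k, (m k setT <= (c * r ^+ k)%:E)%E) -> (mseries m 0 setT < +oo)%E.
Proof.
move=> c0 r0 r1 h; apply: (@le_lt_trans _ _ (c / (1 - r))%:E); last exact: ltry.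
apply: lime_le; first by apply: is_cvg_nneseries => *; exact: measure_ge0.
apply: nearW => n; apply: (@le_trans _ _ (\sum_(0 <= k < n) (c * r ^+ k)%:E)%E).
  by apply: lee_sum => k _; exact: h.
rewrite sumEFin lee_fin; have := @geometric_seriesE R c r; rewrite lt_eqF// => /(_ isT) /(congr1 (fun f => f n)).
rewrite /series /geometric /= => ->.
have r1' : 0 < 1 - r by rewrite subr_gt0.
rewrite ler_pM2r ?invr_gt0//; rewrite ler_piMr// lerBlDr lerDl; exact: exprn_ge0.
Qed.

Variables (a b : nat -> {measure set T -> \bar R}) (pi0 : {measure set T -> \bar R}).
Variables (nua nub : nat -> {charge set T -> \bar R}) (c r : R).
Hypothesis afin : forall k, (a k setT < +oo)%E.
Hypothesis bfin : forall k, (b k setT < +oo)%E.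
Hypothesis pfin : (pi0 setT < +oo)%E.
Hypothesis nuaE : forall k A, measurable A -> nua k A = (a k A - pi0 A)%E.
Hypothesis nubE : forall k A, measurable A -> nub k A = (b k A - pi0 A)%E.
Hypotheses (c0 : 0 <= c) (r0 : 0 <= r) (r1 : r < 1).
Hypothesis nua_le : forall k, (tv_norm (nua k) <= (c * r ^+ k)%:E)%E.
Hypothesis nub_le : forall k, (tv_norm (nub k) <= (c * r ^+ k)%:E)%E.

(** [a k - b k] is the difference of the two deviations from [pi0]. Regrouping their Jordan parts by
    sign gives two series of measures with masses at most [2 c r^k]. *)
Lemma potential : exists rp rn : {measure set T -> \bar R}, [/\ (rp setT < +oo)%E, (rn setT < +oo)%E &
  forall (F : T -> R) C, measurable_fun setT F -> (forall x, `|F x| <= C) ->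
    \sum_(0 <= k < n) (\int[a k]_x F x - \int[b k]_x F x) @[n --> \oo] --> \int[rp]_x F x - \int[rn]_x F x].
Proof.
pose jp nu : {measure set T -> \bar R} := jordan_pos (hahnP nu).
pose jn nu : {measure set T -> \bar R} := jordan_neg (hahnP nu).
pose mp k : {measure set T -> \bar R} := measure_add (jp (nua k)) (jn (nub k)).
pose mn k : {measure set T -> \bar R} := measure_add (jn (nua k)) (jp (nub k)).
have mpE k A : mp k A = (jp (nua k) A + jn (nub k) A)%E by exact: measure_addE.
have mnE k A : mn k A = (jn (nua k) A + jp (nub k) A)%E by exact: measure_addE.
have tvE nu : tv_norm nu = (jp nu setT + jn nu setT)%E by [].
have two k : ((c + c) * r ^+ k)%:E = ((c * r ^+ k)%:E + (c * r ^+ k)%:E)%E by rewrite -EFinD mulrDl.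
have fp : (mseries mp 0 setT < +oo)%E.
  apply: (geometric_mseries (c := c + c) (r := r)) => // [|k]; first exact: addr_ge0.
  rewrite mpE two leeD//; [apply: le_trans (nua_le k)|apply: le_trans (nub_le k)]; rewrite tvE.
    by rewrite leeDl//; exact: measure_ge0.
  by rewrite leeDr//; exact: measure_ge0.
have fn : (mseries mn 0 setT < +oo)%E.
  apply: (geometric_mseries (c := c + c) (r := r)) => // [|k]; first exact: addr_ge0.
  rewrite mnE two leeD//; [apply: le_trans (nua_le k)|apply: le_trans (nub_le k)]; rewrite tvE.
    by rewrite leeDr//; exact: measure_ge0.
  by rewrite leeDl//; exact: measure_ge0.
exists (mseries mp 0), (mseries mn 0); split => // F C mF FC.
rewrite (_ : (fun n => _) = (fun n => \sum_(0 <= k < n) \int[mp k]_x F x - \sum_(0 <= k < n) \int[mn k]_x F x)).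
  by apply: cvgB; exact: mseries_Rintegral FC.
apply/funext => n; rewrite -sumrB; apply: eq_bigr => k _.
have [jpa jna] := jordan_lty (nua k); have [jpb jnb] := jordan_lty (nub k).
have Ea := jordan_integral (afin k) pfin (@nuaE k) mF FC.
have Eb := jordan_integral (bfin k) pfin (@nubE k) mF FC.
rewrite (Rintegral_measure_sum jpa jnb (fun A _ => mpE k A) mF FC).
rewrite (Rintegral_measure_sum jna jpb (fun A _ => mnE k A) mF FC) /jp /jn.
lra.
Qed.

End potential.

(** * The uniform law on a segment *)

Section segment.
Context {R : realType} {d : nat}.

(** The Hessian oscillates by at most [2 C], so Taylor's formula costs [4 C], and dropping the
    quadratic term costs another [C]. *)
Lemma first_order (f : 'cV[R]_d -> R) Df Hf C (x y : 'cV[R]_d) : test_data f Df Hf C ->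
  orthant x -> orthant y ->
  `|f y - f x - \sum_j Df j x * (y - x) j 0| <= 5 * C * (\sum_j `|(y - x) j 0|) ^+ 2.
Proof.
move=> [df ddf Dc Hc DE HE fc C0 fC DC HC] x0 y0.
have yx : `|y - x| < `|y - x| + 1 by rewrite ltrDl.
have := @taylor_orthant _ _ f Df Hf df ddf Dc Hc DE HE fc x y (C + C) _ x0 y0 yx.
have he : forall p, `|p - x| <= `|y - x| + 1 -> forall j k, `|Hf j k p - Hf j k x| <= C + C.
  by move=> p _ j k; apply: le_trans (ler_normB _ _) _; rewrite lerD.
move=> /(_ he) h1.
set s := \sum_j `|(y - x) j 0| in h1 *.
have h2 : `|2^-1 * \sum_j \sum_k Hf j k x * ((y - x) j 0 * (y - x) k 0)| <= C * s ^+ 2.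
  apply: (@le_trans _ _ (\sum_j \sum_k C * (`|(y - x) j 0| * `|(y - x) k 0|))).
    rewrite normrM gtr0_norm ?invr_gt0//.
    rewrite (@le_trans _ _ (1 * `|\sum_j \sum_k Hf j k x * ((y - x) j 0 * (y - x) k 0)|))//.
      by rewrite ler_wpM2r// invf_le1// ler1n.
    rewrite mul1r; apply: le_trans (ler_norm_sum _ _ _) _; apply: ler_sum => j _.
    apply: le_trans (ler_norm_sum _ _ _) _; apply: ler_sum => k _.
    by rewrite !normrM ler_wpM2r// mulr_ge0.
  rewrite /s expr2 mulr_suml mulr_sumr; apply: ler_sum => j _.
  by rewrite !mulr_sumr.
rewrite (_ : f y - _ - _ = (f y - f x - taylor2 Df Hf x (y - x)) +
   2^-1 * \sum_j \sum_k Hf j k x * ((y - x) j 0 * (y - x) k 0)).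
  by apply: le_trans (ler_normD _ _) _; lra.
by rewrite /taylor2; ring.
Qed.

Variables (p w : 'cV[R]_d).
Hypotheses (p0 : orthant p) (pw0 : orthant (p + w)).

Let gam (u : R) : 'cV[R]_d := p + u *: w.

Let gam_cont : continuous gam.
Proof.
move=> u; apply: (@cvgD _ _ _ (nbhs u)); first exact: cvg_cst.
by apply: cvgZl; exact: cvg_id.
Qed.

Let gam_orthant u : 0 <= u <= 1 -> orthant (gam u).
Proof.
move=> /andP[u0 u1] i; have := p0 i; have := pw0 i; rewrite !mxE => h1 h2.
have -> : p i 0 + u * w i 0 = (1 - u) * p i 0 + u * (p i 0 + w i 0) by ring.
by rewrite addr_ge0// mulr_ge0// subr_ge0.
Qed.

(** The segment may lie in the boundary, where the partial derivatives of [f] need not exist.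
    [first_order], valid up to the boundary, shows that [f] is differentiable along the segment with
    derivative [D]. *)
Lemma segment_ftc f Df Hf C : test_data f Df Hf C ->
  \int[lebesgue_measure]_(u in `[0, 1]) (\sum_j w j 0 * Df j (gam u)) = f (p + w) - f p.
Proof.
move=> td; have [_ _ Dc _ _ _ fc C0 _ _ _] := td.
pose D u := \sum_j w j 0 * Df j (gam u).
have Dcont : continuous D.
  apply: continuous_sum => j u; apply: (@cvgM _ _ (nbhs u)); first exact: cvg_cst.
  apply: (@continuous_comp _ _ _ gam (Df j)); [exact: gam_cont|exact: Dc].
pose phi u := f (pos_part (gam u)).
have phiE u : 0 <= u <= 1 -> phi u = f (gam u) by move=> u01; rewrite /phi pos_part_id//; exact: gam_orthant.
have phic : continuous phi.
  move=> u; apply: (@continuous_comp _ _ _ gam (f \o pos_part)); first exact: gam_cont.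
  exact: (continuous_pos_part fc).
pose K := 5 * C * (\sum_j `|w j 0|) ^+ 2.
have K0 : 0 <= K by rewrite /K mulr_ge0 ?sqr_ge0// mulr_ge0// ltW.
have bnd u v : 0 <= u <= 1 -> 0 <= v <= 1 -> `|phi v - phi u - (v - u) * D u| <= K * (v - u) ^+ 2.
  move=> u01 v01; have := first_order td (gam_orthant u01) (gam_orthant v01).
  have E : gam v - gam u = (v - u) *: w.
    by rewrite /gam opprD addrACA subrr add0r scalerBl.
  rewrite E !phiE// /K.
  rewrite (_ : \sum_j Df j (gam u) * ((v - u) *: w) j 0 = (v - u) * D u); last first.
    by rewrite /D mulr_sumr; apply: eq_bigr => j _; rewrite mxE; ring.
  rewrite (_ : \sum_j `|((v - u) *: w) j 0| = `|v - u| * \sum_j `|w j 0|); last first.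
    by rewrite mulr_sumr; apply: eq_bigr => j _; rewrite mxE normrM.
  by rewrite exprMn real_normK ?num_real// => h; apply: le_trans h _; rewrite [leRHS]mulrAC mulrA.
have dphi (u : R) : u \in `]0, 1[ -> is_derive u 1 phi (D u).
  rewrite in_itv /= => /andP[u0 u1].
  have lim : h^-1 *: ((phi \o shift u) (h *: (1 : R)) - phi u) @[h --> 0^'] --> D u.
    apply/cvgrPdist_le => e e0.
    (* The first two radii keep [u + h] in [[0, 1]], the third makes [K |h|] at most [e]; [K + 1]
       avoids division by 0. *)
    have rr0 : 0 < Num.min (Num.min u (1 - u)) (e / (K + 1)).
      by rewrite !lt_min u0 subr_gt0 u1 divr_gt0// ltr_pwDr.
    near=> h.
    have hn0 : h != 0 by near: h; exact: nbhs_dnbhs_neq.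
    have hr : `|h| < Num.min (Num.min u (1 - u)) (e / (K + 1)).
      near: h; apply: dnbhs0_lt; exact: rr0.
    move: hr; rewrite !lt_min => /andP[/andP[h1 h2] h3].
    have hu : 0 <= h + u <= 1.
      by move: h1 h2; rewrite !ltr_norml => /andP[? ?] /andP[? ?]; apply/andP; split; lra.
    have u01 : 0 <= u <= 1 by rewrite (ltW u0) (ltW u1).
    have := bnd u (h + u) u01 hu; rewrite addrK => hb.
    rewrite /= [h *: 1]mulr1 /shift /= .
    have -> : D u - h^-1 *: (phi (h + u) - phi u) = - h^-1 * (phi (h + u) - phi u - h * D u).
      by rewrite /GRing.scale /=; field.
    rewrite normrM normrN normfV.
    apply: (@le_trans _ _ (`|h|^-1 * (K * h ^+ 2))); first by rewrite ler_wpM2l// invr_ge0.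
    rewrite -(real_normK (num_real h)).
    have nh : `|h| != 0 by rewrite normr_eq0.
    have -> : `|h|^-1 * (K * `|h| ^+ 2) = K * `|h| by field.
    have h4 : (K + 1) * `|h| <= e by rewrite mulrC -ler_pdivlMr ?ltr_pwDr// ltW.
    have : 0 <= `|h| by [].
    lra.
  by apply: DeriveDef; [apply/cvg_ex; exists (D u)|apply: cvg_lim].
have ph1 : f (p + w) = phi 1 by rewrite phiE ?lexx ?ler01// /gam scale1r.
have ph0 : f p = phi 0 by rewrite phiE ?lexx ?ler01// /gam scale0r addr0.
rewrite ph1 ph0 /Rintegral.
have -> : (\int[lebesgue_measure]_(u in `[0%R, 1%R]) (\sum_j w j 0 * Df j (gam u))%:E = (phi 1)%:E - (phi 0)%:E)%E.
  apply: (continuous_FTC2 ltr01).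
  - exact: continuous_subspaceT Dcont.
  - split.
    + by move=> u u01; have [] := dphi u u01.
    + by apply: cvg_at_right_filter; exact: phic.
    + by apply: cvg_at_left_filter; exact: phic.
  - by move=> u u01; rewrite derive1E; have [_ ->] := dphi u u01.
by [].
Unshelve. all: by end_near. Qed.

Lemma segment_measure : exists lam : {measure set (borel R d) -> \bar R}, [/\ (lam setT < +oo)%E,
  forall A : set (borel R d), measurable A -> (forall u, 0 <= u <= 1 -> ~ A (p + u *: w)) -> lam A = 0%E &
  forall f Df Hf C, test_data f Df Hf C -> f (p + w) - f p = \sum_j w j 0 * \int[lam]_x Df j x].
Proof.
have mI : measurable (`[0, 1]%classic : set R) by exact: measurable_itv.
have mgam : measurable_fun [set: R] (gam : R -> borel R d).
  apply: measurable_to_borel => U oU; apply: open_measurable.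
  by move/continuousP : gam_cont; apply.
pose lam : {measure set (borel R d) -> \bar R} := image_measure (mrestr lebesgue_measure mI) mgam.
have lamE A : lam A = lebesgue_measure (gam @^-1` A `&` `[0, 1]%classic) by [].
exists lam; split.
- rewrite lamE preimage_setT setTI lebesgue_measure_itv /= lte_fin ltr01 /=.
  by rewrite -EFinB ltry.
- move=> A mA hA; rewrite lamE (_ : _ `&` _ = set0) ?measure0//.
  apply/seteqP; split => // u [/= Au]; rewrite in_itv /= => u01.
  exact: (hA u u01 Au).
- move=> f Df Hf C td; rewrite -(segment_ftc td).
  have [_ _ Dc _ _ _ _ C0 _ DC _] := td.
  have tr (q : 'cV[R]_d -> R) : continuous q -> (forall x, `|q x| <= C) ->
      lebesgue_measure.-integrable `[0, 1]%classic (EFin \o (fun u => q (gam u))) /\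
      \int[lam]_x q x = \int[lebesgue_measure]_(u in `[0, 1]) q (gam u).
    move=> qc qC; have mq := borel_continuous qc.
    have mqg : measurable_fun [set: R] (fun u => q (gam u)) by exact: (measurableT_comp mq mgam).
    have Ifin : (lebesgue_measure (`[0%R, 1%R]%classic : set R) < +oo)%E.
      by rewrite lebesgue_measure_itv /= lte_fin ltr01 /= -EFinB ltry.
    have iq : lebesgue_measure.-integrable `[0, 1]%classic (EFin \o (fun u => q (gam u))).
      apply: measurable_bounded_integrable => //; first exact: measurable_funTS.
      by exists C; split; [exact: num_real|move=> M CM x _ /=; rewrite (le_trans (qC _))// ltW].
    split => //.
    have mi : measurable_fun setT (\1_(`[0, 1]%classic) : R -> R) by exact: measurable_indic.
    have E0 (g : R -> R) : (fun u : R => (g u * \1_(`[0, 1]%classic) u)%:E) = ((EFin \o g) \_ `[0, 1]).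
      apply/funext => u; rewrite patchE indicE; case: ifP => _; rewrite ?mulr1 ?mulr0//.
    have iq1 : lebesgue_measure.-integrable setT (EFin \o (fun u => q (gam u) * \1_(`[0, 1]%classic) u)).
      have : lebesgue_measure.-integrable setT ((EFin \o (fun u => q (gam u))) \_ `[0, 1]).
        have X := (@integrable_mkcond _ _ R lebesgue_measure _ (EFin \o (fun u => q (gam u))) mI).1.
        apply: X; exact: iq.
      have E1 : EFin \o (fun u => q (gam u) * \1_(`[0, 1]%classic) u) = (EFin \o (fun u => q (gam u))) \_ `[0, 1].
        exact: (E0 (fun u => q (gam u))).
      by rewrite -E1.
    have [|||||_ E] := @Rintegral_transfer _ _ _ _ _ _ R lam lebesgue_measure id gam (cst 1)
        \1_(`[0, 1]%classic) _ mgam _ mi _ _ _ q mq iq1 => //.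
      move=> B mB; under eq_integral do rewrite mule1.
      rewrite integral_indic// setIT.
      have mPB : measurable (gam @^-1` B) by rewrite -[X in measurable X]setTI; exact: (mgam measurableT).
      transitivity (\int[lebesgue_measure]_u (\1_(gam @^-1` B `&` `[0, 1]%classic) u)%:E)%E.
        by rewrite integral_indic ?setIT//; exact: measurableI.
      apply: eq_integral => u _; rewrite -EFinM !indicE in_setI.
      have -> : (u \in gam @^-1` B) = (gam u \in B) by apply/idP/idP; rewrite !inE.
      by case: (_ \in B); case: (_ \in `[0, 1]%classic); rewrite ?mulr1 ?mulr0.
    transitivity (\int[lam]_x (q x * cst 1 x)); first by apply: eq_Rintegral => x _; rewrite mulr1.
    rewrite E /Rintegral; congr fine; rewrite [RHS]integral_mkcond; congr (integral _ _ _).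
    exact: (E0 (fun u => q (gam u))).
  rewrite (_ : \int[lebesgue_measure]_(u in `[0, 1]) _ = \sum_j \int[lebesgue_measure]_(u in `[0, 1]) (w j 0 * Df j (gam u))).
    apply: eq_bigr => j _; have [ij ->] := tr _ (Dc j) (DC j).
    by rewrite RintegralZl.
  have iw j : lebesgue_measure.-integrable `[0, 1]%classic (fun u => (w j 0 * Df j (gam u))%:E).
    by have [ij _] := tr _ (Dc j) (DC j); exact: (@integrableZl _ _ R lebesgue_measure _ mI (w j 0) (EFin \o (fun u => Df j (gam u))) ij).
  rewrite /Rintegral sum_fine; last by move=> j _; apply: integrable_fin_num => //; exact: iw.
  by congr fine; under eq_integral do rewrite -sumEFin; rewrite integral_sum.
Qed.

End segment.

(** Take a kernel vector of the singular submatrix, found through the transpose as [kermx] is a left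
    kernel, and extend it by 0. The image under [Rmat] is nonzero because [Rmat] is invertible. *)
Lemma singular_direction (R : realType) d (Rmat : 'M[R]_d) (A : {set 'I_d}) :
  Rmat \in unitmx -> principal_submx Rmat A \notin unitmx ->
  exists v : 'cV[R]_d, [/\ Rmat *m v != 0, forall i, i \notin A -> v i 0 = 0 &
    forall i, i \in A -> (Rmat *m v) i 0 = 0].
Proof.
move=> hR; rewrite -unitmx_tr -row_free_unit -kermx_eq0 => /rowV0Pn[r /sub_kermxP rM r0].
have uM : principal_submx Rmat A *m r^T = 0 by rewrite -[LHS]trmxK trmx_mul trmxK rM trmx0.
(* Extension of [r] by 0: since [enum_val] is injective, the sum has at most one term, and none when
   [i] is not in [A]. *)
pose v : 'cV[R]_d := \col_i \sum_(a | enum_val a == i) r 0 a.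
have vE a : v (enum_val a) 0 = r 0 a.
  rewrite mxE (bigD1 a)//= big1 ?addr0// => b /andP[/eqP /enum_val_inj ->].
  by rewrite eqxx.
exists v; split.
- apply: contra r0 => /eqP Rv; have v0 : v = 0 by rewrite -[v]mul1mx -(mulVmx hR) -mulmxA Rv mulmx0.
  by apply/eqP/rowP => a; rewrite -vE v0 !mxE.
- move=> i iA; rewrite mxE big1// => a /eqP ai; move: iA; rewrite -ai; move: (enum_valP a) => ->.
  by [].
- move=> i iA; rewrite !mxE.
  have -> : \sum_j Rmat i j * v j 0 = \sum_a Rmat i (enum_val a) * r 0 a.
    rewrite (eq_bigr (fun j => \sum_(a : 'I_#|A| | enum_val a == j) Rmat i j * r 0 a)); last first.
      by move=> j _; rewrite mxE mulr_sumr.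
    rewrite (exchange_big_dep xpredT)//=; apply: eq_bigr => a _.
    by rewrite (eq_bigl (pred1 (enum_val a))) ?big_pred1_eq// => k; rewrite /= eq_sym.
  have : (principal_submx Rmat A *m r^T) (enum_rank_in iA i) 0 = 0 by rewrite uM mxE.
  rewrite mxE => h; rewrite -[RHS]h.
  apply: eq_bigr => a _.
  by rewrite /principal_submx !mxE enum_rankK_in.
Qed.

(** * The signed tuple *)

Section semigroup.
Context {R : realType} {d : nat} {dO} {Omega : measurableType dO}.
Variables (F : R -> set (set Omega)) (P : borel R d -> probability Omega R).
Variables (Z : R -> {mfun Omega >-> borel R d}).
Hypothesis hF : filtration F.
Hypothesis aZ : adapted F (fun t => Z t : Omega -> borel R d).
Hypothesis oZ : forall t w, 0 <= t -> orthant (Z t w).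
Hypothesis hM : strong_markov F P Z.
Hypothesis hZ0 : forall x, orthant x -> {ae P x, forall w, Z 0 w = x}.

Local Notation S t h x := (\int[P x]_w h (Z t w)).

Let mZ t : measurable_fun setT (Z t : Omega -> borel R d).
Proof. exact: measurable_funPT. Qed.

Lemma semigroupE t (h : 'cV[R]_d -> R) x : semigroup P Z t h x = S t h x.
Proof. by rewrite /semigroup unlock. Qed.

Section bounded.
Variables (h : borel R d -> R) (C : R).
Hypotheses (mh : measurable_fun setT h) (hC : forall x, `|h x| <= C).

Lemma semigroup_integrable x t : (P x).-integrable setT (EFin \o (fun w => h (Z t w))).
Proof.
by apply: (bounded_integrable _ _ (C := C)) => //; [exact: probability_lty|exact: measurableT_comp].
Qed.

Lemma semigroup_le x t : `|S t h x| <= C.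
Proof.
have mhZ : measurable_fun setT (fun w => h (Z t w)) by exact: measurableT_comp.
apply: le_trans (Rintegral_norm_le (probability_lty (P x)) mhZ (fun=> hC _)) _.
by rewrite -[leRHS]mulr1 -[X in _ <= _ * X](congr1 fine (probability_setT (P x))).
Qed.

Lemma semigroup0 x : orthant x -> S 0 h x = h x.
Proof.
move=> x0; have [G [mG PG hG]] := ae_full_set (hZ0 x0).
transitivity (\int[P x]_w (h x * 1)); last by rewrite RintegralZl ?Rintegral1 ?mulr1//; exact: finite_measure_integrable_cst.
apply: (eq_Rintegral_null mG PG) => //; first exact: measurableT_comp.
by move=> w Gw; rewrite hG// mulr1.
Qed.

Let h0 z : (0 <= (h z + C)%:E)%E.
Proof. by rewrite lee_fin; have := hC z; rewrite ler_norml => /andP[]; lra. Qed.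

Let mhC : measurable_fun setT (fun z => (h z + C)%:E).
Proof. by apply/measurable_EFinP; exact: measurable_funD. Qed.

Let kernel_shift u z : orthant z -> kernel_integral P Z u (fun z => (h z + C)%:E) z = (S u h z + C)%:E.
Proof.
move=> z0; rewrite (@kernel_integralE _ _ _ _ P Z u _ z z0 mhC h0).
transitivity (\int[P z]_w (h (Z u w) + C * 1))%:E.
  rewrite /Rintegral fineK; last first.
    apply: integrable_fin_num => //; apply: (@integrableD _ _ _ _ _ measurableT (EFin \o _) (EFin \o (fun=> C * 1))).
      exact: semigroup_integrable.
    exact: finite_measure_integrable_cst.
  by apply: eq_integral => w _; rewrite mulr1.
rewrite RintegralD//; [|exact: semigroup_integrable|exact: finite_measure_integrable_cst].
by rewrite RintegralZl ?Rintegral1 ?mulr1//; exact: finite_measure_integrable_cst.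
Qed.

(** The kernel handles nonnegative integrands and is extended by 0 off the orthant, so the shift by
    [C] is undone on the orthant only. *)
Lemma semigroup_measurable u : 0 <= u ->
  measurable_fun setT (fun z : borel R d => if `[< @orthant R d z >] then S u h z else 0).
Proof.
move=> u0; have m1 := kernel_integral_measurable hM u0 mhC h0.
have m2 : measurable_fun setT (\1_(orthant : set (borel R d)) : borel R d -> R).
  by apply: measurable_indic; exact: measurable_orthant.
rewrite (_ : (fun z => _) = (fun z => fine (kernel_integral P Z u (fun z => (h z + C)%:E) z) - C * \1_(orthant : set (borel R d)) z)).
  by apply: measurable_funB; [exact: measurableT_comp|exact: measurable_funM].
apply/funext => z; rewrite indicE; have -> : (z \in (orthant : set (borel R d))) = `[< @orthant R d z >].
  by apply/idP/asboolP; rewrite inE.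
case: asboolP => z0; first by rewrite kernel_shift//= mulr1 addrK.
by rewrite /kernel_integral; case: asboolP => //; rewrite mulr0 subr0.
Qed.

(** [two_time] with the weight 1, applied to the nonnegative function [h + C]. *)
Lemma chapman_kolmogorov x s u : orthant x -> 0 <= s -> 0 <= u ->
  \int[P x]_w (if `[< @orthant R d (Z s w) >] then S u h (Z s w) else 0) = S (s + u) h x.
Proof.
move=> x0 s0 u0.
have mc1 : measurable_fun setT (cst 1 : borel R d -> R) by exact: measurable_cst.
have E := two_time hF aZ oZ hM x0 s0 u0 mc1 (fun=> ler01) mhC h0.
pose sg (w : Omega) : R := if `[< @orthant R d (Z s w) >] then S u h (Z s w) else 0.
have := congr1 fine E.
have msg : measurable_fun setT sg by exact: (measurableT_comp (semigroup_measurable u0) (mZ s)).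
have isg : (P x).-integrable setT (EFin \o sg).
  apply: (bounded_integrable _ msg (C := C)); first exact: probability_lty.
  move=> w; rewrite /sg; case: asboolP => _; first exact: semigroup_le.
  by rewrite normr0; exact: le_trans (hC (0 : 'cV[R]_d)).
have i1 : (P x).-integrable setT (EFin \o (fun=> C * 1)) by exact: finite_measure_integrable_cst.
have -> : fine (\int[P x]_w ((cst 1 (Z s w))%:E * (h (Z (s + u) w) + C)%:E))%E = S (s + u) h x + C.
  transitivity (\int[P x]_w (h (Z (s + u) w) + C * 1)).
    by rewrite /Rintegral; congr fine; apply: eq_integral => w _; rewrite mul1e mulr1.
  rewrite RintegralD//; last exact: semigroup_integrable.
  by rewrite RintegralZl ?Rintegral1 ?mulr1//; exact: finite_measure_integrable_cst.
have -> : fine (\int[P x]_w ((cst 1 (Z s w))%:E * kernel_integral P Z u (fun z => (h z + C)%:E) (Z s w)))%E = \int[P x]_w sg w + C.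
  transitivity (\int[P x]_w (sg w + C * 1)).
    rewrite /Rintegral; congr fine; apply: eq_integral => w _; rewrite mul1e mulr1.
    by rewrite kernel_shift; [rewrite /sg; case: asboolP => // n; exfalso; apply: n|]; exact: oZ.
  rewrite RintegralD//.
  by rewrite RintegralZl ?Rintegral1 ?mulr1//; exact: finite_measure_integrable_cst.
by move=> /addIr ->.
Qed.

End bounded.

End semigroup.

Section construction.
Context {R : realType} {d : nat} {dO} {Omega : measurableType dO}.
Variables (F : R -> set (set Omega)) (P : borel R d -> probability Omega R).
Variables (Z : R -> {mfun Omega >-> borel R d}) (W Y : R -> Omega -> borel R d).
Variables (mu : 'cV[R]_d) (Sigma Rmat : 'M[R]_d).
Hypothesis hSRBM : is_SRBM F P Z mu Sigma Rmat W Y.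
Hypothesis hY : forall i : 'I_d,
      (ereal_sup [set 'E_(P x)[fun w => (Y 1%R w : 'cV[R]_d) i 0%R]
                 | x in @orthant R d] < +oo)%E.
Hypothesis hM : strong_markov F P Z.
Hypothesis hR : Rmat \in unitmx.
Variable m : borel R d -> option 'I_d -> {measure set (borel R d) -> \bar R}.
Hypothesis hm : forall x, orthant x -> occupation_family P Z Y mu Sigma Rmat x (m x).

Local Notation S t h x := (\int[P x]_w h (Z t w)).
Local Notation OR := (orthant : set (borel R d)).

Let hF : filtration F. Proof. exact: srbm_filtration hSRBM. Qed.
Let aZ : adapted F (fun t => Z t : Omega -> borel R d). Proof. exact: srbm_adapted hSRBM. Qed.
Let oZ : forall t w, 0 <= t -> orthant (Z t w). Proof. exact: srbm_orthant hSRBM. Qed.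
Let hZ0 : forall x, orthant x -> {ae P x, forall w, Z 0 w = x}. Proof. exact: srbm_start hSRBM. Qed.
Let mZ t : measurable_fun setT (Z t : Omega -> borel R d). Proof. exact: measurable_funPT. Qed.

Definition carrier (c : option 'I_d) : set 'cV[R]_d := if c is Some i then face i else orthant.

Lemma measurable_carrier c : measurable (carrier c : set (borel R d)).
Proof. by case: c => [i|]; [apply: borel_closed; exact: closed_face|exact: measurable_orthant]. Qed.

Lemma mass_bound : exists2 Cb : R, 0 <= Cb & forall c z, orthant z -> (m z c setT <= Cb%:E)%E.
Proof.
have [C C0 hC] := regulator_bound hSRBM hY.
(* [C] bounds the expected regulators and 1 is the mass of the time clock. *)
exists (C + 1); first exact: addr_ge0.
move=> c z z0; have mfin := of_finite (hm z0) c.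
rewrite -[m z c setT]fineK ?ge0_fin_numE// lee_fin.
have <- : \int[m z c]_y (1 : R) = fine (m z c setT).
  by transitivity (1 * fine (m z c setT)); [exact: Rintegral_cst|rewrite mul1r].
rewrite (of_mass (hm z0)); case: c mfin => [i|] _ /=.
  by rewrite (le_trans (hC z i z0))// lerDl.
by rewrite Rintegral1 lerDr.
Qed.

Lemma occupation_mass z : orthant z -> \int[m z None]_y (1 : R) = 1.
Proof. by move=> z0; rewrite (of_mass (hm z0)) /= Rintegral1. Qed.

Lemma transition_integral t x (h : borel R d -> R) C : measurable_fun setT h -> (forall y, `|h y| <= C) ->
  \int[transition P Z t x]_y h y = S t h x.
Proof.
move=> mh hC; rewrite (Rintegral_shift (probability_lty _) mh hC).
have mhZ : measurable_fun setT (fun w => h (Z t w)) by exact: measurableT_comp.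
rewrite (Rintegral_shift (probability_lty (P x)) mhZ (fun w => hC _)).
congr (fine _ - C * fine _).
rewrite ge0_integral_distribution//.
  by apply/measurable_EFinP; exact: measurable_funD.
by move=> y; rewrite lee_fin; have := hC y; rewrite ler_norml => /andP[]; lra.
Qed.

Variables (x0 x1 : 'cV[R]_d) (rp rn : {measure set (borel R d) -> \bar R}).
Hypotheses (x00 : orthant x0) (x10 : orthant x1).
Hypotheses (rpf : (rp setT < +oo)%E) (rnf : (rn setT < +oo)%E).
Hypothesis hrho : forall (h : borel R d -> R) C, measurable_fun setT h -> (forall x, `|h x| <= C) ->
  \sum_(0 <= k < n) (\int[transition P Z k%:R x1]_x h x - \int[transition P Z k%:R x0]_x h x) @[n --> \oo] -->
    \int[rp]_x h x - \int[rn]_x h x.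

Definition one_step (t : R) (h : borel R d -> R) (z : borel R d) : R :=
  if `[< @orthant R d z >] then S t h z - h z else 0.

Lemma one_stepE t h z : one_step t h z =
  (if `[< @orthant R d z >] then S t h z else 0) - (if `[< @orthant R d z >] then h z else 0).
Proof. by rewrite /one_step; case: ifP => _ //; rewrite subr0. Qed.

Lemma restrict_measurable (B : set (borel R d)) (h : borel R d -> R) : measurable B -> measurable_fun setT h ->
  measurable_fun setT (fun z => if `[< B z >] then h z else 0).
Proof.
move=> mB mh; rewrite (_ : (fun z => _) = (fun z => h z * \1_B z)).
  by apply: measurable_funM => //; exact: measurable_indic.
apply/funext => z; rewrite indicE; have -> : (z \in B) = `[< B z >] by apply/idP/asboolP; rewrite inE.
by case: asboolP => _; rewrite ?mulr1 ?mulr0.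
Qed.

Section bounded.
Variables (h : borel R d -> R) (C : R).
Hypotheses (mh : measurable_fun setT h) (hC : forall x, `|h x| <= C).

Let C0 : 0 <= C. Proof. exact: le_trans (hC (0 : 'cV[R]_d)). Qed.

Lemma one_step_measurable t : 0 <= t -> measurable_fun setT (one_step t h).
Proof.
move=> t0; rewrite (funext (one_stepE t h)); apply: measurable_funB.
  exact: (semigroup_measurable hM mh hC t0).
by apply: restrict_measurable => //; exact: measurable_orthant.
Qed.

Lemma one_step_le t z : `|one_step t h z| <= C + C.
Proof.
rewrite /one_step; case: ifP => _; last by rewrite normr0 addr_ge0.
by apply: le_trans (ler_normB _ _) _; rewrite lerD//; exact: (semigroup_le _ _ mh hC).
Qed.

(** Applied to [P_1 h - h], the series telescopes to [- (h x1 - h x0)] plus a term at time [n] that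
    vanishes in the limit. *)
Lemma potential_one_step : \int[rp]_z one_step 1 h z - \int[rn]_z one_step 1 h z = h x0 - h x1.
Proof.
(* This is the general term of the convergent series [hrho], hence tends to 0. *)
have tail : S k%:R h x1 - S k%:R h x0 @[k --> \oo] --> (0 : R).
  have := hrho mh hC; move=> /cvgP /cvg_series_cvg_0.
  by under eq_fun do rewrite !(transition_integral _ _ mh hC).
have step k x : orthant x -> \int[transition P Z k%:R x]_z one_step 1 h z = S k.+1%:R h x - S k%:R h x.
  move=> xo; rewrite (transition_integral _ _ (one_step_measurable ler01) (one_step_le 1)).
  rewrite -[k.+1%:R]natr1 -(@chapman_kolmogorov _ _ _ _ _ _ _ hF aZ oZ hM h C mh hC x k%:R 1)//.
  have mk : measurable_fun setT (fun w => if `[< @orthant R d (Z k%:R w) >] then S 1 h (Z k%:R w) else 0).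
    exact: (measurableT_comp (semigroup_measurable hM mh hC ler01) (mZ k%:R)).
  rewrite -RintegralB//.
  - apply: eq_Rintegral => w _; rewrite /one_step; case: asboolP => // n.
    by exfalso; apply: n; exact: oZ.
  - apply: (bounded_integrable _ mk (C := C)); first exact: probability_lty.
    by move=> w; case: asboolP => _; [exact: (semigroup_le _ _ mh hC)|rewrite normr0].
  - exact: (semigroup_integrable _ _ mh hC).
have lim1 := hrho (one_step_measurable ler01) (one_step_le 1).
have lim2 : \sum_(0 <= k < n) (\int[transition P Z k%:R x1]_x one_step 1 h x
    - \int[transition P Z k%:R x0]_x one_step 1 h x) @[n --> \oo] --> 0 - (h x1 - h x0).
  rewrite (_ : (fun n => _) = (fun n => (S n%:R h x1 - S n%:R h x0) - (h x1 - h x0))).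
    by apply: cvgB tail _; exact: cvg_cst.
  apply/funext => n.
  transitivity (\sum_(0 <= k < n) ((S k.+1%:R h x1 - S k.+1%:R h x0) - (S k%:R h x1 - S k%:R h x0))).
    by apply: eq_bigr => k _; rewrite !step//; ring.
  rewrite (telescope_sumr (fun k => S k%:R h x1 - S k%:R h x0))//; congr (_ - _).
  by rewrite !(semigroup0 hZ0 mh).
by rewrite -[RHS]opprB -[RHS]sub0r; exact: (cvg_unique _ lim1 lim2).
Qed.

End bounded.

(** The process stays in the orthant, so each term of the series assigns it mass [1 - 1 = 0]. *)
Lemma potential_orthant : \int[rp]_z (\1_OR z : R) = \int[rn]_z (\1_OR z : R).
Proof.
have mI : measurable_fun setT (\1_OR : borel R d -> R) by apply: measurable_indic; exact: measurable_orthant.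
have bI z : `|\1_OR z : R| <= 1 by rewrite indicE; case: (_ \in _); rewrite ?normr1 ?normr0.
have := hrho mI bI; rewrite (_ : (fun n => _) = cst 0).
  move=> h; apply/eqP; rewrite -subr_eq0; apply/eqP; apply: esym.
  exact: (cvg_unique _ (cvg_cst _) h).
apply/funext => n; rewrite big1// => k _; rewrite !(transition_integral _ _ mI bI).
suff E x : S k%:R (\1_OR : borel R d -> R) x = 1 by rewrite !E subrr.
rewrite -[RHS](Rintegral1 (P x)); apply: eq_Rintegral => w _; rewrite indicE mem_set//; exact: oZ.
Qed.

Variables (mp mn : option 'I_d -> {measure set (borel R d) -> \bar R}).
Hypothesis mpE : forall c (h : borel R d -> R) C, measurable_fun setT h -> (forall x, `|h x| <= C) ->
    \int[mp c]_x h x = \int[rp]_z kernel_apply OR (fun z => m z c) h z.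
Hypothesis mnE : forall c (h : borel R d -> R) C, measurable_fun setT h -> (forall x, `|h x| <= C) ->
    \int[mn c]_x h x = \int[rn]_z kernel_apply OR (fun z => m z c) h z.

Definition operator_density (Df : 'I_d -> 'cV[R]_d -> R) (Hf : 'I_d -> 'I_d -> 'cV[R]_d -> R)
    (c : option 'I_d) (x : 'cV[R]_d) : R :=
  if c is Some i then \sum_j Rmat j i * Df j x
  else \sum_j mu j 0 * Df j x + 2^-1 * \sum_j \sum_k Sigma j k * Hf j k x.

(** Charges are integrated over their carrier; cutting the integrand down turns this into
    integration over the whole space. *)
Definition carried (c : option 'I_d) (h : 'cV[R]_d -> R) (x : 'cV[R]_d) : R :=
  if `[< carrier c x >] then h x else 0.

Lemma operator_density_cont f Df Hf C c : test_data f Df Hf C -> continuous (operator_density Df Hf c).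
Proof.
move=> [_ _ Dc Hc _ _ _ _ _ _ _]; case: c => [i|] x /=.
  apply: continuous_sum => j y; apply: (@cvgM _ _ (nbhs y)); [exact: cvg_cst|exact: Dc].
apply: (@cvgD _ _ _ (nbhs x)).
  apply: continuous_sum => j y; apply: (@cvgM _ _ (nbhs y)); [exact: cvg_cst|exact: Dc].
apply: (@cvgM _ _ (nbhs x)); first exact: cvg_cst.
apply: continuous_sum => j y; apply: continuous_sum => k {}y.
by apply: (@cvgM _ _ (nbhs y)); [exact: cvg_cst|exact: Hc].
Qed.

Lemma operator_density_le f Df Hf C : test_data f Df Hf C ->
  exists K, forall c x, `|operator_density Df Hf c x| <= K.
Proof.
move=> [_ _ _ _ _ _ _ C0 _ DC HC].
pose K1 := \sum_j \sum_i `|Rmat j i| * C; pose K2 := \sum_j `|mu j 0| * C.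
pose K3 := \sum_j \sum_k `|Sigma j k| * C.
have p (a : R) : 0 <= `|a| * C by rewrite mulr_ge0// ltW.
have K10 : 0 <= K1 by apply: sumr_ge0 => j _; exact: sumr_ge0.
have K20 : 0 <= K2 by exact: sumr_ge0.
have K30 : 0 <= K3 by apply: sumr_ge0 => j _; exact: sumr_ge0.
exists (K1 + K2 + K3) => -[i|] x /=.
  rewrite -addrA; apply: (@le_trans _ _ K1); last by rewrite lerDl addr_ge0.
  apply: le_trans (ler_norm_sum _ _ _) _; apply: ler_sum => j _.
  rewrite (bigD1 i)//= normrM; apply: (@le_trans _ _ (`|Rmat j i| * C)); first by rewrite ler_wpM2l.
  by rewrite lerDl sumr_ge0.
rewrite -addrA; apply: (@le_trans _ _ (K2 + K3)); last by rewrite lerDr.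
apply: le_trans (ler_normD _ _) _; apply: lerD.
  apply: le_trans (ler_norm_sum _ _ _) _; apply: ler_sum => j _.
  by rewrite normrM ler_wpM2l.
rewrite normrM gtr0_norm ?invr_gt0//; apply: (@le_trans _ _ (1 * `|\sum_j \sum_k Sigma j k * Hf j k x|)).
  by rewrite ler_wpM2r// invf_le1// ler1n.
rewrite mul1r; apply: le_trans (ler_norm_sum _ _ _) _; apply: ler_sum => j _.
apply: le_trans (ler_norm_sum _ _ _) _; apply: ler_sum => k _.
by rewrite normrM ler_wpM2l.
Qed.

Lemma carried_measurable c (h : 'cV[R]_d -> R) : continuous h ->
  measurable_fun setT (carried c h : borel R d -> R).
Proof.
move=> hc; apply: (@restrict_measurable (carrier c) h); first exact: measurable_carrier.
exact: borel_continuous.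
Qed.

Lemma carried_le c (h : 'cV[R]_d -> R) K x : (forall x, `|h x| <= K) -> `|carried c h x| <= K.
Proof. by move=> hK; rewrite /carried; case: ifP => // _; rewrite normr0 (le_trans _ (hK x)). Qed.

Lemma carried_occupation z c (h : 'cV[R]_d -> R) : orthant z -> continuous h ->
  \int[m z c]_x carried c h x = \int[m z c]_x h x.
Proof.
move=> z0 hc; apply: (eq_Rintegral_null (measurable_carrier c) (of_support (hm z0) c)).
- exact: carried_measurable.
- exact: borel_continuous.
- by move=> x cx; rewrite /carried; case: asboolP.
Qed.

(** At each [z] in the orthant, Dynkin's formula identifies the sum over clocks of the kernel
    integrals with [P_1 f z - f z]; then [potential_one_step] evaluates the mixture. *)
Lemma potential_balance f Df Hf C : test_data f Df Hf C ->
  \sum_c (\int[mp c]_x carried c (operator_density Df Hf c) x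
          - \int[mn c]_x carried c (operator_density Df Hf c) x) = f x0 - f x1.
Proof.
move=> td; have [K hK] := operator_density_le td.
have oc c := @operator_density_cont _ _ _ _ c td.
have [Cb Cb0 hCb] := mass_bound.
pose V c : borel R d -> R := carried c (operator_density Df Hf c).
have mV c : measurable_fun setT (V c) by exact: carried_measurable.
have VK c x : `|V c x| <= K by apply: carried_le; exact: hK.
have mka c : measurable_fun setT (kernel_apply OR (fun z => m z c) (V c)).
  apply: (kernel_apply_measurable measurable_orthant _ _ (mV c) (VK c)).
    by move=> B mB; exact: (occupation_measurable hSRBM hY hM hR hm).
  by move=> z; exact: hCb.
have kab c z : `|kernel_apply OR (fun z => m z c) (V c) z| <= `|K| * Cb.
  by apply: (kernel_apply_le Cb0 _ (mV c) (VK c)) => z'; exact: hCb.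
have ika (r : {measure set (borel R d) -> \bar R}) c : (r setT < +oo)%E ->
    r.-integrable setT (EFin \o kernel_apply OR (fun z => m z c) (V c)).
  by move=> rf; exact: (bounded_integrable rf (mka c) (kab c)).
rewrite sumrB.
rewrite (eq_bigr (fun c => \int[rp]_z kernel_apply OR (fun z => m z c) (V c) z)); last first.
  by move=> c _; exact: (mpE _ (mV c) (VK c)).
rewrite [X in _ - X](eq_bigr (fun c => \int[rn]_z kernel_apply OR (fun z => m z c) (V c) z)); last first.
  by move=> c _; exact: (mnE _ (mV c) (VK c)).
rewrite -!Rintegral_fsum; [|by move=> c; exact: ika|by move=> c; exact: ika].
pose fp : 'cV[R]_d -> R := f \o pos_part.
have [_ _ Dc Hc _ _ fc C0 fC DC HC] := td.
have fpc : continuous fp := continuous_pos_part fc.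
have fpC x : `|fp x| <= C by apply: fC; exact: pos_part_orthant.
have fpE x : orthant x -> fp x = f x by move=> xo; rewrite /fp /= pos_part_id.
have key z : \sum_c kernel_apply OR (fun z => m z c) (V c) z = one_step 1 fp z.
  rewrite /one_step; case: asboolP => zo; last first.
    by rewrite big1// => c _; rewrite /kernel_apply; case: asboolP.
  rewrite (eq_bigr (fun c => \int[m z c]_x operator_density Df Hf c x)); last first.
    move=> c _; rewrite /kernel_apply; case: asboolP => // _; exact: carried_occupation.
  rewrite (_ : S 1 fp z = S 1 f z); last first.
    by apply: eq_Rintegral => w _; rewrite fpE//; exact: oZ.
  rewrite (fpE _ zo) (of_dynkin (hm zo) td) !big_option /=.
  have iD c j : (m z c).-integrable setT (EFin \o (Df j : borel R d -> R)).
    exact: (bounded_integrable (of_finite (hm zo) c) (borel_continuous (Dc j)) (DC j)).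
  have iH c j k : (m z c).-integrable setT (EFin \o (Hf j k : borel R d -> R)).
    exact: (bounded_integrable (of_finite (hm zo) c) (borel_continuous (Hc j k)) (HC j k)).
  rewrite [RHS]addrAC; congr (_ + _).
    rewrite RintegralD//; last 2 first.
    - by apply: integrable_fsum => j; apply: integrable_Zl; exact: iD.
    - apply: integrable_Zl; apply: integrable_fsum => j; apply: integrable_fsum => k; apply: integrable_Zl; exact: iH.
    congr (_ + _).
      rewrite Rintegral_fsum; last by move=> j; apply: integrable_Zl; exact: iD.
      by apply: eq_bigr => j _; rewrite RintegralZl//; exact: iD.
    rewrite RintegralZl//; last first.
      by apply: integrable_fsum => j; apply: integrable_fsum => k; apply: integrable_Zl; exact: iH.
    congr (_ * _); rewrite Rintegral_fsum; last first.
      by move=> j; apply: integrable_fsum => k; apply: integrable_Zl; exact: iH.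
    apply: eq_bigr => j _; rewrite Rintegral_fsum; last by move=> k; apply: integrable_Zl; exact: iH.
    by apply: eq_bigr => k _; rewrite RintegralZl//; exact: iH.
  apply: eq_bigr => i _; rewrite Rintegral_fsum; last by move=> j; apply: integrable_Zl; exact: iD.
  by apply: eq_bigr => j _; rewrite RintegralZl//; exact: iD.
rewrite (funext key) -(fpE x0 x00) -(fpE x1 x10).
exact: (potential_one_step (borel_continuous fpc) fpC).
Qed.

End construction.

(** Telescoping with lag [L]: the middle terms cancel and [L] terms survive at each end. *)
Lemma sum_shift_sub (V : zmodType) (a : nat -> V) n L :
  \sum_(k < n) (a (k + L)%N - a k) = \sum_(k < L) (a (n + k)%N - a k).
Proof.
elim: n => [|n ih]; first by rewrite big_ord0 big1// => k _; rewrite add0n subrr.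
rewrite big_ord_recr/= ih.
have <- : \sum_(k < L) (a (n + k.+1)%N - a (n + k)%N) = a (n + L)%N - a n.
  by rewrite -(big_mkord xpredT (fun k => a (n + k.+1)%N - a (n + k)%N)) (telescope_sumr (fun k => a (n + k)%N))// addn0.
rewrite -big_split; apply: eq_bigr => k _ /=.
by rewrite addnS addSn addrC addrA subrK.
Qed.

(** * Nontriviality of the signed measure *)

Section separation.
Context {R : realType} {d : nat} {dO} {Omega : measurableType dO}.
Variables (F : R -> set (set Omega)) (P : borel R d -> probability Omega R).
Variables (Z : R -> {mfun Omega >-> borel R d}) (Y : R -> Omega -> borel R d).
Variables (mu : 'cV[R]_d) (Sigma Rmat : 'M[R]_d).
Hypothesis hF : filtration F.
Hypothesis aZ : adapted F (fun t => Z t : Omega -> borel R d).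
Hypothesis oZ : forall t w, 0 <= t -> orthant (Z t w).
Hypothesis hM : strong_markov F P Z.
Hypothesis hZ0 : forall x, orthant x -> {ae P x, forall w, Z 0 w = x}.
Hypothesis hfeller : feller P Z.
Variable m : borel R d -> option 'I_d -> {measure set (borel R d) -> \bar R}.
Hypothesis hm : forall x, orthant x -> occupation_family P Z Y mu Sigma Rmat x (m x).

Local Notation S t h x := (\int[P x]_w h (Z t w)).
Local Notation OR := (orthant : set (borel R d)).

Section average.
Variables (phi : 'cV[R]_d -> R) (C : R).
Hypotheses (phic : continuous phi) (phiC : forall x, `|phi x| <= C).

Let mphi : measurable_fun setT (phi : borel R d -> R). Proof. exact: borel_continuous. Qed.

Let mZ t : measurable_fun setT (Z t : Omega -> borel R d).
Proof. exact: measurable_funPT. Qed.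

Let CK x s u : orthant x -> 0 <= s -> 0 <= u -> \int[P x]_w (S u phi (Z s w)) = S (s + u) phi x.
Proof.
move=> x0 s0 u0; rewrite -(chapman_kolmogorov hF aZ oZ hM mphi phiC x0 s0 u0).
by apply: eq_Rintegral => w _; case: asboolP => // n; exfalso; apply: n; exact: oZ.
Qed.

Let iS x s u : 0 <= s -> 0 <= u -> (P x).-integrable setT (EFin \o (fun w => S u phi (Z s w))).
Proof.
move=> s0 u0; apply: (bounded_integrable _ _ (C := C)); first exact: probability_lty.
  have := measurableT_comp (semigroup_measurable hM mphi phiC u0) (mZ s).
  apply: eq_measurable_fun => w _ /=; case: asboolP => // n; exfalso; apply: n; exact: oZ.
by move=> w; exact: (semigroup_le _ _ mphi phiC).
Qed.

(* The mesh 1/((M+1)(L+1)) divides the lag 1/(M+1), so that the sum over the times k/((M+1)(L+1))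
   telescopes to its first and last L+1 terms. *)
Lemma riemann_sum_telescope (q : 'cV[R]_d -> R) M L z : orthant z ->
  (forall y, orthant y -> q y = S M.+1%:R^-1 phi y - phi y) ->
  M.+1%:R * riemann_sum P Z Y None q z (M.+1 * L.+1).-1 =
  L.+1%:R^-1 * \sum_(k < L.+1) (S (1 + k%:R / (M.+1 * L.+1)%:R) phi z - S (k%:R / (M.+1 * L.+1)%:R) phi z).
Proof.
move=> z0 qE; pose N := (M.+1 * L.+1)%N; pose a k := S (k%:R / N%:R) phi z.
have N0 : (N%:R : R) != 0 by rewrite pnatr_eq0.
have NE : N = N.-1.+1 by [].
have h0 : 0 <= M.+1%:R^-1 :> R by rewrite invr_ge0.
rewrite /riemann_sum -NE.
rewrite (eq_bigr (fun k : 'I_N => N%:R^-1 * (a (k + L.+1)%N - a k))); last first.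
  move=> k _; have g0 : 0 <= (k%:R / N%:R : R) by rewrite divr_ge0.
  rewrite /clock_increment /= grid_step -NE /grid -NE.
  transitivity (\int[P z]_w (N%:R^-1 * (S M.+1%:R^-1 phi (Z (k%:R / N%:R) w) - phi (Z (k%:R / N%:R) w)))).
    by apply: eq_Rintegral => w _; rewrite qE; [rewrite mulrC|exact: oZ].
  have i1 := iS z g0 h0; have i2 := semigroup_integrable P Z mphi phiC z (k%:R / N%:R).
  rewrite RintegralZl//; last exact: (@integrableB _ _ _ _ _ measurableT (EFin \o _) (EFin \o _) i1 i2).
  congr (_ * _); rewrite RintegralB// CK//; congr (_ - _); rewrite /a; congr (S _ phi z).
  by rewrite natrD mulrDl; congr (_ + _); rewrite /N natrM invfM mulrCA divff ?mulr1// pnatr_eq0.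
rewrite -mulr_sumr (sum_shift_sub a) mulrA.
congr (_ * _).
  by rewrite /N natrM invfM mulrA divff ?mul1r// pnatr_eq0.
by apply: eq_bigr => k _; rewrite /a natrD mulrDl divff.
Qed.

(** With [h = 1/(M+1)], the scaled integral of [q] is the average of [P_s phi z] over [[1, 1 + h]]
    minus that over [[0, h]]. Each is within [eps] of its value at the left end. *)
Lemma average_estimate (q : 'cV[R]_d -> R) Cq M eps z : orthant z -> continuous q ->
  (forall y, `|q y| <= Cq) -> (forall y, orthant y -> q y = S M.+1%:R^-1 phi y - phi y) ->
  (forall s x, orthant x -> 0 <= s -> s <= M.+1%:R^-1 -> `|S s phi x - phi x| <= eps) ->
  `|M.+1%:R * \int[m z None]_y q y - (S 1 phi z - phi z)| <= eps + eps.
Proof.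
move=> z0 qc qC qE heps.
have lim := of_riemann (hm z0) (c := None) qc qC.
(* The Riemann sums may be followed along the meshes for which they telescope. *)
have sub : (M.+1 * L.+1).-1 @[L --> \oo] --> \oo.
  apply/cvgnyPge => A; near=> L; apply: leq_trans (_ : L <= _)%N; first by near: L; exact: nbhs_infty_ge.
  by rewrite -ltnS prednK ?muln_gt0//; exact: leq_pmull.
have lim1 : `|M.+1%:R * riemann_sum P Z Y None q z (M.+1 * L.+1).-1 - (S 1 phi z - phi z)| @[L --> \oo] -->
    `|M.+1%:R * \int[m z None]_y q y - (S 1 phi z - phi z)|.
  apply: cvg_norm; apply: cvgB; last exact: cvg_cst.
  apply: cvgMr; exact: (cvg_comp _ _ sub lim).
apply: (cvgr_to_le lim1); near=> L.
rewrite (riemann_sum_telescope L z0 qE).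
have L0 : (L.+1%:R : R) != 0 by rewrite pnatr_eq0.
rewrite (_ : S 1 phi z - phi z = L.+1%:R^-1 * \sum_(k < L.+1) (S 1 phi z - phi z)); last first.
  by rewrite sumr_const card_ord -[X in _ * X]mulr_natl mulrA mulVf// mul1r.
rewrite -mulrBr -sumrB normrM gtr0_norm ?invr_gt0// mulrC ler_pdivrMr// mulr_natr.
apply: le_trans (ler_norm_sum _ _ _) _.
rewrite -[X in _ <= _ *+ X]card_ord -sumr_const; apply: ler_sum => k _.
set s := k%:R / _.
have s0 : 0 <= s by rewrite divr_ge0.
have sM : s <= M.+1%:R^-1.
  rewrite /s natrM invfM mulrCA ler_piMr ?invr_ge0// ler_pdivrMr// mul1r ler_nat; exact: ltnW.
have e1 : `|S (1 + s) phi z - S 1 phi z| <= eps.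
  rewrite -(CK z0 ler01 s0).
  have i1 := iS z ler01 s0; have i2 := semigroup_integrable P Z mphi phiC z 1.
  rewrite -RintegralB//; have iB := @integrableB _ _ _ _ _ measurableT (EFin \o _) (EFin \o _) i1 i2.
  rewrite -[leRHS]mulr1 -[X in _ <= _ * X](congr1 fine (probability_setT (P z))).
  apply: Rintegral_norm_le; first exact: probability_lty.
    by apply/measurable_EFinP; exact: measurable_int iB.
  by move=> w; apply: heps => //; exact: oZ.
have e2 : `|S s phi z - phi z| <= eps by exact: heps.
rewrite (_ : _ - _ = (S (1 + s) phi z - S 1 phi z) - (S s phi z - phi z)); last by ring.
by apply: le_trans (ler_normB _ _) _; exact: lerD.
Unshelve. all: by end_near. Qed.

End average.

Variables (x0 x1 : 'cV[R]_d) (rp rn : {measure set (borel R d) -> \bar R}) (Cb : R).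
Hypotheses (rpf : (rp setT < +oo)%E) (rnf : (rn setT < +oo)%E).
Hypothesis rho_step : forall (h : borel R d -> R) C, measurable_fun setT h -> (forall x, `|h x| <= C) ->
  \int[rp]_z one_step P Z 1 h z - \int[rn]_z one_step P Z 1 h z = h x0 - h x1.
Hypothesis mK : forall B, measurable B -> measurable_fun OR (fun z => m z None B).
Hypotheses (Cb0 : 0 <= Cb) (mCb : forall z, orthant z -> (m z None setT <= Cb%:E)%E).
Hypothesis vanishing : forall (h : borel R d -> R) C, measurable_fun setT h -> (forall x, `|h x| <= C) ->
  \int[rp]_z kernel_apply OR (fun z => m z None) h z = \int[rn]_z kernel_apply OR (fun z => m z None) h z.

Lemma feller_uniform (phi : 'cV[R]_d -> R) eps : C0_orthant phi -> 0 < eps ->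
  exists2 del, 0 < del & forall s x, orthant x -> 0 < s -> s < del -> `|S s phi x - phi x| <= eps.
Proof.
move=> phi0 e0; have [_ /(_ phi phi0)] := hfeller.
move=> /(_ [set y | (y < eps%:E)%E]) lim.
have /lim : nbhs (0%E : \bar R) [set y | (y < eps%:E)%E].
  change (nbhs (0 : R) (fun r : R => (r%:E < eps%:E)%E)).
  apply/nbhs_ballP; exists eps => // r; rewrite -ball_normE /= sub0r normrN lte_fin.
  exact: le_lt_trans (ler_norm r).
rewrite /= /at_right /= => /nbhs_ballP[del /= del0 hdel].
exists del => // s x xo s0 sdel.
have := hdel s; rewrite -ball_normE /= sub0r normrN gtr0_norm// => /(_ sdel s0) hs.
rewrite -lee_fin; apply: le_trans (ltW hs); apply: ereal_sup_ubound; exists x => //.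
by rewrite semigroupE.
Qed.

Lemma no_separation (phi : 'cV[R]_d -> R) C : continuous phi -> (forall x, `|phi x| <= C) ->
  C0_orthant phi -> phi x0 = phi x1.
Proof.
move=> phic phiC phi0; apply/eqP; rewrite -subr_eq0; apply/negP => nz.
have mphi : measurable_fun setT (phi : borel R d -> R) by exact: borel_continuous.
pose T := fine (rp setT) + fine (rn setT).
have T0 : 0 <= T by rewrite addr_ge0 ?fine_ge0.
pose dist := `|phi x0 - phi x1|.
have dist0 : 0 < dist by rewrite normr_gt0; apply/negP.
(* The estimate will give [dist <= 2 eps T], which this choice makes at most [dist / 2]. *)
pose eps := dist / (4 * (T + 1)).
have T1 : 0 < T + 1 by rewrite ltr_pwDr.
have e0 : 0 < eps by rewrite divr_gt0// mulr_gt0.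
have [del del0 hdel] := feller_uniform phi0 e0.
have [M hM'] : exists M, M.+1%:R^-1 < del.
  have [M _ h] := near_infty_natSinv_lt (PosNum del0); by exists M; apply: (h M) => /=.
have heps s x : orthant x -> 0 <= s -> s <= M.+1%:R^-1 -> `|S s phi x - phi x| <= eps.
  move=> xo; rewrite le_eqVlt => /predU1P[<- _|s0 sM]; last by apply: hdel => //; exact: le_lt_trans hM'.
  by rewrite (semigroup0 hZ0 mphi xo) subrr normr0 ltW.
pose h : R := M.+1%:R^-1.
have h0 : 0 <= h by rewrite invr_ge0.
(* The Feller property gives continuity of [P_h phi] on the orthant only; [pos_part] extends [q] to
   a continuous function on the whole space. *)
pose q (y : 'cV[R]_d) := S h phi (pos_part y) - phi (pos_part y).
have ccS : {within orthant, continuous (fun y : 'cV[R]_d => S h phi y)}.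
  have [/(_ h phi h0 phi0) [+ _] _] := hfeller.
  by rewrite (_ : semigroup P Z h phi = (fun y => S h phi y))//; apply/funext => y; rewrite semigroupE.
have qc : continuous q.
  move=> y; apply: (@cvgB _ _ _ (nbhs y)); first exact: (continuous_pos_part ccS).
  apply: (continuous_pos_part (f := phi)); exact: continuous_subspaceT.
have qC y : `|q y| <= C + C.
  by apply: le_trans (ler_normB _ _) _; rewrite lerD//; exact: (semigroup_le _ _ mphi phiC).
have qE y : orthant y -> q y = S M.+1%:R^-1 phi y - phi y by move=> yo; rewrite /q pos_part_id.
pose K := kernel_apply OR (fun z => m z None).
have mq := borel_continuous qc.
have mKq : measurable_fun setT (K q) by exact: (kernel_apply_measurable measurable_orthant mK mCb mq qC).
have Kq z : `|K q z| <= `|C + C| * Cb by apply: (kernel_apply_le Cb0 _ mq qC) => z'; exact: mCb.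
pose E := one_step P Z 1 (phi : borel R d -> R).
have mE : measurable_fun setT E by exact: (one_step_measurable hM mphi phiC ler01).
have EC z : `|E z| <= C + C by exact: (one_step_le _ _ mphi phiC).
(* Since [vanishing] removes the term with [K q], the difference of the integrals of [E] equals that
   of [D], which is uniformly small. *)
pose D z := E z - M.+1%:R * K q z.
have mD : measurable_fun setT D by apply: measurable_funB => //; exact: measurable_funM.
have De z : `|D z| <= eps + eps.
  rewrite /D /E /K /one_step /kernel_apply; case: asboolP => zo.
    by rewrite distrC; exact: (average_estimate phic phiC zo qc qC qE heps).
  by rewrite mulr0 subrr normr0 addr_ge0// ltW.
have split (r : {measure set (borel R d) -> \bar R}) : (r setT < +oo)%E ->
    \int[r]_z D z = \int[r]_z E z - M.+1%:R * \int[r]_z K q z.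
  move=> rf; have i1 := bounded_integrable rf mE EC; have i2 := bounded_integrable rf mKq Kq.
  rewrite RintegralB//; last exact: integrable_Zl.
  by rewrite RintegralZl.
have := rho_step mphi phiC; rewrite -/E.
have -> : \int[rp]_z E z - \int[rn]_z E z = \int[rp]_z D z - \int[rn]_z D z.
  by rewrite (split rp rpf) (split rn rnf) /K (vanishing mq qC); ring.
move=> eq; have : dist <= (eps + eps) * T.
  rewrite /dist -eq; apply: le_trans (ler_normB _ _) _; rewrite mulrDr.
  by apply: lerD; exact: Rintegral_norm_le.
have : eps * (4 * (T + 1)) = dist by rewrite /eps divfK// mulf_neq0// lt0r_neq0.
have : 0 <= eps * T by rewrite mulr_ge0// ltW.
lra.
Qed.
End separation.

(** * A test function that separates two points *)

Section bump.
Context {R : realType} {d : nat}.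

Lemma trmx_continuous : continuous (fun v : 'rV[R]_d => v^T).
Proof.
move=> v; apply/(@cvgrPdist_le _ _ _ (nbhs v)) => e e0; near=> u.
have uv : `|v - u| <= e by near: u; apply: cvgr_dist_le.
apply/cV_normP; first exact: ltW.
move=> i; rewrite !mxE; apply: le_trans uv.
rewrite [leRHS]/Num.Def.normr /= mx_normrE.
by apply: le_trans (le_bigmax _ _ (0, i)); rewrite !mxE.
Unshelve. all: by end_near. Qed.

(** A tent centred at [x1] whose radius is the distance to [x0]: it is 1 at [x1] and 0 at [x0]. *)
Lemma separating_bump (x0 x1 : 'cV[R]_d) : x0 != x1 -> exists phi : 'cV[R]_d -> R,
  [/\ continuous phi, forall x, `|phi x| <= 1, C0_orthant phi & phi x0 != phi x1].
Proof.
move=> x01; pose del := `|x0 - x1|.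
have del0 : 0 < del by rewrite normr_gt0 subr_eq0.
pose phi (x : 'cV[R]_d) : R := Num.max 0 (1 - `|x - x1| / del).
have phic : continuous phi.
  rewrite (_ : phi = fun x => (0 + (1 - `|x - x1| / del) + `|0 - (1 - `|x - x1| / del)|) / 2); last first.
    by apply/funext => x; rewrite /phi maxr_absE.
  move=> x; have c1 : 1 - `|y - x1| / del @[y --> nbhs x] --> 1 - `|x - x1| / del.
    apply: (@cvgB _ _ _ (nbhs x)); first exact: cvg_cst.
    apply: (@cvgM _ _ (nbhs x)); last exact: cvg_cst.
    apply: (@cvg_norm _ _ _ (nbhs x)); apply: (@cvgB _ _ _ (nbhs x)); [exact: cvg_id|exact: cvg_cst].
  have z : (0 : R) @[y --> nbhs x] --> (0 : R) by exact: cvg_cst.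
  apply: (@cvgM _ _ (nbhs x)); last exact: cvg_cst.
  apply: (@cvgD _ _ _ (nbhs x)); first exact: (@cvgD _ _ _ (nbhs x)).
  by apply: (@cvg_norm _ _ _ (nbhs x)); exact: (@cvgB _ _ _ (nbhs x)).
exists phi; split => //.
- by move=> x; rewrite ger0_norm ?le_max ?lexx// ge_max ler01 /= gerBl divr_ge0// ltW.
- split; first exact: (continuous_subspaceT phic).
  move=> e e0; pose B (i : 'I_d) : set R := `[x1 i 0 - del, x1 i 0 + del]%classic.
  (* [rV_compact] concerns row vectors, so the compact box containing the support is transported by
     the transpose. *)
  exists [set v^T | v in [set v : 'rV[R]_d | forall i, B i (v ord0 i)]].
    apply: continuous_compact; first exact: continuous_subspaceT trmx_continuous.
    by apply: rV_compact => i; exact: segment_compact.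
  move=> x _ nK; suff -> : phi x = 0 by rewrite normr0.
  apply/max_idPl; rewrite subr_le0 ler_pdivlMr// mul1r leNgt; apply/negP => xd.
  apply: nK; exists x^T; last by rewrite trmxK.
  move=> i /=; rewrite /B /= in_itv /= mxE; have := cV_coord_le (x - x1) i; rewrite !mxE => h.
  have : `|x i 0 - x1 i 0| <= del by apply: le_trans h (ltW xd).
  by rewrite ler_norml => /andP[? ?]; apply/andP; split; lra.
- have -> : phi x1 = 1 by rewrite /phi subrr normr0 mul0r subr0; apply/max_idPr.
  have -> : phi x0 = 0 by rewrite /phi divff ?lt0r_neq0// subrr; apply/max_idPl.
  by rewrite eq_sym oner_neq0.
Qed.

End bump.

Section signed.
Context d (T : measurableType d) (R : realType).
Implicit Types m lam : {measure set T -> \bar R}.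

Lemma add_scaled_measure m lam (a : R) : (m setT < +oo)%E -> (lam setT < +oo)%E -> 0 <= a ->
  exists m' : {measure set T -> \bar R}, [/\ (m' setT < +oo)%E,
    forall A, m' A = (m A + a%:E * lam A)%E &
    forall (F : T -> R) C, measurable_fun setT F -> (forall x, `|F x| <= C) ->
      \int[m']_x F x = \int[m]_x F x + a * \int[lam]_x F x].
Proof.
move=> mf lf a0; pose l2 : {measure set T -> \bar R} := mscale (NngNum a0) lam.
have l2E A : l2 A = (a%:E * lam A)%E by [].
have l2f : (l2 setT < +oo)%E.
  by rewrite l2E lte_mul_pinfty// ge0_fin_numE.
have E A : measure_add m l2 A = (m A + l2 A)%E by exact: measure_addE.
exists (measure_add m l2); split.
- by have := lte_add_pinfty mf l2f; rewrite -E.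
- exact: E.
- move=> F C mF FC; rewrite (Rintegral_measure_sum mf l2f (fun A _ => E A) mF FC); congr (_ + _).
  rewrite (Rintegral_shift l2f mF FC) (Rintegral_shift lf mF FC) mulrBr.
  rewrite (_ : fine (l2 setT) = a * fine (lam setT)); last by rewrite l2E fineM// ge0_fin_numE.
  congr (_ - _); last by rewrite mulrCA.
  rewrite -[a]/(fine a%:E) -fineM//; last exact: shift_fin_num FC.
  congr fine; rewrite ge0_integral_mscale//; last first.
    by move=> x _; rewrite lee_fin; have := FC x; rewrite ler_norml => /andP[]; lra.
  by apply/measurable_EFinP; exact: measurable_funD.
Qed.

(** [h] is controlled on [D] only, as an [extension] is; [g] is its measurable version, set to 0
    elsewhere. *)
Lemma charge_integral_difference (nu : {charge set T -> \bar R}) m1 m2 (D : set T) (h g : T -> R) C :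
  (m1 setT < +oo)%E -> (m2 setT < +oo)%E -> (forall A, measurable A -> nu A = (m1 A - m2 A)%E) ->
  (forall x, D x -> h x = g x) -> (forall x, ~ D x -> g x = 0) ->
  measurable_fun setT g -> (forall x, `|g x| <= C) ->
  charge_integral nu D h = \int[m1]_x g x - \int[m2]_x g x.
Proof.
move=> f1 f2 nuE hg g0 mg gC; rewrite -(jordan_integral f1 f2 nuE mg gC) /charge_integral.
have E (m : {measure set T -> \bar R}) : \int[m]_(x in D) h x = \int[m]_x g x.
  rewrite /Rintegral integral_mkcond; congr fine; apply: eq_integral => x _.
  by rewrite patchE; case: ifPn => [/set_mem/hg ->|/negP xD]//; rewrite g0// => /mem_set.
by rewrite !E.
Qed.

End signed.

Theorem theorem6p4 (R : realType) (d : nat)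
    (mu : 'cV[R]_d) (Sigma Rmat : 'M[R]_d)
    (hSigma : posdefmx Sigma)
    (hRunit : Rmat \in unitmx) (hRS : completely_S Rmat)
    (dO : measure_display) (Omega : measurableType dO)
    (F : R -> set (set Omega)) (P : borel R d -> probability Omega R)
    (Z : R -> {mfun Omega >-> borel R d}) (W Y : R -> Omega -> borel R d)
    (hSRBM : is_SRBM F P Z mu Sigma Rmat W Y)
    (pi0 : probability (borel R d) R)
    (hpi0 : stationary_probability P Z pi0)
    (hmarkov : strong_markov F P Z)
    (hfeller : feller P Z)
    (V : 'cV[R]_d -> R) (M kappa : R)
    (hV1 : forall x, orthant x -> 1 <= V x)
    (hVloc : [locally [bounded V x | x in orthant]])
    (hM : 0 < M) (hkappa : 0 < kappa)
    (herg : exponentially_ergodic P Z pi0 V M kappa)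
    (hY : forall i : 'I_d,
      (ereal_sup [set 'E_(P x)[fun w => (Y 1%R w : 'cV[R]_d) i 0%R]
                 | x in @orthant R d] < +oo)%E)
    (A : {set 'I_d}) (hA0 : A != finset.set0) (hAT : A != finset.setT)
    (hA : principal_submx Rmat A \notin unitmx) :
  exists (pi : {charge set (borel R d) -> \bar R})
         (nu : 'I_d -> {charge set (borel R d) -> \bar R}),
    [/\ signed_BAR_tuple mu Sigma Rmat pi nu,
        pi (@orthant R d) = 0%E,
        exists2 B : set (borel R d), measurable B & pi B <> 0%E &
        ~ exists c : R, forall B : set (borel R d), measurable B ->
            pi B = (c%:E * pi0 B)%E].
Proof.
have [v [w0 vA wA]] := singular_direction hRunit hA.
set w := Rmat *m v in w0 wA.
(* With absolute values both [x0] and [x0 + w] are in the orthant, and both vanish in every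
   coordinate where [w] does, in particular in those of [A]. *)
pose x0 : 'cV[R]_d := \col_i `|w i 0|; pose x1 := x0 + w.
have x00 : orthant x0 by move=> i; rewrite mxE.
have x10 : orthant x1 by move=> i; rewrite !mxE -lerBlDr sub0r -normrN ler_norm.
have x01 : x0 != x1 by rewrite -subr_eq0 /x1 opprD addrA subrr sub0r oppr_eq0.
have [m hm] := occupation_family_exists hSRBM hY.
have [Cb Cb0 hCb] := mass_bound hSRBM hY hm.
have mK c B : measurable B -> measurable_fun (orthant : set (borel R d)) (fun z => m z c B).
  by move=> mB; exact: (occupation_measurable hSRBM hY hmarkov hRunit hm).
have [rp [rn [rpf rnf hrho]]] : exists rp rn : {measure set (borel R d) -> \bar R},
    [/\ (rp setT < +oo)%E, (rn setT < +oo)%E &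
    forall (h : borel R d -> R) C, measurable_fun setT h -> (forall x, `|h x| <= C) ->
      \sum_(0 <= k < n) (\int[transition P Z k%:R x1]_x h x - \int[transition P Z k%:R x0]_x h x) @[n --> \oo] -->
      \int[rp]_x h x - \int[rn]_x h x].
  have V0 x : orthant x -> 0 <= V x by move=> xo; exact: le_trans (hV1 x xo).
  have devE k x B : measurable B -> transition_deviation P Z pi0 k x B = (transition P Z k x B - pi0 B)%E.
    by move=> mB; rewrite /transition_deviation /cadd /= /copp /= .
  (* At integer times the exponential bound is geometric of ratio [expR (- kappa)]; [V x0 + V x1]
     serves for both starting points. *)
  have tv k x : orthant x -> V x <= V x0 + V x1 -> (tv_norm (transition_deviation P Z pi0 k%:R x) <=
      ((M * (V x0 + V x1)) * expR (- kappa) ^+ k)%:E)%E.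
    move=> xo Vx; apply: le_trans (herg x k%:R xo (ler0n _ _)) _.
    by rewrite lee_fin mulrC [- kappa * _]mulrC expRM_natl mulrC ler_wpM2r ?exprn_ge0 ?expR_ge0// ler_pM2l.
  apply: (@potential _ (borel R d) R (fun k => transition P Z k%:R x1) (fun k => transition P Z k%:R x0) pi0
    (fun k => transition_deviation P Z pi0 k%:R x1) (fun k => transition_deviation P Z pi0 k%:R x0)
    (M * (V x0 + V x1)) (expR (- kappa))).
  - by move=> k; exact: probability_lty.
  - by move=> k; exact: probability_lty.
  - exact: probability_lty.
  - by move=> k B; exact: devE.
  - by move=> k B; exact: devE.
  - by rewrite mulr_ge0 ?(ltW hM)// addr_ge0// V0.
  - exact: expR_ge0.
  - by rewrite expR_lt1 oppr_lt0.
  - by move=> k; apply: tv => //; rewrite lerDr V0.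
  - by move=> k; apply: tv => //; rewrite lerDl V0.
have hF := srbm_filtration hSRBM.
have aZ : adapted F (fun t => Z t : Omega -> borel R d) by exact: (srbm_adapted hSRBM).
have oZ : forall t w, 0 <= t -> orthant (Z t w) by exact: (srbm_orthant hSRBM).
have hZ0 : forall x, orthant x -> {ae P x, forall w, Z 0 w = x} by exact: (srbm_start hSRBM).
have KCb c z : orthant z -> (m z c setT <= Cb%:E)%E by exact: hCb.
have [mp hmp] := choice (fun c => mixture measurable_orthant (mK c) Cb0 (KCb c) rpf).
have [mn hmn] := choice (fun c => mixture measurable_orthant (mK c) Cb0 (KCb c) rnf).
have mpf c : (mp c setT < +oo)%E by have [] := hmp c.
have mnf c : (mn c setT < +oo)%E by have [] := hmn c.
have mpE c (h : borel R d -> R) C : measurable_fun setT h -> (forall x, `|h x| <= C) ->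
    \int[mp c]_x h x = \int[rp]_z kernel_apply (orthant : set (borel R d)) (fun z => m z c) h z.
  by have [_ _] := hmp c; apply.
have mnE c (h : borel R d -> R) C : measurable_fun setT h -> (forall x, `|h x| <= C) ->
    \int[mn c]_x h x = \int[rn]_z kernel_apply (orthant : set (borel R d)) (fun z => m z c) h z.
  by have [_ _] := hmn c; apply.
have off c (B : set (borel R d)) : measurable B -> B `&` carrier c = set0 -> mp c B = 0%E /\ mn c B = 0%E.
  move=> mB Bc; have z0 z : orthant z -> m z c B = 0%E.
    move=> zo; apply/eqP; rewrite -measure_le0 -(of_support (hm z zo) c).
    apply: le_measure; rewrite ?inE//; first by apply: measurableC; exact: measurable_carrier.
    by move=> y By cy; have : (B `&` carrier c) y by []; rewrite Bc.
  by have [_ h1 _] := hmp c; have [_ h2 _] := hmn c; split; [exact: h1|exact: h2].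
have [lam [lamf lam0 hlam]] := segment_measure x00 x10.
(* The segment law receives the signed weight [v i]; its positive and negative parts are added to
   the two halves of the charge [nu i]. *)
pose vp i : R := Num.max (v i 0) 0; pose vn i : R := Num.max (- v i 0) 0.
have vp0 i : 0 <= vp i by rewrite le_max lexx orbT.
have vn0 i : 0 <= vn i by rewrite le_max lexx orbT.
have vE i : vp i - vn i = v i 0 by rewrite /vp /vn !maxr_absE !addr0 !subr0 normrN; lra.
have [n1 hn1] := choice (fun i => add_scaled_measure (mpf (Some i)) lamf (vp0 i)).
have [n2 hn2] := choice (fun i => add_scaled_measure (mnf (Some i)) lamf (vn0 i)).
have n1f i : (n1 i setT < +oo)%E by have [] := hn1 i.
have n2f i : (n2 i setT < +oo)%E by have [] := hn2 i.
have [pi piE] := charge_difference (mpf None) (mnf None).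
have [nu nuE] := choice (fun i => charge_difference (n1f i) (n2f i)).
(* For [i] in [A], the coordinate [i] of every point [x0 + u *: w] is 0, so the whole segment lies
   in the face. *)
have lam_face i (B : set (borel R d)) : i \in A -> measurable B -> B `&` face i = set0 -> lam B = 0%E.
  move=> iA mB Bi; apply: lam0 => // u /andP[u0 u1] Bu.
  have xu j : (x0 + u *: w) j 0 = `|w j 0| + u * w j 0 by rewrite !mxE.
  have : (B `&` face i) (x0 + u *: w).
    split=> //; split; last by rewrite xu wA// normr0 mulr0 addr0.
    move=> j; rewrite xu -lerBlDr sub0r -mulrN; apply: le_trans (ler_norm _) _.
    by rewrite normrM normrN ger0_norm// ler_piMl.
  by rewrite Bi.
have v_off i : i \notin A -> vp i = 0 /\ vn i = 0.
  by move=> /vA v0; rewrite /vp /vn v0 oppr0 maxxx.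
have mI : measurable_fun setT (\1_(orthant : set (borel R d)) : borel R d -> R).
  by apply: measurable_indic; exact: measurable_orthant.
have bI z : `|\1_(orthant : set (borel R d)) z : R| <= 1.
  by rewrite indicE; case: (_ \in _); rewrite ?normr1 ?normr0.
have pi0E : pi (@orthant R d) = 0%E.
  have indE (k : {measure set (borel R d) -> \bar R}) : (k setT < +oo)%E ->
      k (orthant : set (borel R d)) = (\int[k]_z (\1_(orthant : set (borel R d)) z : R))%:E.
    move=> kf; rewrite /Rintegral integral_indic ?setIT//; last exact: measurable_orthant.
    by rewrite fineK//; apply: measure_fin_num => //; exact: measurable_orthant.
  (* The time kernel is a probability on the orthant, so applying it to the indicator of the orthant
     gives the indicator back, and [pi] has the mass of the potential. *)
  have KI z : kernel_apply (orthant : set (borel R d)) (fun z => m z None) (\1_(orthant : set (borel R d))) z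
      = \1_(orthant : set (borel R d)) z.
    rewrite /kernel_apply [RHS]indicE; case: asboolP => zo; last by rewrite memNset.
    rewrite mem_set// -(occupation_mass hm zo).
    apply: (eq_Rintegral_null measurable_orthant (of_support (hm z zo) None)) => // y yo.
    by rewrite indicE mem_set.
  rewrite piE (indE _ (mpf None)) (indE _ (mnf None)) (mpE None _ _ mI bI) (mnE None _ _ mI bI) (funext KI).
  by rewrite (potential_orthant hSRBM hrho) subee.
have piN : exists2 B : set (borel R d), measurable B & pi B <> 0%E.
  apply: contrapT => /forall2NP nB.
  (* A vanishing charge means that the two mixtures for the time clock coincide; this is the
     hypothesis [vanishing] of [no_separation]. *)
  have mpn (B : set (borel R d)) : measurable B -> mp None B = mn None B.
    move=> mB; have [//|/contrapT] := nB B; rewrite piE.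
    have := measure_fin_num (mpf None) mB; have := measure_fin_num (mnf None) mB.
    by case: (mn None B) (mp None B) => [y| |] [x| |]//= _ _ [/subr0_eq ->].
  have [phi [phic phi1 phi0 phin]] := separating_bump x01.
  move/eqP : phin; apply.
  apply: (no_separation hF aZ oZ hmarkov hZ0 hfeller hm rpf rnf _ _ Cb0 _ _ phic phi1 phi0).
  - move=> h C mh hC.
    exact: (potential_one_step hSRBM hmarkov x00 x10 hrho mh hC).
  - exact: mK.
  - by move=> z; exact: hCb.
  - move=> h C mh hC; rewrite -(mpE None h C mh hC) -(mnE None h C mh hC).
    rewrite /Rintegral; congr fine; apply: eq_measure_integral => B mB _; exact: mpn.
exists pi, nu; split => //; last first.
  (* Evaluating on the orthant, where [pi0] is 1 and [pi] is 0, gives [c = 0] and hence [pi = 0]. *)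
  move=> [c hc]; have [B mB] := piN; apply.
  have : (c%:E * pi0 (orthant : set (borel R d)) = 0)%E.
    by rewrite -hc ?pi0E//; exact: measurable_orthant.
  have [-> _] := hpi0; rewrite mule1 => -[c0].
  by rewrite hc// c0 mul0e.
split.
- move=> B mB Bo; rewrite piE; have [-> ->] := off None B mB Bo; exact: sube0.
- move=> i B mB Bi; rewrite nuE; have [_ -> _] := hn1 i; have [_ -> _] := hn2 i.
  have [-> ->] := off (Some i) B mB Bi; rewrite !add0e.
  have [iA|iA] := boolP (i \in A); first by rewrite (lam_face i B iA mB Bi) !mule0 sube0.
  by have [-> ->] := v_off i iA; rewrite !mul0e sube0.
- move=> f Cf; have [Df [Hf [C [td DE HE]]]] := Cb2_test_data Cf.
  have [K hK] := operator_density_le mu Sigma Rmat td.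
  have oc c : continuous (operator_density mu Sigma Rmat Df Hf c) by exact: operator_density_cont td.
  pose G c := carried c (operator_density mu Sigma Rmat Df Hf c).
  have mG c : measurable_fun setT (G c : borel R d -> R) by exact: (carried_measurable _ (oc c)).
  have GK c x : `|G c x| <= K by apply: carried_le; exact: hK.
  have G0 c x : ~ carrier c x -> G c x = 0 by move=> nc; rewrite /G /carried; case: asboolP.
  rewrite (charge_integral_difference (mpf None) (mnf None) (fun B _ => piE B) _ (@G0 None) (mG None) (GK None)); last first.
    move=> x xo; rewrite /G /carried; case: asboolP => // _; rewrite /generator /=.
    congr (_ + _ * _); first by apply: eq_bigr => j _; rewrite DE.
    by apply: eq_bigr => j _; apply: eq_bigr => k _; rewrite HE.
  (* Separates the mixtures, governed by [potential_balance], from the contribution of the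
     segment. *)
  rewrite (eq_bigr (fun i => (\int[mp (Some i)]_x G (Some i) x - \int[mn (Some i)]_x G (Some i) x)
      + \sum_j v i 0 * (Rmat j i * \int[lam]_x Df j x))); last first.
    move=> i _.
    rewrite (charge_integral_difference (n1f i) (n2f i) (fun B _ => nuE i B) _ (@G0 (Some i)) (mG (Some i)) (GK (Some i))); last first.
      move=> x xi; rewrite /G /carried; case: asboolP => // _; rewrite /reflection_op /=.
      by apply: eq_bigr => j _; rewrite DE//; case: xi.
    have [_ _ E1] := hn1 i; have [_ _ E2] := hn2 i.
    rewrite (E1 _ _ (mG (Some i)) (GK (Some i))) (E2 _ _ (mG (Some i)) (GK (Some i))) opprD addrACA -mulrBl vE.
    congr (_ + _); rewrite -mulr_sumr.
    have [iA|iA] := boolP (i \in A); last by rewrite vA// !mul0r.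
    congr (_ * _).
    have iD j : lam.-integrable setT (EFin \o (Df j : borel R d -> R)).
      have [_ _ Dc _ _ _ _ _ _ DC _] := td.
      exact: (bounded_integrable lamf (borel_continuous (Dc j)) (DC j)).
    transitivity (\int[lam]_x (\sum_j Rmat j i * Df j x)); last first.
      rewrite Rintegral_fsum; last by move=> j; apply: integrable_Zl; exact: iD.
      by apply: eq_bigr => j _; rewrite RintegralZl//; exact: iD.
    apply: (eq_Rintegral_null (measurable_carrier (Some i))).
    - apply: (lam_face i) => //; first by apply: measurableC; exact: (measurable_carrier (Some i)).
      by rewrite setICl.
    - exact: mG.
    - exact: (borel_continuous (oc (Some i))).
    - by move=> x xi; rewrite /G /carried; case: asboolP.
  rewrite big_split /= addrA.
  have := potential_balance hSRBM hY hmarkov hRunit hm x00 x10 rpf rnf hrho mpE mnE td.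
  rewrite big_option /= => ->.
  have := hlam f Df Hf C td; rewrite -/x1 => E.
  (* Summing over [i] first forms [Rmat *m v = w], so the segment contributes the increment of [f]
     along [w], opposite to the error of the mixtures. *)
  rewrite (_ : \sum_i \sum_j _ = f x1 - f x0); first by rewrite addrC subrKA subrr.
  rewrite E exchange_big /=; apply: eq_bigr => j _.
  rewrite {1}/w mxE mulr_suml; apply: eq_bigr => i _; ring.
Qed.
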